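(* Let $l>1$ be an integer, let $t_1<t_2<\cdots<t_l$ be an increasing sequence of real numbers, and let $\lambda:\{1,\dots,l-1\}\to\{0,1\}$ be a map. Then for every sufficiently large integer $m$ there exist an $m$-dimensional non-singular real algebraic connected manifold $M$ with no boundary, a smooth real algebraic function $f:M\to\mathbb{R}$, an integer $n\ge 3$, an NC semi-algebraic set $D\subset\mathbb{R}^n$ with associated real polynomials $f_1,\dots,f_r$ in $n$ variables and hypersurfaces $S_1,\dots,S_r$, and a smooth real algebraic map $f_D:M\to\mathbb{R}^n$, such that all of the following hold. (1) $f(M)=[t_1,t_l]$ and $f(S(f))=\{t_1,\dots,t_l\}$. (2) For every $t\in f(M)$ the preimage $f^{-1}(t)$ is connected and homeomorphic to a CW complex of dimension at most $m-1$. (3) For each $j\in\{1,\dots,l-1\}$ and each $t\in(t_j,t_{j+1})$: if $\lambda(j)=0$, then $f^{-1}(t)$ is a smooth compact submanifold with no boundary; if $\lambda(j)=1$, then $f^{-1}(t)$ is a smooth non-compact submanifold with no boundary. (4) $f=\pi_{n,1}\circ f_D$. (5) $M$ is a connected component of the real algebraic set defined by some $r$ real polynomials; $f_D(M)=\overline{D}$; $f_D(S(f_D))=\overline{D}-D$; and for each point $p$ the preimage $f_D^{-1}(p)$ is at most $(m-n)$-dimensional and, if $p\in D$, it is a smooth submanifold diffeomorphic to a product of finitely many unit spheres. (6) $\overline{D}-D$ is a union of finitely many $(n-1)$-dimensional smooth connected submanifolds (boundary and corners allowed) of the hypersurfaces $S_1,\dots,S_r$, and each $S_j$ is a connected component of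 the real algebraic set defined by a single real polynomial of degree at most $2$. (7) Each $S_j$ is the product of a connected component of a hyperbola and a copy of the $(n-2)$-dimensional real affine space $\mathbb{R}^{n-2}$.
   Context: Real algebraic set: the common zero set in some $\mathbb{R}^k$ of finitely many real polynomials. Non-singular real algebraic manifold: a union of connected components of a real algebraic set which is non-singular, where non-singularity is defined by the rank of the differential of the map given by the defining polynomials (the rank equals the codimension at each point of the manifold). Maps between smooth manifolds are of class $C^\infty$. For a smooth map $c:X\to Y$ between smooth manifolds, a point $x\in X$ is singular if the rank of the differential of $c$ at $x$ is smaller than $\min\{\dim X,\dim Y\}$; $S(c)$ denotes the set of all singular points of $c$. $\pi_{n,1}:\mathbb{R}^n\to\mathbb{R}$ is the canonical projection $(x_1,\dots,x_n)\mapsto x_1$. $\overline{D}$ denotes the closure of $D$ in $\mathbb{R}^n$. The $k$-dimensional unit sphere is $S^k=\{x\in\mathbb{R}^{k+1}: \|x\|=1\}$, for $k\ge 0$. Hyperbola: for real numbers $a,b$ and $c\neq 0$, the set $\{(x_1,x_2)\in\mathbb{R}^2 : (x_1-a)(x_2-b)=c\}$; its two connected components are the parts where $x_2>b$ and where $x_2<b$. A hypersurface in $\mathbb{R}^n$ ''is the product of a connected component of a hyperbola and a copy of $\mathbb{R}^{n-2}$'' if, after identifying $\mathbb{R}^n$ with $\mathbb{R}^2\times\mathbb{R}^{n-2}$ by a real affine transformation, it equals $C\times\mathbb{R}^{n-2}$ with $C\subset\mathbb{R}^2$ a connected component of a hyperbola. NC (''normal and convenient'') semi-algebraic set: a connected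 open set $D\subset\mathbb{R}^n$ such that: (i) there exist a positive integer $r$ and a family $\{f_j\}_{j=1}^r$ of real polynomials in $n$ variables; (ii) $D=\bigcap_{j=1}^r\{x\in\mathbb{R}^n : f_j(x)>0\}$; (iii) $\overline{D}=\bigcap_{j=1}^r\{x\in\mathbb{R}^n : f_j(x)\ge 0\}$; (iv) for each $j$ a set $S_j$ is given which is the union of some of the connected components of $\{x\in\mathbb{R}^n: f_j(x)=0\}$ and is a non-singular real algebraic hypersurface with no boundary, and $\{x\in\mathbb{R}^n: f_j(x)=0\}-S_j$ is disjoint from $\overline{D}$; (v) (transversality) for every non-empty $\Lambda\subset\{1,\dots,r\}$, the intersection $\bigcap_{j\in\Lambda}S_j$ is either empty or a non-singular real algebraic manifold with no boundary of dimension $n-|\Lambda|$, and at each point $p$ of this intersection the image of the differential at $p$ of the inclusion $\bigcap_{j\in\Lambda}S_j\hookrightarrow\mathbb{R}^n$ coincides with the intersection over $j\in\Lambda$ of the images of the differentials at $p$ of the inclusions $S_j\hookrightarrow\mathbb{R}^n$. *)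

(* Defs.v *)
From mathcomp Require Export all_boot all_order all_algebra.
From mathcomp Require Export all_classical all_reals all_analysis.
(* The notations of mpoly clash with those of MathComp-Analysis. *)
From mathcomp Require Export -(notations) mpoly.
Export Order.TTheory GRing.Theory Num.Theory numFieldNormedType.Exports.

#[export] Set Implicit Arguments.
#[export] Unset Strict Implicit.
#[export] Unset Printing Implicit Defensive.

Local Open Scope classical_set_scope.
Local Open Scope ring_scope.

Section Euclidean.
Context {R : realType}.

(* The library norm on ['rV_n] is the sup norm; balls and spheres below are
   Euclidean. *)
Definition enorm n (x : 'rV[R]_n) : R := Num.sqrt (\sum_(i < n) x 0 i ^+ 2).

Definition eball n : set 'rV[R]_n := [set x | enorm x < 1].
Definition cball n : set 'rV[R]_n := [set x | enorm x <= 1].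
Definition usphere n : set 'rV[R]_n := [set x | enorm x = 1].

(* The product of the unit spheres of dimensions [ks i], sitting in the product
   of the spaces R^(ks i + 1). *)
Definition sphere_product q (ks : 'I_q -> nat) :
    set 'rV[R]_(\sum_(i < q) (ks i).+1) :=
  [set x | forall i : 'I_q,
     @usphere (ks i).+1 (submxrow (q_ := fun i => (ks i).+1) x i)].

Definition fiber (X Y : Type) (M : set X) (F : X -> Y) (y : Y) : set X :=
  M `&` F @^-1` [set y].

End Euclidean.

Arguments sphere_product {R q} ks _.

Section Smooth.
Context {R : realType}.

(* [U] is meant to be open. *)
Fixpoint Ck_on a (U : set 'rV[R]_a) (k : nat) (g : 'rV[R]_a -> R) : Prop :=
  match k with
  | 0 => forall x, U x -> {for x, continuous g}
  | k'.+1 => (forall x, U x -> differentiable g x) /\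
             (forall i : 'I_a, Ck_on U k' ('D_(delta_mx 0 i) g))
  end.

Definition smooth_open a b (U : set 'rV[R]_a) (F : 'rV[R]_a -> 'rV[R]_b) : Prop :=
  forall (j : 'I_b) (k : nat), Ck_on U k (fun x => F x 0 j).

(* Maps between subsets of Euclidean spaces are total functions considered only
   on their domain [A]; they are smooth when they locally extend to smooth maps
   on open subsets of the ambient space. *)
Definition smooth_on a b (A : set 'rV[R]_a) (F : 'rV[R]_a -> 'rV[R]_b) : Prop :=
  forall x, A x -> exists (U : set 'rV[R]_a) (G : 'rV[R]_a -> 'rV[R]_b),
    [/\ open U, U x, smooth_open U G & forall y, A y -> U y -> F y = G y].

Definition diffeo a b (A : set 'rV[R]_a) (B : set 'rV[R]_b)
    (h : 'rV[R]_a -> 'rV[R]_b) : Prop :=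
  exists g : 'rV[R]_b -> 'rV[R]_a,
    [/\ smooth_on A h, smooth_on B g,
        (forall x, A x -> B (h x) /\ g (h x) = x) &
        (forall y, B y -> A (g y) /\ h (g y) = y)].

Definition diffeomorphic a b (A : set 'rV[R]_a) (B : set 'rV[R]_b) : Prop :=
  exists h, diffeo A B h.

(* [phi] parametrizes, by an open subset [W] of R^d, an open neighbourhood of
   [x = phi w] in [A]. *)
Definition local_param d k (A : set 'rV[R]_k) (x : 'rV[R]_k)
    (W : set 'rV[R]_d) (phi : 'rV[R]_d -> 'rV[R]_k) (w : 'rV[R]_d) : Prop :=
  [/\ open W, W w, phi w = x &
      exists U : set 'rV[R]_k, open U /\ diffeo W (A `&` U) phi].

Definition submanifold d k (A : set 'rV[R]_k) : Prop :=
  forall x, A x -> exists (W : set 'rV[R]_d) phi w, local_param A x W phi w.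

(* Manifolds with (possibly empty) boundary and corners, modelled on open
   subsets of [0, +oo)^d. *)
Definition submanifold_corners d k (A : set 'rV[R]_k) : Prop :=
  forall x, A x -> exists (U : set 'rV[R]_k) (W : set 'rV[R]_d),
    [/\ open U, U x, open W &
        diffeomorphic (W `&` [set w | forall i, 0 <= w 0 i]) (A `&` U)].

(* The image of the differential at [x] of the inclusion of the d-dimensional
   submanifold [A] in R^k.  Jacobians act on row vectors from the right. *)
Definition tangent_space d k (A : set 'rV[R]_k) (x : 'rV[R]_k) : set 'rV[R]_k :=
  [set v | exists (W : set 'rV[R]_d) phi w (u : 'rV[R]_d),
     local_param A x W phi w /\ v = u *m jacobian phi w].

(* The rank of the differential at [x] of a map [F] on [A] is computed in a
   local parametrization of [A]; it does not depend on the choice of the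
   latter. *)
Definition singular_set d k b (A : set 'rV[R]_k) (F : 'rV[R]_k -> 'rV[R]_b) :
    set 'rV[R]_k :=
  [set x | A x /\ exists (W : set 'rV[R]_d) phi w,
     local_param A x W phi w /\
     (\rank (jacobian (F \o phi) w) < minn d b)%N].

(* Dimension of a semi-algebraic set, as the largest dimension of the smooth
   submanifolds that it contains; [e] is an integer so that differences of
   dimensions are not truncated. *)
Definition dim_le k (A : set 'rV[R]_k) (e : int) : Prop :=
  forall d (N : set 'rV[R]_k),
    N !=set0 -> submanifold d N -> N `<=` A -> d%:Z <= e.

End Smooth.

Arguments submanifold {R} d {k} A.
Arguments submanifold_corners {R} d {k} A.
Arguments tangent_space {R} d {k} A x.
Arguments singular_set {R} d {k b} A F.

Section CW.
Context {R : realType}.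

Definition homeo (X Y : topologicalType) (A : set X) (B : set Y) (h : X -> Y) :
    Prop :=
  exists g : Y -> X,
    [/\ {within A, continuous h}, {within B, continuous g},
        (forall x, A x -> B (h x) /\ g (h x) = x) &
        (forall y, B y -> A (g y) /\ h (g y) = y)].

Record CW_structure (T : topologicalType) (cell : nat -> Type)
    (chi : forall d, cell d -> 'rV[R]_d -> T) : Prop := {
  cw_hausdorff : hausdorff_space T;
  cw_char_continuous : forall d (c : cell d), {within @cball R d, continuous (chi d c)};
  cw_open_cell : forall d (c : cell d),
    homeo (@eball R d) (chi d c @` @eball R d) (chi d c);
  cw_disjoint : forall d (c : cell d) d' (c' : cell d'),
    chi d c @` @eball R d `&` chi d' c' @` @eball R d' !=set0 ->
    existT cell d c = existT cell d' c';
  cw_cover : forall y : T, exists d (c : cell d), (chi d c @` @eball R d) y;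
  cw_boundary : forall d (c : cell d),
    exists (N : nat) (e : 'I_N -> {d' : nat & cell d'}),
      (forall i, (tag (e i) < d)%N) /\
      chi d c @` @usphere R d `<=`
        \bigcup_i (chi (tag (e i)) (tagged (e i)) @` @eball R (tag (e i)));
  cw_weak_topology : forall A : set T,
    (forall d (c : cell d), closed (A `&` chi d c @` @cball R d)) -> closed A
}.

Definition homeomorphic_to_CW_dim_le (X : topologicalType) (A : set X) (e : int) :
    Prop :=
  exists (T : topologicalType) (cell : nat -> Type)
         (chi : forall d, cell d -> 'rV[R]_d -> T),
    [/\ CW_structure chi, (forall d, cell d -> d%:Z <= e) &
        exists h, homeo A [set: T] h].

End CW.

Arguments homeomorphic_to_CW_dim_le R {X} A e.

Section Algebraic.
Context {R : realType}.

Definition peval k (p : mpoly k R) (x : 'rV[R]_k) : R :=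
  meval (x 0) p.

Definition pmap k s (P : 'I_s -> mpoly k R) (x : 'rV[R]_k) : 'rV[R]_s :=
  \row_(j < s) peval (P j) x.

Definition zeros k s (P : 'I_s -> mpoly k R) : set 'rV[R]_k :=
  [set x | forall j, peval (P j) x = 0].

Definition is_component (X : topologicalType) (Z C : set X) : Prop :=
  exists2 x, Z x & C = connected_component Z x.

Definition union_of_components (X : topologicalType) (Z M : set X) : Prop :=
  M `<=` Z /\ forall x, M x -> connected_component Z x `<=` M.

(* The clause [submanifold m M] fixes the dimension: the rank condition alone
   would accept the origin of R^2, defined by x = y^2 = 0, as a 1-dimensional
   manifold. *)
Definition nonsingular_by k s (P : 'I_s -> mpoly k R) (m : nat)
    (M : set 'rV[R]_k) : Prop :=
  [/\ union_of_components (zeros P) M, submanifold m M, (m <= k)%N &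
      forall x, M x -> \rank (jacobian (pmap P) x) = (k - m)%N].

Definition nonsingular_ra_manifold k (m : nat) (M : set 'rV[R]_k) : Prop :=
  exists s (P : 'I_s -> mpoly k R), nonsingular_by P m M.

Definition smooth_ra_map k b (M : set 'rV[R]_k) (F : 'rV[R]_k -> 'rV[R]_b) : Prop :=
  smooth_on M F /\
  exists P : 'I_b -> mpoly k R, forall x, M x -> F x = pmap P x.

Record NC_set n r (f : 'I_r -> mpoly n R) (S : 'I_r -> set 'rV[R]_n)
    (D : set 'rV[R]_n) : Prop := {
  nc_open : open D;
  nc_connected : connected D;
  nc_pos : (0 < r)%N;
  nc_interior : D = [set x | forall j, 0 < peval (f j) x];
  nc_closure : closure D = [set x | forall j, 0 <= peval (f j) x];
  nc_hypersurface : forall j, nonsingular_by (fun _ : 'I_1 => f j) (n - 1) (S j);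
  nc_residue : forall j, (zeros (fun _ : 'I_1 => f j) `\` S j) `&` closure D = set0;
  nc_transverse : forall L : {set 'I_r}, L != finset.set0 ->
    let I := [set x | forall j, j \in L -> S j x] in
    I = set0 \/
    [/\ (#|L| <= n)%N, nonsingular_ra_manifold (n - #|L|) I &
        forall p, I p ->
          tangent_space (n - #|L|) I p =
          [set v | forall j, j \in L -> tangent_space (n - 1) (S j) p v]]
}.

(* A connected component of the hyperbola (x_1 - a)(x_2 - b) = c, [c != 0]. *)
Definition hyperbola_component (C : set 'rV[R]_2) : Prop :=
  exists a b c : R, c != 0 /\
    let H := [set x : 'rV[R]_2 | (x 0 0 - a) * (x 0 1 - b) = c] in
    C = H `&` [set x | b < x 0 1] \/ C = H `&` [set x | x 0 1 < b].

(* [x |-> x *m A + v] is the affine identification of R^(2 + q) with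
   R^2 x R^q, and [lsubmx] is the projection onto R^2. *)
Definition hyperbola_cylinder q (S : set 'rV[R]_(2 + q)) : Prop :=
  exists (A : 'M[R]_(2 + q)) (v : 'rV[R]_(2 + q)) (C : set 'rV[R]_2),
    [/\ A \in unitmx, hyperbola_component C &
        S = [set x | C (lsubmx (x *m A + v))]].

End Algebraic.

Arguments nonsingular_ra_manifold {R k} m M.
Arguments hyperbola_cylinder {R} q S.

(* Main.v *)
From HB Require Import structures.
Require Import Defs.
From mathcomp Require Import ring lra zify.

Local Open Scope classical_set_scope.
Local Open Scope ring_scope.

(* The domain D is cut out by forms f_j = (x_0 - b_j)(xi_j(x) - a_j) - c_j, with
   linear forms xi_j not involving x_0, and M is the set of the (x, y) such that
   |y_j|^2 = f_j(x) for all j, with the functions f = x_0 and f_D = x.  A point of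
   M is singular for f_D iff some f_j vanishes at x, and for f iff dx_0 is a
   combination of the differentials of the f_j that vanish at x.  The f_j are
   chosen so that, in the coordinates u = x_0 - a0, u X_i and Z_i on R^n, the
   first ones bound a simplex whose vertices lie over the t_j, which makes the
   t_j the critical values, while the others bound the Z_i from above except over
   the intervals [t_i, t_(i+1)] with lambda(i) = 1.
   All maps are quadratic, so the inverse function theorem is only needed for
   maps with F(x) - F(x') = (x - x') A(x + x') and A affine.  On a level of x_0
   the f_j are affine, so that replacing |y_j|_2^2 by |y_j|_oo turns a fibre of f
   into a polyhedron, with a CW structure given by bounded polytopes. *)

(** * Smooth maps *)

Section MatrixCalculus.
Context {R : realType}.

(** The domain is shaped by the demand that every wall be a genuine hyperbolic cylinder. In the
    coordinates (u, w) with w = u X, an affine form alpha + beta u + gamma.w reads alpha + u (beta +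
    gamma.X), which has the required shape as soon as alpha and gamma are nonzero: polytopes in (u,
    w) are available, provided that no wall passes through the origin. This is why lam_i is 1 + u
    X_i and not u X_i, and why the heights must be close to each other. A simplex is chosen because
    its facets are in general position and a linear function on it is critical only on faces of
    constant height. Its levels are compact, since u stays away from 0. Non-compactness is therefore
    delegated to separate coordinates Z_i: the wall 1 + (u - al) Z_i = 0 gives the bound 1/(al - u),
    which escapes to infinity at the pole u = al, and such walls carry zero multipliers at critical
    points. The price is the other branch of each hyperbola, kept off the closure by Z_i >= -1/u.
    All spheres have dimension at least 1, which keeps everything over a connected set connected;
    enlarging one of them reaches every large m. *)

Lemma near_open (T : topologicalType) (U : set T) x :
  open U -> U x -> \forall y \near x, U y.
Proof. by move=> oU Ux; apply: open_nbhs_nbhs. Qed.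

Lemma coord_le_norm m n (x : 'M[R]_(m, n)) i j : `|x i j| <= `|x|.
Proof.
rewrite [leRHS]/Num.Def.normr /= mx_normrE.
exact: (le_bigmax _ (fun p : 'I_m * 'I_n => `|x p.1 p.2|) (i, j)).
Qed.

Lemma norm_le_coord m n (x : 'M[R]_(m, n)) (e : R) :
  0 <= e -> (forall i j, `|x i j| <= e) -> `|x| <= e.
Proof.
move=> e0 H; rewrite [leLHS]/Num.Def.normr /= mx_normrE.
by apply: bigmax_le => // -[i j] _; apply: H.
Qed.

Lemma rV_cvgP (T : Type) (F : set_system T) {FF : Filter F} m n
    (f : T -> 'M[R]_(m, n)) (l : 'M[R]_(m, n)) :
  (forall i j, f x i j @[x --> F] --> l i j) -> f @ F --> l.
Proof.
move=> H; apply/cvgrPdist_le => e e0.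
have : \forall x \near F, forall (p : 'I_m * 'I_n), `|l p.1 p.2 - f x p.1 p.2| <= e.
  apply: filter_forall => -[i j].
  by move/cvgrPdist_le : (H i j) => /(_ e e0).
apply: filterS => x Hx; apply: norm_le_coord; first exact: ltW.
by move=> i j; rewrite !mxE; exact: (Hx (i, j)).
Qed.

Lemma rV_continuous_at (T : topologicalType) m n (f : T -> 'M[R]_(m, n)) x :
  (forall i j, {for x, continuous (fun y => f y i j)}) -> {for x, continuous f}.
Proof. by move=> H; apply: rV_cvgP => i j; exact: H. Qed.

Lemma rV_continuous (T : topologicalType) m n (f : T -> 'M[R]_(m, n)) :
  (forall i j, continuous (fun y => f y i j)) -> continuous f.
Proof. by move=> H x; apply: rV_continuous_at => i j; exact: H. Qed.

Lemma continuous_at_sum (T : topologicalType) (I : Type) (r : seq I) (P : pred I)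
    (f : I -> T -> R) x : (forall i, P i -> {for x, continuous (f i)}) ->
  {for x, continuous (fun y => \sum_(i <- r | P i) f i y)}.
Proof.
move=> H.
elim: r => [|i r IH].
  rewrite (_ : (fun _ => _) = cst 0); first exact: cvg_cst.
  by apply/funext => y; rewrite big_nil.
case Pi : (P i); last first.
  rewrite (_ : (fun _ => _) = fun y => \sum_(j <- r | P j) f j y) //.
  by apply/funext => y; rewrite big_cons Pi.
rewrite (_ : (fun _ => _) = f i \+ fun y => \sum_(j <- r | P j) f j y).
  by apply: continuousD; [exact: H|exact: IH].
by apply/funext => y; rewrite big_cons Pi.
Qed.

Lemma coord_continuous_at (T : topologicalType) m n (f : T -> 'M[R]_(m, n)) i j x :
  {for x, continuous f} -> {for x, continuous (fun y => f y i j)}.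
Proof.
move=> cf; apply: (@continuous_comp _ _ _ f (fun M : 'M[R]_(m, n) => M i j)) => //.
exact: coord_continuous.
Qed.

Lemma mulmx_continuous_at (T : topologicalType) m n p
    (f : T -> 'M[R]_(m, n)) (g : T -> 'M[R]_(n, p)) x :
  {for x, continuous f} -> {for x, continuous g} ->
  {for x, continuous (fun y => f y *m g y)}.
Proof.
move=> cf cg; apply: rV_continuous_at => i j.
rewrite (_ : (fun _ => _) = fun y => \sum_k f y i k * g y k j); last first.
  by apply/funext => y; rewrite mxE.
apply: continuous_at_sum => k _.
by apply: continuousM; exact: coord_continuous_at.
Qed.

Lemma mulmxr_continuous m n p (A : 'M[R]_(n, p)) :
  continuous (fun x : 'M[R]_(m, n) => x *m A).
Proof. move=> x; apply: (@mulmx_continuous_at _ _ _ _ id (cst A)); first exact: cvg_id.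
exact: cst_continuous. Qed.

Lemma differentiable_rV (V : normedModType R) n (f : V -> 'rV[R]_n) x :
  (forall j, differentiable (fun y => f y 0 j) x) -> differentiable f x.
Proof.
move=> H.
rewrite (_ : f = \sum_(j < n) (fun y => f y 0 j *: delta_mx 0 j)); last first.
  apply/funext => y; rewrite {1}[f y]row_sum_delta.
  by rewrite fct_sumE.
apply: differentiable_sum => j.
exact: differentiableZl.
Qed.

Lemma jacobianE a b (f : 'rV[R]_a -> 'rV[R]_b) x v : 
  v *m jacobian f x = 'd f x v.
Proof. by rewrite /jacobian mul_rV_lin1. Qed.

Lemma diff_near (V W : normedModType R) (f : V -> W) (x : V)
    (df : {linear V -> W}) : continuous df ->
  (forall e : R, 0 < e -> \forall h \near (0 : V),
     `|f (h + x) - f x - df h| <= e * `|h|) ->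
  differentiable f x /\ 'd f x = df :> (V -> W).
Proof.
move=> cdf H.
have H1 : f \o shift x = cst (f x) + df +o_ 0 id.
  apply/eqaddoP => e e0; near=> h.
  rewrite !fctE /= opprD addrA; near: h; exact: H.
have dA := diff_unique cdf H1.
split => //; apply/diff_locallyP; split; first by rewrite dA.
by rewrite dA.
Unshelve. all: by end_near. Qed.

Lemma jacobian_unique a b (f : 'rV[R]_a -> 'rV[R]_b) (x : 'rV[R]_a)
    (A : 'M[R]_(a, b)) :
  (forall e : R, 0 < e -> \forall h \near (0 : 'rV[R]_a),
     `|f (h + x) - f x - h *m A| <= e * `|h|) ->
  differentiable f x /\ jacobian f x = A.
Proof.
move=> H.
have [df dA] := @diff_near _ _ f x (mulmxr A) (@mulmxr_continuous 1 a b A) H.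
split => //; apply/row_matrixP => i; rewrite !rowE jacobianE.
by have /(congr1 (fun F => F (delta_mx 0 i))) := dA.
Qed.
End MatrixCalculus.

(** * Stability of C^k functions under algebraic operations and affine substitution *)

Section CkTheory.
Context {R : realType}.
Implicit Types (a b k : nat).

Lemma near_eq_differentiable (V W : normedModType R) (f g : V -> W) x :
  (\near x, f x = g x) -> differentiable f x ->
  differentiable g x /\ 'd g x = 'd f x :> (V -> W).
Proof.
move=> fg df; apply: diff_near; first exact: diff_continuous.
move=> e e0.
have /eqaddoP H := diff_locally df.
have fg0 : \forall h \near (0 : V), f (h + x) = g (h + x).
  by move: fg; rewrite (near_shift 0) subr0.
near=> h.
have -> : g (h + x) = f (h + x) by apply/esym; near: h.
rewrite -(nbhs_singleton fg).
have : `|(f \o shift x - (cst (f x) + 'd f x)) h| <= e * `|h|.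
  by near: h; exact: H.
by rewrite !fctE /= opprD addrA.
Unshelve. all: by end_near. Qed.

Lemma derive_coord a (g : 'rV[R]_a -> R) x (v : 'rV[R]_a) : differentiable g x ->
  'D_v g x = \sum_i v 0 i * 'D_(delta_mx 0 i) g x.
Proof.
move=> dg; rewrite deriveE // [in LHS](row_sum_delta v) linear_sum.
by apply: eq_bigr => i _; rewrite linearZ /= -deriveE.
Qed.

(** Openness of [U] makes the iterated partial derivatives on [U] depend only on the values on [U].
    The rules below compute derivatives on [U] only and are transferred by this lemma to the total
    functions that [Ck_on] speaks about. *)
Lemma Ck_on_ext a (U : set 'rV[R]_a) k f g : open U ->
  (forall x, U x -> f x = g x) -> Ck_on U k f -> Ck_on U k g.
Proof.
move=> oU; elim: k f g => [|k IH] f g fg.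
  move=> H x Ux; have := H x Ux.
  have nfg : {near x, f =1 g} by apply: filterS (near_open oU Ux) => y /fg.
  rewrite /prop_for /continuous_at (fg x Ux).
  exact: cvg_trans (near_eq_cvg nfg).
move=> [d D]; split.
  move=> x Ux; apply: (proj1 (near_eq_differentiable _ (d x Ux))).
  by apply: filterS (near_open oU Ux) => y /fg.
move=> i; apply: IH (D i) => x Ux; apply: near_eq_derive.
by apply: filterS (near_open oU Ux) => y /fg.
Unshelve. all: by end_near. Qed.

Lemma Ck_on_S a (U : set 'rV[R]_a) k f : Ck_on U k.+1 f -> Ck_on U k f.
Proof.
elim: k f => [|k IH] f.
  by case=> d _ x /d /differentiable_continuous.
by case=> d D; split => // i; apply: IH.
Qed.

Lemma Ck_on_cst a (U : set 'rV[R]_a) k c : Ck_on U k (cst c).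
Proof.
elim: k c => [|k IH] c; first by move=> x _; exact: cst_continuous.
split=> [x _|i]; first exact: differentiable_cst.
rewrite (_ : 'D_(delta_mx 0 i) _ = cst 0) //.
by apply/funext => x; rewrite derive_cst.
Qed.

Lemma Ck_on_coord a (U : set 'rV[R]_a) k j : Ck_on U k (fun x => x 0 j).
Proof.
case: k => [|k]; first by move=> x _; exact: coord_continuous.
split=> [x _|i]; first exact: differentiable_coord.
rewrite (_ : 'D_(delta_mx 0 i) _ = cst ((delta_mx 0 i : 'rV[R]_a) 0 j)).
  exact: Ck_on_cst.
apply/funext => x; rewrite deriveE; last exact: differentiable_coord.
have @f : {linear 'rV[R]_a -> R}.
  by exists (fun N : 'rV[R]_a => N 0 j); do 2![eexists]; do ?[constructor];
     rewrite ?mxE// => ? *; rewrite ?mxE//; move=> ?; rewrite !mxE.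
by rewrite (_ : (fun _ => _) = f) // diff_lin //; exact: coord_continuous.
Qed.

Lemma Ck_onD a (U : set 'rV[R]_a) k f g : open U ->
  Ck_on U k f -> Ck_on U k g -> Ck_on U k (f \+ g).
Proof.
move=> oU; elim: k f g => [|k IH] f g.
  by move=> cf cg x Ux; apply: continuousD; [exact: cf|exact: cg].
move=> [df Df] [dg Dg]; split=> [x Ux|i].
  by apply: differentiableD; [exact: df|exact: dg].
apply: Ck_on_ext (IH _ _ (Df i) (Dg i)) => // x Ux.
by rewrite /= deriveD //; apply: diff_derivable; [exact: df|exact: dg].
Qed.

Lemma Ck_onM a (U : set 'rV[R]_a) k f g : open U ->
  Ck_on U k f -> Ck_on U k g -> Ck_on U k (f \* g).
Proof.
move=> oU; elim: k f g => [|k IH] f g.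
  by move=> cf cg x Ux; apply: continuousM; [exact: cf|exact: cg].
move=> Cf Cg; have [df Df] := Cf; have [dg Dg] := Cg; split=> [x Ux|i].
  by apply: differentiableM; [exact: df|exact: dg].
apply: Ck_on_ext (Ck_onD oU (IH _ _ (Ck_on_S Cf) (Dg i)) (IH _ _ (Ck_on_S Cg) (Df i))) => // x Ux.
by rewrite /= deriveM //; apply: diff_derivable; [exact: df|exact: dg].
Qed.

Lemma Ck_on_sum a (U : set 'rV[R]_a) k (I : Type) (r : seq I) (P : pred I)
    (f : I -> 'rV[R]_a -> R) : open U ->
  (forall i, P i -> Ck_on U k (f i)) ->
  Ck_on U k (fun x => \sum_(i <- r | P i) f i x).
Proof.
move=> oU H; rewrite -fct_sumE; elim/big_ind: _ => //; first exact: Ck_on_cst.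
by move=> f' g' Hf Hg; exact: Ck_onD.
Qed.

Lemma Ck_on_prod a (U : set 'rV[R]_a) k (I : Type) (r : seq I)
    (f : I -> 'rV[R]_a -> R) : open U ->
  (forall i, Ck_on U k (f i)) ->
  Ck_on U k (fun x => \prod_(i <- r) f i x).
Proof.
move=> oU H; elim: r => [|i r IH].
  by apply: Ck_on_ext (Ck_on_cst U k 1) => // x _; rewrite big_nil.
by apply: Ck_on_ext (Ck_onM oU (H i) IH) => // x _; rewrite big_cons.
Qed.

Lemma Ck_onV a (U : set 'rV[R]_a) k f : open U -> (forall x, U x -> f x != 0) ->
  Ck_on U k f -> Ck_on U k (fun x => (f x)^-1).
Proof.
move=> oU f0; elim: k => [|k IH].
  by move=> cf x Ux; apply: continuousV; [exact: f0|exact: cf].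
move=> Cf; have [df Df] := Cf; split=> [x Ux|i].
  by apply: differentiableV; [exact: df|exact: f0].
have CV := IH (Ck_on_S Cf).
apply: Ck_on_ext (Ck_onM oU (Ck_on_cst U k (-1)) (Ck_onM oU (Ck_onM oU CV CV) (Df i))) => // x Ux.
rewrite /= (deriveV (f0 x Ux)); last exact/diff_derivable/df.
by rewrite -invfM -expr2 mulN1r scaleNr.
Qed.

(** The partial derivatives of such a composite are constant combinations of composites of the same
    kind, so the induction closes without a chain rule of higher order. Affine inner maps suffice,
    since charts are built from a local inverse and affine maps. *)
Lemma Ck_on_comp_affine a b (V : set 'rV[R]_b) (U : set 'rV[R]_a) k
    (g : 'rV[R]_b -> R) (c : 'rV[R]_b) (A : 'M[R]_(a, b)) :
  open U -> (forall x, U x -> V (c + x *m A)) ->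
  Ck_on V k g -> Ck_on U k (fun x => g (c + x *m A)).
Proof.
move=> oU UV.
have DF0 x : differentiable (fun x : 'rV[R]_a => c + x *m A) x /\
    'd (fun x : 'rV[R]_a => c + x *m A) x = mulmxr A :> ('rV_a -> 'rV_b).
  apply: diff_near; first exact: mulmxr_continuous.
  move=> e e0; near=> h; rewrite /= mulmxDl addrCA addrK subrr normr0.
  by rewrite mulr_ge0 // ltW.
have dF x := (DF0 x).1.
have DF x v : 'd (fun x : 'rV[R]_a => c + x *m A) x v = v *m A by rewrite (DF0 x).2.
elim: k g => [|k IH] g.
  move=> cg x Ux; apply: (@continuous_comp 'rV[R]_a 'rV[R]_b R (fun x => c + x *m A) g x).
    exact: differentiable_continuous.
  exact/cg/UV.
move=> [dg Dg].
have dgF x : U x -> differentiable (fun x => g (c + x *m A)) x.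
  move=> Ux; apply: (differentiable_comp (dF x)); exact/dg/UV.
split => // i.
have C : Ck_on U k (fun x => \sum_j A i j * 'D_(delta_mx 0 j) g (c + x *m A)).
  apply: Ck_on_sum => // j _.
  apply: (@Ck_onM _ _ _ (cst _)) => //; first exact: Ck_on_cst.
  exact: (IH _ (Dg j)).
apply: Ck_on_ext C => // x Ux.
rewrite deriveE; last exact: dgF.
rewrite (@diff_comp _ _ _ _ (fun x => c + x *m A) g) //; last exact/dg/UV.
rewrite /= DF -deriveE; last exact/dg/UV.
rewrite derive_coord; last exact/dg/UV.
by apply: eq_bigr => j _; rewrite -rowE mxE.
Unshelve. all: by end_near. Qed.
End CkTheory.

(** * Quadratic maps *)

Section Quadratic.
Context {R : realType}.

Lemma continuous_at_normP (V W : normedModType R) (f : V -> W) x :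
  {for x, continuous f} <->
  forall e : R, 0 < e -> \forall z \near x, `|f x - f z| <= e.
Proof.
split; first by move=> cf e e0; move/cvgrPdist_le : cf => /(_ e e0).
by move=> H; apply/cvgrPdist_le => e e0; exact: H.
Qed.

Lemma mulmx_norm_le m n p (A : 'M[R]_(m, n)) (B : 'M[R]_(n, p)) :
  `|A *m B| <= n%:R * `|A| * `|B|.
Proof.
apply: norm_le_coord => [|i j]; first by rewrite !mulr_ge0.
rewrite mxE (le_trans (ler_norm_sum _ _ _))//.
apply: (@le_trans _ _ (\sum_(k < n) `|A| * `|B|)).
  by apply: ler_sum => k _; rewrite normrM ler_pM // coord_le_norm.
by rewrite sumr_const card_ord -mulrA mulr_natl.
Qed.

Lemma jacobian_coord a b (G : 'rV[R]_a -> 'rV[R]_b) y (v : 'rV[R]_a) j : differentiable G y ->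
  differentiable (fun x => G x 0 j) y /\
  'D_v (fun x => G x 0 j) y = (v *m jacobian G y) 0 j.
Proof.
move=> dG.
have dc := @differentiable_coord R 1 b (G y) 0 j.
have d1 : differentiable (fun x => G x 0 j) y by exact: (differentiable_comp dG dc).
split => //; rewrite deriveE // (diff_comp dG dc) /= jacobianE.
have @f : {linear 'rV[R]_b -> R}.
  by exists (fun N : 'rV[R]_b => N 0 j); do 2![eexists]; do ?[constructor];
     rewrite ?mxE// => ? *; rewrite ?mxE//; move=> ?; rewrite !mxE.
by rewrite (_ : (fun _ => _) = f) // diff_lin //; exact: coord_continuous.
Qed.

(* A map is quadratic when its difference quotient is an affine function of the
   sum of the arguments; its Jacobian at [x] is then [A (x + x)]. *)
Definition quadratic k s (F : 'rV[R]_k -> 'rV[R]_s) (A : 'rV[R]_k -> 'M[R]_(k, s)) :=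
  (forall x x', F x - F x' = (x - x') *m A (x + x')) /\
  exists A0 (B : 'I_k -> 'M[R]_(k, s)), forall v, A v = A0 + \sum_l v 0 l *: B l.

Section Basic.
Variables (k s : nat) (F : 'rV[R]_k -> 'rV[R]_s) (A : 'rV[R]_k -> 'M[R]_(k, s)).
Hypothesis qF : quadratic F A.

Lemma quadratic_slope_continuous : continuous A.
Proof.
case: qF => _ [A0 [B HA]]; apply: rV_continuous => i j.
rewrite (_ : (fun _ => _) = (fun v : 'rV[R]_k => A0 i j + \sum_l v 0 l * B l i j)).
  move=> v; apply: (@continuousD _ _ _ (cst (A0 i j))); first exact: cst_continuous.
  apply: continuous_at_sum => l _; apply: (@continuousM _ _ _ (cst (B l i j))) => //.
  - exact: coord_continuous.
  - exact: cst_continuous.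
by apply/funext => v; rewrite HA mxE summxE; congr (_ + _); apply: eq_bigr => l _; rewrite mxE.
Qed.

Lemma quadratic_slope_comp_Ck a (V : set 'rV[R]_a) n (G : 'rV[R]_a -> 'rV[R]_k) i j :
  open V -> (forall l, Ck_on V n (fun y => G y 0 l)) ->
  Ck_on V n (fun y => A (G y + G y) i j).
Proof.
case: qF => _ [A0 [B HA]] oV CG.
have C : Ck_on V n (fun y => A0 i j + \sum_l (G y 0 l + G y 0 l) * B l i j).
  apply: (@Ck_onD _ _ _ _ (cst (A0 i j))) => //; first exact: Ck_on_cst.
  apply: Ck_on_sum => // l _.
  apply: (@Ck_onM _ _ _ _ (fun y => G y 0 l + G y 0 l) (cst (B l i j))) => //.
    exact: (Ck_onD oV).
  exact: Ck_on_cst.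
apply: Ck_on_ext C => // y _; rewrite HA mxE summxE; congr (_ + _).
by apply: eq_bigr => l _; rewrite !mxE.
Qed.

Lemma quadratic_differential x : differentiable F x /\ jacobian F x = A (x + x).
Proof.
case: (qF) => HF _; apply: jacobian_unique => e e0.
have k0 : 0 < k%:R + 1 :> R by rewrite ltr_wpDl.
have cA : A (h + x + x) @[h --> (0 : 'rV[R]_k)] --> A (x + x).
  have -> : A (x + x) = A (0 + x + x) by rewrite add0r.
  apply: (@continuous_comp 'rV[R]_k 'rV[R]_k _ (fun h => h + x + x) A).
    apply: (@continuousD _ _ _ (fun h => h + x) (cst x)); last exact: cst_continuous.
    apply: (@continuousD _ _ _ id (cst x)); last exact: cst_continuous.
    exact: cvg_id.
  exact: quadratic_slope_continuous.
move/cvgrPdist_le : cA => /(_ (e / (k%:R + 1))) cA.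
near=> h.
rewrite HF addrK -mulmxBr (le_trans (mulmx_norm_le _ _))//.
rewrite mulrAC ler_wpM2r //.
have : `|A (x + x) - A (h + x + x)| <= e / (k%:R + 1).
  by near: h; apply: cA; rewrite divr_gt0.
rewrite distrC => H1; rewrite -addrA in H1 *.
apply: (@le_trans _ _ (k%:R * (e / (k%:R + 1)))); first by rewrite ler_wpM2l.
rewrite mulrCA ler_piMr ?(ltW e0) // ler_pdivrMr // mul1r.
by rewrite lerDl.
Unshelve. all: by end_near. Qed.

Lemma quadratic_continuous : continuous F.
Proof. by move=> x; apply/differentiable_continuous/(quadratic_differential x).1. Qed.

Lemma quadratic_smooth (U : set 'rV[R]_k) : open U -> smooth_open U F.
Proof.
move=> oU j n; elim: n => [|n IH].
  by move=> x _; apply: coord_continuous_at; exact: quadratic_continuous.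
split=> [x _|i]; first exact: (jacobian_coord 0 j (quadratic_differential x).1).1.
have C : Ck_on U n (fun x => A (x + x) i j).
  by apply: (quadratic_slope_comp_Ck (G := id)) => // l; exact: Ck_on_coord.
apply: Ck_on_ext C => // x _.
rewrite (jacobian_coord _ j (quadratic_differential x).1).2.
by rewrite (quadratic_differential x).2 -rowE mxE.
Qed.
End Basic.

Lemma Ck_on_det a (V : set 'rV[R]_a) n m (M : 'rV[R]_a -> 'M[R]_m) : open V ->
  (forall i j, Ck_on V n (fun y => M y i j)) -> Ck_on V n (fun y => \det (M y)).
Proof.
move=> oV CM; apply: Ck_on_sum => // s _.
apply: (@Ck_onM _ _ _ _ (cst _)) => //; first exact: Ck_on_cst.
exact: Ck_on_prod.
Qed.

Lemma Ck_on_invmx a (V : set 'rV[R]_a) n m (M : 'rV[R]_a -> 'M[R]_m) i j : open V ->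
  (forall y, V y -> M y \in unitmx) ->
  (forall i j, Ck_on V n (fun y => M y i j)) -> Ck_on V n (fun y => invmx (M y) i j).
Proof.
move=> oV uM CM.
have C : Ck_on V n (fun y => (\det (M y))^-1 * ((-1) ^+ (j + i) * \det (row' j (col' i (M y))))).
  apply: Ck_onM => //.
    apply: Ck_onV => //; last exact: Ck_on_det.
    by move=> y /uM; rewrite unitmxE unitfE.
  apply: (@Ck_onM _ _ _ _ (cst _)) => //; first exact: Ck_on_cst.
  apply: Ck_on_det => // i' j'.
  apply: Ck_on_ext (CM (lift j i') (lift i j')) => // y _.
  by rewrite !mxE.
apply: Ck_on_ext C => // y Vy.
by rewrite /invmx uM // !mxE /cofactor.
Qed.

Lemma rV_fixed_point n (C : set 'rV[R]_n) (T : 'rV[R]_n -> 'rV[R]_n) (q : R) :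
  closed C -> C !=set0 -> (forall x, C x -> C (T x)) -> 0 <= q -> q < 1 ->
  (forall x x', C x -> C x' -> `|T x - T x'| <= q * `|x - x'|) ->
  exists2 x, C x & x = T x.
Proof.
move=> cC C0 TC q0 q1 TT.
pose X : completeNormedModType R := HB.pack 'rV[R]_n (Uniform_isComplete.Build 'rV[R]_n (@cauchy_cvg ('rV[R]_n))).
pose Tf : {fun (C : set X) >-> (C : set X)} := HB.pack (T : X -> X) (isFun.Build X X C C T TC).
apply: (@banach_fixed_point R X C Tf) => //.
exists (NngNum q0); split => //; by move=> [x x'] [/= xp x'p]; exact: TT.
Qed.

(* A zero of [x |-> F x - y] is a fixed point of [x - (F x - y) *m K], which is a
   contraction near [p]; the derivative of the local inverse is a rational
   function of that inverse, so it is smooth by induction. *)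
Lemma quadratic_inverse k k' (F : 'rV[R]_k -> 'rV[R]_k') (A : 'rV[R]_k -> 'M[R]_(k, k'))
    (K : 'M[R]_(k', k)) (p : 'rV[R]_k) (U0 : set 'rV[R]_k) :
  quadratic F A -> A (p + p) *m K = 1%:M -> K *m A (p + p) = 1%:M ->
  open U0 -> U0 p ->
  exists (U : set 'rV[R]_k) (V : set 'rV[R]_k') (G : 'rV[R]_k' -> 'rV[R]_k),
    [/\ [/\ open U, U p & U `<=` U0], open V,
        (forall x, U x -> V (F x) /\ G (F x) = x),
        (forall y, V y -> U (G y) /\ F (G y) = y) & smooth_open V G].
Proof.
move=> qF AK KA oU0 U0p; have [HF _] := qF.
(* [N] is the slope of [x |-> F x *m K]. It is the identity at [p + p], and [r] is chosen so that it
   moves no vector by more than half its norm at the sum of two points [r]-close to [p]. *)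
pose N s := A s *m K.
have cN : continuous N.
  move=> s; apply: (@mulmx_continuous_at _ _ _ _ _ A (cst K)).
    exact: quadratic_slope_continuous qF s.
  exact: cst_continuous.
have k0 : 0 < k%:R + 1 :> R by rewrite ltr_wpDl.
have [r r0 [Hr HU0]] : exists2 r, 0 < r &
    (forall x x', `|x - p| <= r -> `|x' - p| <= r -> forall v : 'rV[R]_k,
       `|v - v *m N (x + x')| <= 2^-1 * `|v|) /\
    (forall x, `|x - p| <= r -> U0 x).
  have /cvgrPdist_le /(_ (2^-1 / (k%:R + 1))) : N s @[s --> p + p] --> N (p + p) by exact: cN.
  have -> : N (p + p) = 1%:M by [].
  move=> /(_ _) /nbhs_ballP[|r1 /= r10 H1]; first by rewrite divr_gt0.
  have /nbhs_ballP[r2 /= r20 H2] := near_open oU0 U0p.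
  have [q [q0 q1 q2]] : exists q, [/\ 0 < q, q <= r1 & q <= r2].
    by exists (Num.min r1 r2); rewrite lt_min r10 r20 !ge_min !lexx orbT.
  exists (q / 4); first by rewrite divr_gt0.
  have lt1 : q / 4 + q / 4 < r1 by clear -q0 q1; lra.
  have lt2 : q / 4 < r2 by clear -q0 q2; lra.
  split=> [x x' xp x'p v|x xp]; last first.
    by apply: H2; rewrite -ball_normE /= distrC; apply: le_lt_trans lt2.
  rewrite -[X in X - _]mulmx1 -mulmxBr (le_trans (mulmx_norm_le _ _))//.
  have : `|1%:M - N (x + x')| <= 2^-1 / (k%:R + 1).
    apply: H1; rewrite -ball_normE /= distrC; apply: le_lt_trans lt1.
    rewrite opprD addrACA; apply: le_trans (ler_normD _ _) _; exact: lerD.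
  move=> H; apply: (@le_trans _ _ (k%:R * `|v| * (2^-1 / (k%:R + 1)))).
    by rewrite ler_wpM2l // mulr_ge0.
  rewrite mulrAC ler_wpM2r // mulrCA ler_piMr // ler_pdivrMr // mul1r.
  by rewrite lerDl.
have contr x x' : `|x - p| <= r -> `|x' - p| <= r -> forall v : 'rV[R]_k,
    `|v| <= 2 * `|v *m N (x + x')|.
  move=> xp x'p v; have := Hr _ _ xp x'p v.
  have : `|v| <= `|v - v *m N (x + x')| + `|v *m N (x + x')|.
    by rewrite -{1}[v](subrK (v *m N (x + x'))); exact: ler_normD.
  by move=> H1 H2; clear -H1 H2; lra.
have unitN x x' : `|x - p| <= r -> `|x' - p| <= r -> N (x + x') \in unitmx.
  move=> xp x'p; rewrite -row_free_unit; apply/inj_row_free => v v0.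
  apply/eqP; rewrite -normr_eq0 eq_le normr_ge0 andbT.
  by rewrite (le_trans (contr _ _ xp x'p v)) // v0 normr0 mulr0.
have Hlip x x' : `|x - p| <= r -> `|x' - p| <= r ->
    `|x - x'| <= 2 * `|(F x - F x') *m K|.
  by move=> xp x'p; rewrite HF -mulmxA; exact: contr.
(* The bound [r / 2] leaves room for the contraction: [T] moves the centre [p] by less than [r / 2]
   and halves distances, hence sends the closed [r]-ball into the open one. *)
pose V := [set y : 'rV[R]_k' | `|(y - F p) *m K| < r / 2].
have oV : open V.
  rewrite (_ : V = (fun y : 'rV[R]_k' => `|(y - F p) *m K|) @^-1` [set z | z < r / 2]) //.
  apply: open_comp; last exact: open_lt.
  move=> y _; apply: (@continuous_comp 'rV[R]_k' 'rV[R]_k R (fun y => (y - F p) *m K) (fun z => `|z|) y).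
    apply: (@continuous_comp 'rV[R]_k' 'rV[R]_k' 'rV[R]_k (fun y => y - F p) (fun z => z *m K) y).
      apply: (@continuousB _ _ _ id (cst _)); [exact: cvg_id|exact: cst_continuous].
    exact: mulmxr_continuous.
  exact: norm_continuous.
have solve y : V y -> exists x, `|x - p| < r /\ F x = y.
  move=> Vy; pose T x := x - (F x - y) *m K.
  pose C := [set x : 'rV[R]_k | `|x - p| <= r].
  have TT x x' : `|x - p| <= r -> `|x' - p| <= r -> `|T x - T x'| <= 2^-1 * `|x - x'|.
    move=> xp x'p; have := Hr _ _ xp x'p (x - x').
    rewrite /T mulmxA -HF; congr (_ <= _); congr (`|_|).
    have -> : F x - F x' = (F x - y) - (F x' - y) by rewrite opprB addrA subrK.
    by rewrite mulmxBl; move: (_ *m K) (_ *m K) => P Q; rewrite !opprD !opprK [RHS]addrACA.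
  have TC x : C x -> `|T x - p| < r.
    move=> Cx; have := TT _ _ Cx; move=> /(_ p); rewrite subrr normr0 => /(_ (ltW r0)).
    have H1 : `|T p - p| < r / 2.
      rewrite /T addrAC subrr sub0r -mulNmx opprB; exact: Vy.
    have : `|T x - p| <= `|T x - T p| + `|T p - p|.
      by rewrite -{1}[T x](subrK (T p)) -addrA; exact: ler_normD.
    by move=> H2 H3; move: Cx; rewrite /C /= => Cx; clear -Cx H1 H2 H3; lra.
  have [x Cx xT] : exists2 x, C x & x = T x.
    apply: (@rV_fixed_point k C T 2^-1) => //.
    - rewrite (_ : C = closed_ball p r); first exact: closed_ball_closed.
      by rewrite closed_ballE //; apply/seteqP; split => x; rewrite /C /closed_ball_ /= distrC.
    - by exists p; rewrite /C /= subrr normr0 ltW.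
    - by move=> x /TC /ltW.
    - by rewrite invf_lt1 // ltr1n.
  exists x; split; first by rewrite xT; exact: TC.
  have : (F x - y) *m K = 0.
    have E : x - T x = (F x - y) *m K by rewrite /T subKr.
    by rewrite -E -xT subrr.
  move/(congr1 (fun z => z *m A (p + p))); rewrite mul0mx -mulmxA KA mulmx1.
  by move/eqP; rewrite subr_eq0 => /eqP.
(* Outside [V] the value 0 is a placeholder; all statements about [G] are restricted to [V]. *)
pose G y := if pselect (V y) is left Vy then projT1 (cid (solve y Vy)) else 0.
have GP y : V y -> `|G y - p| < r /\ F (G y) = y.
  by move=> Vy; rewrite /G; case: pselect => // Vy'; case: cid.
have GL y y' : V y -> V y' -> `|G y - G y'| <= 2 * `|(y - y') *m K|.
  move=> /GP [g1 g2] /GP [g1' g2']; rewrite -{2}g2 -{2}g2'.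
  by apply: Hlip; exact: ltW.
have GK x : `|x - p| < r -> V (F x) -> G (F x) = x.
  move=> xp VF; have [g1 g2] := GP _ VF.
  apply/eqP; rewrite -subr_eq0 -normr_eq0 eq_le normr_ge0 andbT.
  rewrite (le_trans (Hlip _ _ (ltW g1) (ltW xp))) //.
  by rewrite g2 subrr mul0mx normr0 mulr0.
have Gc y : V y -> {for y, continuous G}.
  move=> Vy; apply/continuous_at_normP => e e0.
  have cK : {for y, continuous (fun z : 'rV[R]_k' => (y - z) *m K)}.
    apply: (@continuous_comp 'rV[R]_k' 'rV[R]_k' 'rV[R]_k (fun z => y - z) (fun z => z *m K) y).
      apply: (@continuousB _ _ _ (cst y) id); [exact: cst_continuous|exact: cvg_id].
    exact: mulmxr_continuous.
  move/continuous_at_normP : cK => /(_ (e / 2)) cK.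
  near=> z.
  have Vz : V z by near: z; exact: (near_open oV Vy).
  apply: le_trans (GL _ _ Vy Vz) _.
  have : `|(y - y) *m K - (y - z) *m K| <= e / 2 by near: z; apply: cK; rewrite divr_gt0.
  by rewrite subrr mul0mx sub0r normrN => H1; clear -H1; lra.
have dG y : V y -> differentiable G y /\ jacobian G y = K *m invmx (N (G y + G y)).
  move=> Vy; apply: jacobian_unique => e e0.
  have [gp Fg] := GP _ Vy.
  set I := invmx _.
  (* [c - 1] collects the factors of the estimate below: the Lipschitz constant of [G], two products
     of inner size [k] and the norm of the inverse matrix. The added 1 makes [c] positive. *)
  pose c := 2 * (k'%:R * `|K|) * k%:R * k%:R * `|I| + 1.
  have c0 : 0 < c by rewrite ltr_wpDl // !mulr_ge0.
  have cN2 : {for y, continuous (fun z : 'rV[R]_k' => N (G z + G y))}.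
    apply: (@continuous_comp 'rV[R]_k' 'rV[R]_k 'M[R]_k (fun z => G z + G y) N y); last exact: cN.
    by apply: (@continuousD _ _ _ G (cst (G y))); [exact: Gc|exact: cst_continuous].
  move/continuous_at_normP : cN2 => /(_ (e / c)) cN2.
  have H0 : \forall h \near (0 : 'rV[R]_k'), V (h + y) /\ `|N (G y + G y) - N (G (h + y) + G y)| <= e / c.
    have : \forall z \near y, V z /\ `|N (G y + G y) - N (G z + G y)| <= e / c.
      near=> z; split; near: z; first exact: (near_open oV Vy).
      by apply: cN2; rewrite divr_gt0.
    by rewrite (near_shift 0) subr0.
  near=> h.
  have [Vh Nh] : V (h + y) /\ `|N (G y + G y) - N (G (h + y) + G y)| <= e / c by near: h.
  have [gph Fgh] := GP _ Vh.
  have uI : N ((G y) + (G y)) \in unitmx by apply: unitN; exact: ltW.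
  (* The remainder is an exact expression: the difference quotient and the derivative differ only
     through the argument of the continuous map [N]. *)
  have E : (G (h + y)) - (G y) - h *m (K *m I) = ((G (h + y)) - (G y)) *m (N ((G y) + (G y)) - N ((G (h + y)) + (G y))) *m I.
    have -> : h *m (K *m I) = ((G (h + y)) - (G y)) *m N ((G (h + y)) + (G y)) *m I.
      by rewrite /N !mulmxA -HF Fgh Fg addrK.
    rewrite mulmxBr [RHS]mulmxBl; congr (_ - _).
    by rewrite -mulmxA mulmxV // mulmx1.
  rewrite E.
  have L : `|(G (h + y)) - (G y)| <= 2 * (k'%:R * `|h| * `|K|).
    apply: le_trans (GL _ _ Vh Vy) _; rewrite addrK ler_wpM2l //; exact: mulmx_norm_le.
  apply: le_trans (mulmx_norm_le _ _) _.
  apply: (@le_trans _ _ (k%:R * (k%:R * (2 * (k'%:R * `|h| * `|K|)) * (e / c)) * `|I|)).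
    rewrite ler_wpM2r // ler_wpM2l //; apply: le_trans (mulmx_norm_le _ _) _.
    by apply: ler_pM => //; rewrite ?mulr_ge0 ?ler_wpM2l.
  have -> : k%:R * (k%:R * (2 * (k'%:R * `|h| * `|K|)) * (e / c)) * `|I| =
     e * `|h| * ((c - 1) / c) by rewrite /c; field; rewrite gt_eqF.
  rewrite ler_piMr ?mulr_ge0 ?(ltW e0) // ler_pdivrMr // mul1r.
  by rewrite gerDl oppr_le0.
have smG : smooth_open V G.
  move=> j n; elim: n j => [|n IH] j.
    by move=> y Vy; apply: coord_continuous_at; exact: Gc.
  split=> [y Vy|i]; first exact: (jacobian_coord 0 j (dG y Vy).1).1.
  have C : Ck_on V n (fun y => \sum_a K i a * invmx (N (G y + G y)) a j).
    apply: Ck_on_sum => // a _.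
    apply: (@Ck_onM _ _ _ _ (cst _)) => //; first exact: Ck_on_cst.
    apply: Ck_on_invmx => //.
      by move=> y /GP [gp _]; apply: unitN; exact: ltW.
    move=> b d.
    have C : Ck_on V n (fun y => \sum_c A (G y + G y) b c * K c d).
      apply: Ck_on_sum => // c _.
      apply: (@Ck_onM _ _ _ _ _ (cst _)) => //; last exact: Ck_on_cst.
      exact: (quadratic_slope_comp_Ck qF).
    by apply: Ck_on_ext C => // y _; rewrite /N mxE.
  apply: Ck_on_ext C => // y Vy.
  by rewrite (jacobian_coord _ j (dG y Vy).1).2 (dG y Vy).2 -rowE !mxE.
exists ([set x | `|x - p| < r] `&` F @^-1` V), V, G; split => //.
- split.
  + apply: openI.
      rewrite (_ : [set x | _] = ball p r); first exact: ball_open.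
      by rewrite -ball_normE; apply/seteqP; split => x /=; rewrite distrC.
    by apply: open_comp => // x _; exact: (quadratic_continuous qF).
  + by split; rewrite /V /= subrr ?mul0mx normr0 // divr_gt0.
  + by move=> x [/= /ltW /HU0].
- by move=> x [/= xp VF]; split => //; exact: GK.
- by move=> y Vy; have [g1 g2] := GP _ Vy; split => //; split => //=; rewrite g2.
Unshelve. all: by end_near. Qed.
End Quadratic.

(** * Regular zero sets *)

Section Straightening.
Context {R : realType}.

Lemma open_forall (T : topologicalType) n (P : 'I_n -> set T) :
  (forall i, open (P i)) -> open [set x | forall i, P i x].
Proof.
move=> oP; rewrite openE => x Hx; rewrite /interior; apply: filter_forall => i.
exact: near_open (oP i) (Hx i).
Qed.

(** A basis of a complement of the row space of [J^T] supplies the missing columns. The completed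
    matrix is square only up to the equation [k = s + d], so its pseudo-inverse is used, which full
    rank makes two-sided. *)
Lemma complete_columns k s d (J : 'M[R]_(k, s)) : k = (s + d)%N -> \rank J = s ->
  exists (N : 'M[R]_(k, d)) (K : 'M[R]_(s + d, k)),
    row_mx J N *m K = 1%:M /\ K *m row_mx J N = 1%:M.
Proof.
move=> E rJ.
have rC : \rank (J^T)^C%MS = d by rewrite mxrank_compl mxrank_tr rJ E addKn.
pose B := castmx (rC, erefl k) (row_base (J^T)^C%MS).
pose M := row_mx J B^T.
have rM : \rank M = (s + d)%N.
  rewrite -mxrank_tr tr_row_mx trmxK.
  have -> : \rank (col_mx J^T B) = \rank (J^T + (J^T)^C)%MS.
    apply/eqmx_rank/eqmxP; apply: eqmx_trans (eqmx_sym (addsmxE _ _)) _.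
    apply: adds_eqmx; first exact: eqmx_refl.
    apply: eqmx_trans (eqmx_cast _ _) _; exact: eq_row_base.
  by have := addsmx_compl_full J^T; rewrite /row_full => /eqP ->; rewrite -E.
exists B^T, (pinvmx M); split.
  by apply: mulmxVp; rewrite /row_free rM -E.
by apply: mulVpmx; rewrite /row_full rM.
Qed.

Lemma row_mx_quadratic k s d (F : 'rV[R]_k -> 'rV[R]_s) A (G : 'rV[R]_k -> 'rV[R]_d) B :
  quadratic F A -> quadratic G B ->
  quadratic (fun x => row_mx (F x) (G x)) (fun v => row_mx (A v) (B v)).
Proof.
move=> [HF [A0 [A1 HA]]] [HG [B0 [B1 HB]]]; split.
  by move=> x x'; rewrite opp_row_mx add_row_mx HF HG mul_mx_row.
exists (row_mx A0 B0), (fun l => row_mx (A1 l) (B1 l)) => v.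
rewrite HA HB; under [in RHS]eq_bigr do rewrite scale_row_mx.
have -> : \sum_l row_mx (v 0 l *: A1 l) (v 0 l *: B1 l) =
    row_mx (\sum_l v 0 l *: A1 l) (\sum_l v 0 l *: B1 l).
  by elim/big_ind3: _ => [|a1 a2 b1 b2 c1 c2 -> ->|//]; rewrite ?row_mx0 ?add_row_mx.
by rewrite add_row_mx.
Qed.

Lemma affine_quadratic k d (c : 'rV[R]_d) (L : 'M[R]_(k, d)) :
  quadratic (fun x => c + x *m L) (fun _ => L).
Proof.
split=> [x x'|]; first by rewrite mulmxBl opprD addrACA subrr add0r.
by exists L, (fun _ => 0) => v; rewrite big1 ?addr0 // => l _; rewrite scaler0.
Qed.

Lemma comp_smooth_affine a b c (V : set 'rV[R]_b) (U : set 'rV[R]_a)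
    (g : 'rV[R]_b -> 'rV[R]_c) (e : 'rV[R]_b) (A : 'M[R]_(a, b)) :
  open U -> (forall x, U x -> V (e + x *m A)) ->
  smooth_open V g -> smooth_open U (fun x => g (e + x *m A)).
Proof. by move=> oU UV sg j k; apply: Ck_on_comp_affine (sg j k). Qed.

Lemma smooth_on_open a b (U : set 'rV[R]_a) (A : set 'rV[R]_a) (F : 'rV[R]_a -> 'rV[R]_b) :
  open U -> A `<=` U -> smooth_open U F -> smooth_on A F.
Proof. by move=> oU AU sF x /AU Ux; exists U, F; split. Qed.

(* Local coordinates in which the equations [F = 0] are linear; the extra
   coordinates are normalized to be positive, as needed for corners. *)
Lemma straighten k s d (F : 'rV[R]_k -> 'rV[R]_s) A p (U0 : set 'rV[R]_k) :
  k = (s + d)%N -> quadratic F A -> \rank (A (p + p)) = s -> open U0 -> U0 p ->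
  exists (c : 'rV[R]_d) (L : 'M[R]_(k, d)) (U : set 'rV[R]_k) (V : set 'rV[R]_(s + d))
      (G : 'rV[R]_(s + d) -> 'rV[R]_k),
    [/\ [/\ open U, U p & U `<=` U0], open V,
        (forall x, U x -> V (row_mx (F x) (c + x *m L)) /\
           G (row_mx (F x) (c + x *m L)) = x /\ forall i, 0 < (c + x *m L) 0 i),
        (forall y, V y -> U (G y) /\ row_mx (F (G y)) (c + G y *m L) = y) &
        smooth_open V G].
Proof.
move=> E qF rA oU0 U0p.
have [L [K [LK KL]]] := complete_columns E rA.
(* With this constant the extra coordinates all equal 1 at [p], hence are positive nearby. *)
pose c := const_mx 1 - p *m L.
pose U1 := U0 `&` [set x : 'rV[R]_k | forall i, 0 < (c + x *m L) 0 i].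
have cL : continuous (fun x : 'rV[R]_k => c + x *m L).
  move=> x; apply/differentiable_continuous.
  exact: (quadratic_differential (affine_quadratic c L) x).1.
have oU1 : open U1.
  apply: openI => //.
  apply: (@open_forall _ _ (fun i => [set x : 'rV[R]_k | 0 < (c + x *m L) 0 i])) => i.
  apply: (@open_comp _ _ (fun x : 'rV[R]_k => (c + x *m L) 0 i) [set z | 0 < z]); last exact: open_gt.
  by move=> z _; apply: (@coord_continuous_at R 'rV[R]_k 1 d (fun x => c + x *m L) 0 i z); exact: cL.
have U1p : U1 p by split => //= i; rewrite /c subrK mxE.
have qP := row_mx_quadratic qF (affine_quadratic c L).
have [U [V [G [[oU Up UU] oV H1 H2 sG]]]] := quadratic_inverse qP LK KL oU1 U1p.
exists c, L, U, V, G; split => //.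
  by split => // x /UU [].
by move=> x Ux; have [? ?] := H1 x Ux; split => //; split => //; have [] := UU _ Ux.
Qed.

(** In straightened coordinates the set is the slice where the first [s] coordinates vanish; the
    parametrization is the local inverse composed with the linear embedding [P] of that slice. *)
Lemma submanifold_regular_zeros k s d (S : set 'rV[R]_k) : k = (s + d)%N ->
  (forall x, S x -> exists (U0 : set 'rV[R]_k) (F : 'rV[R]_k -> 'rV[R]_s) A,
     [/\ open U0, U0 x, quadratic F A, \rank (A (x + x)) = s &
         forall y, U0 y -> (S y <-> F y = 0)]) ->
  submanifold d S.
Proof.
move=> E H x Sx; have [U0 [F [A [oU0 U0x qF rA SF]]]] := H x Sx.
have [c [L [U [V [G [[oU Ux UU0] oV H1 H2 sG]]]]]] := straighten E qF rA oU0 U0x.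
pose P : 'M[R]_(d, s + d) := row_mx 0 1%:M.
have PE (w : 'rV[R]_d) : w *m P = row_mx 0 w by rewrite mul_mx_row mulmx0 mulmx1.
pose W := [set w : 'rV[R]_d | V (0 + w *m P)].
have oW : open W.
  apply: (@open_comp _ _ (fun w : 'rV[R]_d => 0 + w *m P) V) => // w _.
  apply/differentiable_continuous.
  exact: (quadratic_differential (affine_quadratic 0 P) w).1.
have Fx : F x = 0 by apply/(SF x U0x).
exists W, (fun w => G (0 + w *m P)), (c + x *m L); split => //.
- by rewrite /W /= add0r PE -Fx; have [] := H1 x Ux.
- by rewrite add0r PE -Fx; have [_ []] := H1 x Ux.
exists U; split => //; exists (fun y => c + y *m L); split.
- apply: (smooth_on_open oW) => //; exact: comp_smooth_affine sG.
- apply: (smooth_on_open openT) => //; exact: (quadratic_smooth (affine_quadratic c L) openT).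
- move=> w Ww; have [UG] := H2 _ Ww; rewrite {3}add0r {3}PE => /eq_row_mx [FG LG].
  by split => //; split => //; apply/(SF _ (UU0 _ UG)).
- move=> y [Sy Uy]; have [Vy [Gy _]] := H1 y Uy.
  have Fy : F y = 0 by apply/(SF y (UU0 _ Uy)).
  by rewrite add0r PE -Fy Gy; split => //; rewrite /W /= add0r PE -Fy.
Qed.

(** The values of [F] serve as the corner coordinates, in a number [s] that may vary with the point.
    The remaining [d] chart coordinates are positive by the choice made in [straighten], so the
    orthant imposes nothing on them. *)
Lemma submanifold_corners_regular k e (S : set 'rV[R]_k) : k = (1 + e)%N ->
  (forall x, S x -> exists s (U0 : set 'rV[R]_k) (F0 : 'rV[R]_k -> 'rV[R]_1) A0
      (F : 'rV[R]_k -> 'rV[R]_s) A,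
     [/\ [/\ open U0, U0 x, quadratic F0 A0 & quadratic F A],
         \rank (row_mx (A0 (x + x)) (A (x + x))) = (1 + s)%N &
         forall y, U0 y -> (S y <-> F0 y = 0 /\ forall i, 0 <= F y 0 i)]) ->
  submanifold_corners e S.
Proof.
move=> E H x Sx; have [s [U0 [F0 [A0 [F [A [[oU0 U0x qF0 qF] rA SF]]]]]]] := H x Sx.
have se : (s <= e)%N by rewrite -(leq_add2l 1) -E -rA; exact: rank_leq_row.
have [d ed] : exists d, e = (s + d)%N by exists (e - s)%N; rewrite subnKC.
subst e; have E' : k = ((1 + s) + d)%N by rewrite -addnA.
have [c [L [U [V [G [[oU Ux UU0] oV H1 H2 sG]]]]]] :=
  straighten E' (row_mx_quadratic qF0 qF) rA oU0 U0x.
pose P : 'M[R]_(s + d, (1 + s) + d) := row_mx (row_mx 0 (col_mx 1%:M 0)) (col_mx 0 1%:M).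
have PE (a : 'rV[R]_s) (b : 'rV[R]_d) : row_mx a b *m P = row_mx (row_mx 0 a) b.
  by rewrite !mul_mx_row !mul_row_col !mulmx0 !mulmx1 addr0 add0r.
pose W := [set w : 'rV[R]_(s + d) | V (0 + w *m P)].
have oW : open W.
  apply: (@open_comp _ _ (fun w : 'rV[R]_(s + d) => 0 + w *m P) V) => // w _.
  apply/differentiable_continuous.
  exact: (quadratic_differential (affine_quadratic 0 P) w).1.
exists U, W; split => //.
exists (fun w => G (0 + w *m P)), (fun y => row_mx (F y) (c + y *m L)); split.
- apply: (smooth_on_open oW); first by move=> ? [].
  exact: comp_smooth_affine sG.
- apply: (smooth_on_open openT) => //.
  exact: (quadratic_smooth (row_mx_quadratic qF (affine_quadratic c L)) openT).
- move=> w [Ww w0]; have := H2 _ Ww.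
  have -> : 0 + w *m P = row_mx (row_mx 0 (lsubmx w)) (rsubmx w).
    by rewrite add0r -PE hsubmxK.
  move=> [UG] /eq_row_mx [/eq_row_mx [F0G FG] LG].
  have SG : S (G (row_mx (row_mx 0 (lsubmx w)) (rsubmx w))).
    apply/(SF _ (UU0 _ UG)); split => // i.
    by rewrite FG mxE; exact: w0.
  split => //.
  by rewrite FG LG hsubmxK.
- move=> y [Sy Uy]; have [Vy [Gy Ly]] := H1 y Uy.
  have [F0y Fy] : F0 y = 0 /\ forall i, 0 <= F y 0 i by apply/(SF y (UU0 _ Uy)).
  rewrite add0r PE -F0y Gy; split => //; split.
    by rewrite /W /= add0r PE -F0y.
  by move=> i; rewrite mxE; case: (fintype.split i) => j //; exact/ltW/Ly.
Qed.
End Straightening.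

(** * Tangent spaces computed from equations *)

Section Tangent.
Context {R : realType}.

Lemma smooth_open_differentiable a b (U : set 'rV[R]_a) (F : 'rV[R]_a -> 'rV[R]_b) x :
  U x -> smooth_open U F -> differentiable F x.
Proof. by move=> Ux sF; apply: differentiable_rV => j; have [+ _] := sF j 1%N; apply. Qed.

Lemma smooth_on_differentiable a b (W : set 'rV[R]_a) (F : 'rV[R]_a -> 'rV[R]_b) w :
  open W -> W w -> smooth_on W F -> differentiable F w.
Proof.
move=> oW Ww /(_ w Ww) [U [G [oU Uw sG FG]]].
have dG := smooth_open_differentiable Uw sG.
apply: (near_eq_differentiable _ dG).1.
near=> z; apply/esym/FG; near: z; [exact: (near_open oW Ww)|exact: (near_open oU Uw)].
Unshelve. all: by end_near. Qed.

Lemma jacobian_comp a b c (F : 'rV[R]_a -> 'rV[R]_b) (G : 'rV[R]_b -> 'rV[R]_c) x :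
  differentiable F x -> differentiable G (F x) ->
  differentiable (G \o F) x /\ jacobian (G \o F) x = jacobian F x *m jacobian G (F x).
Proof.
move=> dF dG; split; first exact: differentiable_comp.
apply/row_matrixP => i; rewrite !rowE mulmxA (jacobianE (G \o F) x) (jacobianE F x) (jacobianE G (F x)).
by rewrite (diff_comp dF dG).
Qed.

Lemma row_jacobian a b (F : 'rV[R]_a -> 'rV[R]_b) x i :
  row i (jacobian F x) = 'd F x (delta_mx 0 i).
Proof. by rewrite rowE jacobianE. Qed.

Lemma near_eq_jacobian a b (F G : 'rV[R]_a -> 'rV[R]_b) x :
  (\near x, F x = G x) -> differentiable F x -> jacobian G x = jacobian F x.
Proof.
move=> FG dF; apply/row_matrixP => i; transitivity ('d G x (delta_mx 0 i)); first exact: row_jacobian.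
rewrite (near_eq_differentiable FG dF).2; apply/esym; exact: row_jacobian.
Qed.

(** A smooth local extension of the inverse chart composes with [phi] to the identity near [w], so
    by the chain rule [jacobian phi w] has a right inverse. *)
Lemma local_param_rank d k (S : set 'rV[R]_k) x (W : set 'rV[R]_d) phi w :
  local_param S x W phi w ->
  [/\ differentiable phi w, {for w, continuous phi}, W w & \rank (jacobian phi w) = d].
Proof.
move=> [oW Ww phiw [U [oU [psi [sphi spsi H1 H2]]]]].
have dphi := smooth_on_differentiable oW Ww sphi.
have cphi := differentiable_continuous dphi.
split => //.
have [Sx pK] := H1 w Ww; rewrite phiw in Sx pK.
have [U1 [G [oU1 U1x sG pG]]] := spsi x Sx.
have dG := smooth_open_differentiable U1x sG.
have U1p : U1 (phi w) by rewrite phiw.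
have dG' : differentiable G (phi w) by rewrite phiw.
have [dC JC] := jacobian_comp dphi dG'.
have : jacobian (G \o phi) w = 1%:M.
  rewrite -(@near_eq_jacobian _ _ (G \o phi) id) //.
    by apply/row_matrixP => i; rewrite !rowE jacobianE diff_val mulmx1.
  have n1 : \forall z \near w, U1 (phi z) by apply: cphi; exact: (near_open oU1 U1p).
  near=> z; have Wz : W z by near: z; exact: (near_open oW Ww).
  have [Sz zK] := H1 z Wz; rewrite /= -pG //; near: z; exact: n1.
rewrite JC => /(congr1 mxrank); rewrite mxrank1 => rC.
apply/eqP; rewrite eqn_leq rank_leq_row /= -[X in (X <= _)%N]rC.
exact: mxrankM_maxl.
Unshelve. all: by end_near. Qed.

Lemma local_param_jacobian0 d k s (S : set 'rV[R]_k) x (W : set 'rV[R]_d) phi w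
    (F : 'rV[R]_k -> 'rV[R]_s) (U0 : set 'rV[R]_k) :
  local_param S x W phi w -> open U0 -> U0 x -> differentiable F x ->
  (forall y, S y -> U0 y -> F y = 0) -> jacobian phi w *m jacobian F x = 0.
Proof.
move=> lp oU0 U0x dF SF; have [dphi cphi Ww _] := local_param_rank lp.
have [oW _ phiw [U [oU [psi [sphi spsi H1 H2]]]]] := lp.
have dF' : differentiable F (phi w) by rewrite phiw.
have [dC JC] := jacobian_comp dphi dF'.
rewrite phiw in JC; rewrite -JC.
have U0p : U0 (phi w) by rewrite phiw.
rewrite -(@near_eq_jacobian _ _ (F \o phi) (cst 0)) //.
  by apply/row_matrixP => i; rewrite !rowE jacobianE mulmx0 diff_cst.
have n1 : \forall z \near w, U0 (phi z) by apply: cphi; exact: (near_open oU0 U0p).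
near=> z; have Wz : W z by near: z; exact: (near_open oW Ww).
have [[Sz _] _] := H1 z Wz; rewrite /= SF //; near: z; exact: n1.
Unshelve. all: by end_near. Qed.

(** The image of the parametrization lies in the kernel of the differential of [F], and both have
    dimension [d = k - s]. As this kernel does not mention [phi], it describes the tangent space
    whatever parametrization is chosen. *)
Lemma local_param_tangent d k s (S : set 'rV[R]_k) x (W : set 'rV[R]_d) phi w
    (F : 'rV[R]_k -> 'rV[R]_s) (U0 : set 'rV[R]_k) :
  k = (s + d)%N ->
  local_param S x W phi w -> open U0 -> U0 x -> differentiable F x ->
  (forall y, S y -> U0 y -> F y = 0) -> \rank (jacobian F x) = s ->
  forall v : 'rV[R]_k, (exists u : 'rV[R]_d, v = u *m jacobian phi w) <-> v *m jacobian F x = 0.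
Proof.
move=> E lp oU0 U0x dF SF rF; have J0 := local_param_jacobian0 lp oU0 U0x dF SF.
have [_ _ _ rphi] := local_param_rank lp.
have sub : (jacobian phi w <= kermx (jacobian F x))%MS by apply/sub_kermxP.
have eqm : (jacobian phi w == kermx (jacobian F x))%MS.
  have [_ <-] := mxrank_leqif_eq sub.
  by rewrite rphi mxrank_ker rF E addKn.
move=> v; split=> [[u ->]|v0]; first by rewrite -mulmxA J0 mulmx0.
have : (v <= kermx (jacobian F x))%MS by apply/sub_kermxP.
rewrite -(eqmxP eqm) => /submxP [u ->]; by exists u.
Qed.

Lemma submanifold_dim_le d k s (N : set 'rV[R]_k) x (F : 'rV[R]_k -> 'rV[R]_s) :
  submanifold d N -> N x -> differentiable F x -> (forall y, N y -> F y = 0) ->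
  (d + \rank (jacobian F x) <= k)%N.
Proof.
move=> sN Nx dF NF; have [W [phi [w lp]]] := sN x Nx.
have [_ _ _ <-] := local_param_rank lp.
apply: mulmx0_rank_max.
by apply: (local_param_jacobian0 lp openT I dF) => y /NF.
Qed.

Lemma tangent_spaceE d k s (S : set 'rV[R]_k) x
    (F : 'rV[R]_k -> 'rV[R]_s) (U0 : set 'rV[R]_k) :
  k = (s + d)%N -> submanifold d S -> S x -> open U0 -> U0 x -> differentiable F x ->
  (forall y, S y -> U0 y -> F y = 0) -> \rank (jacobian F x) = s ->
  tangent_space d S x = [set v | v *m jacobian F x = 0].
Proof.
move=> E sS Sx oU0 U0x dF SF rF; apply/seteqP; split=> v.
  move=> [W [phi [w [u [lp ->]]]]].
  by apply/(local_param_tangent E lp oU0 U0x dF SF rF); exists u.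
move=> /= v0; have [W [phi [w lp]]] := sS x Sx.
have [u ->] := (local_param_tangent E lp oU0 U0x dF SF rF v).2 v0.
by exists W, phi, w, u.
Qed.
End Tangent.

(** * Polytopes *)

Section Radial.
Context {R : realType}.

Lemma sum_sqr_ge0 n (x : 'rV[R]_n) : 0 <= \sum_(i < n) x 0 i ^+ 2.
Proof. by apply: sumr_ge0 => i _; exact: sqr_ge0. Qed.

Lemma enorm_ge0 n (x : 'rV[R]_n) : 0 <= enorm x.
Proof. exact: sqrtr_ge0. Qed.

Lemma sqr_enorm n (x : 'rV[R]_n) : enorm x ^+ 2 = \sum_(i < n) x 0 i ^+ 2.
Proof. by rewrite sqr_sqrtr // sum_sqr_ge0. Qed.

Lemma norm_le_enorm n (x : 'rV[R]_n) : `|x| <= enorm x.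
Proof.
apply: norm_le_coord; first exact: enorm_ge0.
move=> i j; rewrite ord1 -sqrtr_sqr ler_wsqrtr //.
by rewrite (bigD1 j) //= lerDl; apply: sumr_ge0 => k _; exact: sqr_ge0.
Qed.

Lemma enormZ n (t : R) (x : 'rV[R]_n) : enorm (t *: x) = `|t| * enorm x.
Proof.
rewrite /enorm -sqrtr_sqr -sqrtrM ?sqr_ge0 //; congr Num.sqrt.
by rewrite mulr_sumr; apply: eq_bigr => i _; rewrite mxE exprMn.
Qed.

Lemma sum_sqr_continuous n : continuous (fun x : 'rV[R]_n => \sum_(i < n) x 0 i ^+ 2).
Proof.
move=> x; apply: continuous_at_sum => i _.
by apply: (@continuousM _ _ (fun x : 'rV[R]_n => x 0 i) (fun x : 'rV[R]_n => x 0 i));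
  exact: coord_continuous.
Qed.

Lemma enorm_continuous n : continuous (@enorm R n).
Proof.
move=> x; apply: (@continuous_comp _ _ _ (fun x : 'rV[R]_n => \sum_(i < n) x 0 i ^+ 2) Num.sqrt).
  exact: sum_sqr_continuous.
exact: sqrt_continuous.
Qed.

Lemma enorm0 n : enorm (0 : 'rV[R]_n) = 0.
Proof. by rewrite -(scale0r (0 : 'rV[R]_n)) enormZ normr0 mul0r. Qed.

Lemma enorm_gt0 n (x : 'rV[R]_n) : x != 0 -> 0 < enorm x.
Proof. by move=> x0; apply: lt_le_trans (norm_le_enorm x); rewrite normr_gt0. Qed.

(** At 0 the quotient [a / b] is not controlled, but the image of [v] has norm at most [C] times the
    absolute value of [a v], which tends to 0. If [b v = 0], the quotient is 0 by convention. *)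
Lemma radial_continuous n (a b : 'rV[R]_n -> R) (C : R) :
  continuous a -> continuous b -> a 0 = 0 -> 0 < C -> (forall v, `|v| <= C * b v) ->
  continuous (fun v : 'rV[R]_n => (a v / b v) *: v).
Proof.
move=> ca cb a0 C0 Cb v; have [->|v0] := eqVneq v 0.
  apply/continuous_at_normP => e e0; rewrite scaler0.
  have /continuous_at_normP /(_ (e / C)) := ca 0.
  rewrite divr_gt0 // => /(_ isT); apply: filterS => z; rewrite a0 !sub0r !normrN.
  have bz0 : 0 <= b z by rewrite -(pmulr_rge0 _ C0); apply: le_trans (Cb z).
  move=> az; rewrite normrZ normrM normfV (ger0_norm bz0).
  have [bz|bz] := eqVneq (b z) 0; first by rewrite bz invr0 mulr0 mul0r ltW.
  have {}bz0 : 0 < b z by rewrite lt_def bz bz0.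
  rewrite -mulrA; apply: (@le_trans _ _ (e / C * C)); last by rewrite divfK // gt_eqF.
  by apply: ler_pM => //; [rewrite mulr_ge0 // invr_ge0 ltW|rewrite mulrC ler_pdivrMr].
have bv : b v != 0.
  have : 0 < C * b v by apply: lt_le_trans (Cb v); rewrite normr_gt0.
  by rewrite pmulr_rgt0 // => /gt_eqF ->.
apply: (@continuousZ _ _ _ (fun v => a v / b v) id v); last exact: cvg_id.
apply: (@continuousM _ _ a (fun v => (b v)^-1)); first exact: ca.
by apply: continuousV => //; exact: cb.
Qed.

Lemma radialK n (a b : 'rV[R]_n -> R) :
  (forall v t, 0 <= t -> a (t *: v) = t * a v) ->
  (forall v t, 0 <= t -> b (t *: v) = t * b v) ->
  (forall v, v != 0 -> 0 < a v) -> (forall v, v != 0 -> 0 < b v) ->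
  forall v, b ((a v / b v) *: v) = a v /\
    (b ((a v / b v) *: v) / a ((a v / b v) *: v)) *: ((a v / b v) *: v) = v.
Proof.
move=> aZ bZ a0 b0 v; have [->|v0] := eqVneq v 0.
  rewrite !scaler0; split => //.
  by rewrite -(scale0r 0) aZ // bZ // !mul0r.
have av := a0 v v0; have bv := b0 v v0.
have t0 : 0 <= a v / b v by rewrite divr_ge0 // ltW.
rewrite aZ // bZ // divfK ?gt_eqF //; split => //.
rewrite scalerA -[RHS]scale1r; congr (_ *: _).
by field; rewrite !gt_eqF.
Qed.

Lemma continuous_at_bigmax (T : topologicalType) (I : Type) (r : seq I) (P : pred I)
    (f : I -> T -> R) x : (forall i, P i -> {for x, continuous (f i)}) ->
  {for x, continuous (fun y => \big[Num.max/0]_(i <- r | P i) f i y)}.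
Proof.
move=> H; elim: r => [|i r IH].
  rewrite (_ : (fun _ => _) = cst 0); first exact: cvg_cst.
  by apply/funext => y; rewrite big_nil.
case Pi : (P i); last first.
  rewrite (_ : (fun _ => _) = fun y => \big[Num.max/0]_(j <- r | P j) f j y) //.
  by apply/funext => y; rewrite big_cons Pi.
rewrite (_ : (fun _ => _) = f i \max fun y => \big[Num.max/0]_(j <- r | P j) f j y).
  by apply: continuous_max; [exact: H|exact: IH].
by apply/funext => y; rewrite big_cons Pi.
Qed.

Section Polytope.
Variables (n : nat) (J : finType) (c : J -> R) (l : J -> 'cV[R]_n) (x0 : 'rV[R]_n).
Hypothesis c0 : forall j, 0 <= c j.

Definition cell_form j (x : 'rV[R]_n) : R := c j + ((x - x0) *m l j) 0 0.

(** A form that vanishes at [x0] counts as an equation, while the others are strictly positive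
    there; this makes [x0] a relative interior point. *)
Definition closed_cell : set 'rV[R]_n :=
  [set x | forall j, if c j == 0 then cell_form j x = 0 else 0 <= cell_form j x].

Definition open_cell : set 'rV[R]_n :=
  [set x | forall j, if c j == 0 then cell_form j x = 0 else 0 < cell_form j x].

Definition cell_matrix : 'M[R]_(n, #|J|) :=
  \matrix_(i, j) (if c (enum_val j) == 0 then l (enum_val j) i 0 else 0).

Definition cell_dim := \rank (kermx cell_matrix).

Lemma cell_matrixP m (B : 'M[R]_(m, n)) :
  B *m cell_matrix = 0 <-> forall j, c j = 0 -> B *m l j = 0.
Proof.
split=> [H j cj|H].
  apply/matrixP => i k; rewrite ord1 !mxE.
  transitivity ((B *m cell_matrix) i (enum_rank j)); last by rewrite H mxE.
  by rewrite !mxE; apply: eq_bigr => a _; rewrite mxE enum_rankK cj eqxx.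
apply/matrixP => i k; rewrite !mxE.
have [ck|ck] := eqVneq (c (enum_val k)) 0; last first.
  by rewrite big1 // => a _; rewrite mxE (negbTE ck) mulr0.
transitivity ((B *m l (enum_val k)) i 0); last by rewrite H // mxE.
by rewrite mxE; apply: eq_bigr => a _; rewrite mxE ck eqxx.
Qed.

(* [x0] lies in the open cell, which is the set where a gauge centred at [x0] is
   less than 1 in the affine span of the cell; radial rescaling turns the gauge
   into the Euclidean norm. *)
Lemma polytope_cell : (exists M, forall x, closed_cell x -> `|x| <= M) ->
  exists (chi : 'rV[R]_cell_dim -> 'rV[R]_n) (g : 'rV[R]_n -> 'rV[R]_cell_dim),
    [/\ continuous chi, continuous g,
        (forall v, enorm v <= 1 -> closed_cell (chi v) /\ g (chi v) = v),
        (forall x, closed_cell x -> enorm (g x) <= 1 /\ chi (g x) = x) &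
        (forall x, closed_cell x -> (open_cell x <-> enorm (g x) < 1))].
Proof.
move=> [M0 HM0].
pose B := row_base (kermx cell_matrix).
have BK : B *m pinvmx B = 1%:M by apply: mulmxVp; exact: row_base_free.
have Bl j : c j = 0 -> B *m l j = 0.
  move=> cj; apply: (cell_matrixP B).1 => //.
  by apply/sub_kermxP; rewrite eq_row_base.
have KB (v : 'rV[R]_n) : (forall j, c j = 0 -> v *m l j = 0) -> v *m pinvmx B *m B = v.
  move=> /(cell_matrixP v).2 /sub_kermxP H.
  by apply: mulmxKpV; rewrite eq_row_base.
(* The Minkowski gauge in coordinates [w] on the direction space. The maximum includes 0, so a
   direction along which no constraint tightens has gauge 0; boundedness will exclude this for
   nonzero [w]. *)
pose rho (w : 'rV[R]_cell_dim) := \big[Num.max/0]_(j | c j != 0) (- (w *m B *m l j) 0 0 / c j).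
have rho_le w t : 0 <= t -> (rho w <= t <-> forall j, c j != 0 -> - (w *m B *m l j) 0 0 <= t * c j).
  move=> t0; have cp j : c j != 0 -> 0 < c j by rewrite lt_def c0 => ->.
  split=> [H j cj|H].
    by rewrite -ler_pdivrMr ?cp //; apply: le_trans H; apply: le_bigmax_cond.
  by apply: bigmax_le => // j cj; rewrite ler_pdivrMr ?cp //; exact: H.
have rho_lt w t : 0 < t -> (rho w < t <-> forall j, c j != 0 -> - (w *m B *m l j) 0 0 < t * c j).
  move=> t0; have cp j : c j != 0 -> 0 < c j by rewrite lt_def c0 => ->.
  split=> [H j cj|H].
    by rewrite -ltr_pdivrMr ?cp //; apply: le_lt_trans H; apply: le_bigmax_cond.
  by apply: bigmax_lt => // j cj; rewrite ltr_pdivrMr ?cp //; exact: H.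
have rho_ge0 w : 0 <= rho w by exact: bigmax_ge_id.
have rhoZ w t : 0 <= t -> rho (t *: w) = t * rho w.
  rewrite le_eqVlt => /predU1P [<-|t0].
    rewrite scale0r mul0r; apply/eqP; rewrite eq_le rho_ge0 andbT.
    by apply/rho_le => // j _; rewrite !mul0mx mxE oppr0 mul0r.
  have Hle w' t' : 0 < t' -> rho (t' *: w') <= t' * rho w'.
    move=> t'0; apply/rho_le; first by rewrite mulr_ge0 // ltW.
    move=> j cj; rewrite -!scalemxAl mxE -mulrN -mulrA ler_pM2l //.
    by have /rho_le := lexx (rho w'); apply.
  apply/eqP; rewrite eq_le Hle //= -ler_pdivlMl //.
  by have := Hle (t *: w) t^-1; rewrite scalerA mulVf ?gt_eqF // scale1r; apply; rewrite invr_gt0.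
have chart_form (w : 'rV[R]_cell_dim) j : cell_form j (x0 + w *m B) = c j + (w *m B *m l j) 0 0.
  by rewrite /cell_form addrAC subrr add0r.
have closedP w : closed_cell (x0 + w *m B) <-> rho w <= 1.
  split=> H; last first.
    move=> j; rewrite chart_form; case: ifPn => [/eqP cj|cj].
      by rewrite -mulmxA Bl // mulmx0 mxE cj addr0.
    by have /rho_le /(_ j cj) := H; rewrite mul1r => /(_ ler01); move: (_ 0 0) => z Hz; clear -Hz; lra.
  apply/rho_le => // j cj; have := H j; rewrite (negbTE cj) chart_form mul1r.
  by move: (_ 0 0) => z Hz; clear -Hz; lra.
have openP w : open_cell (x0 + w *m B) <-> rho w < 1.
  split=> H; last first.
    move=> j; rewrite chart_form; case: ifPn => [/eqP cj|cj].
      by rewrite -mulmxA Bl // mulmx0 mxE cj addr0.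
    by have /rho_lt /(_ j cj) := H; rewrite mul1r => /(_ ltr01); move: (_ 0 0) => z Hz; clear -Hz; lra.
  apply/rho_lt => // j cj; have := H j; rewrite (negbTE cj) chart_form mul1r.
  by move: (_ 0 0) => z Hz; clear -Hz; lra.
have closed_chart x : closed_cell x -> x0 + (x - x0) *m pinvmx B *m B = x.
  move=> Hx; rewrite KB ?subrKC // => j cj.
  apply/matrixP => i k; rewrite !ord1 [RHS]mxE.
  by have := Hx j; rewrite cj eqxx /cell_form cj add0r.
have M1 : 0 <= M0.
  have := HM0 x0; case: (lerP 0 M0) => // M00 /(_ _) H.
  have : `|x0| <= M0.
    apply: H; rewrite -[x0]addr0 -(mul0mx _ B); apply/closedP.
    by rewrite -(scale0r 0) rhoZ // mul0r.
  by move=> /le_lt_trans /(_ M00); rewrite ltNge normr_ge0.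
pose C := n%:R * (M0 + `|x0|) * `|pinvmx B| + 1.
have C0 : 0 < C by rewrite /C ltr_wpDl // !mulr_ge0 // addr_ge0.
(* Boundedness of the cell enters here: scaled to gauge at most 1, [w] gives a point of the cell,
   and its norm is at most [C]. The term [e / C] permits the division before [rho w] is known to be
   positive. *)
have rhoC w : `|w| <= C * rho w.
  have H1 w' : rho w' <= 1 -> `|w'| <= C.
    move=> /closedP /HM0 H; rewrite -[w']mulmx1 -BK mulmxA.
    apply: le_trans (mulmx_norm_le _ _) _.
    rewrite /C; apply: (@le_trans _ _ (n%:R * (M0 + `|x0|) * `|pinvmx B|)); last first.
      by rewrite lerDl.
    rewrite ler_wpM2r // ler_wpM2l // -[w' *m B](addKr x0) addrC.
    by apply: le_trans (ler_normD _ _) _; rewrite normrN lerD.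
  apply/ler_addgt0Pr => e e0.
  have t0 : 0 < rho w + e / C by rewrite ltr_wpDl // divr_gt0.
  have : `|(rho w + e / C)^-1 *: w| <= C.
    apply: H1; rewrite rhoZ; last by rewrite invr_ge0 ltW.
    rewrite mulrC ler_pdivrMr // mul1r.
    by rewrite lerDl divr_ge0 // ltW.
  rewrite normrZ normfV gtr0_norm // mulrC ler_pdivrMr // mulrDr => /le_trans; apply.
  by rewrite mulrCA divff ?mulr1 // gt_eqF.
have rho_cont : continuous rho.
  move=> w; apply: continuous_at_bigmax => j _.
  apply: (@continuousM _ _ (fun w : 'rV[R]_cell_dim => - (w *m B *m l j) 0 0) (cst _)); last exact: cst_continuous.
  apply: continuousN; apply: (@coord_continuous_at _ _ _ _ (fun w : 'rV[R]_cell_dim => w *m B *m l j)).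
  rewrite (_ : (fun _ => _) = fun w : 'rV[R]_cell_dim => w *m (B *m l j)); first exact: mulmxr_continuous.
  by apply/funext => w'; rewrite -mulmxA.
have rho_gt0 w : w != 0 -> 0 < rho w.
  move=> w0; have : 0 < C * rho w by apply: lt_le_trans (rhoC w); rewrite normr_gt0.
  by rewrite pmulr_rgt0.
have eZ w t : 0 <= t -> enorm (t *: w : 'rV[R]_cell_dim) = t * enorm w.
  by move=> t0; rewrite enormZ ger0_norm.
have e_gt0 := @enorm_gt0 cell_dim.
pose chi v := x0 + ((enorm v / rho v) *: v) *m B.
pose g x := (fun w => (rho w / enorm w) *: w) ((x - x0) *m pinvmx B).
have gE w : g (x0 + w *m B) = (rho w / enorm w) *: w.
  by rewrite /g addrAC subrr add0r -mulmxA BK mulmx1.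
exists chi, g; split.
- move=> v; apply: (@continuousD R 'rV[R]_n 'rV[R]_cell_dim (cst x0)
    (fun v => ((enorm v / rho v) *: v) *m B) v); first exact: cst_continuous.
  apply: (@continuous_comp 'rV[R]_cell_dim 'rV[R]_cell_dim 'rV[R]_n
    (fun v => (enorm v / rho v) *: v) (fun w => w *m B)); last exact: mulmxr_continuous.
  apply: (@radial_continuous _ _ _ C) => //; [exact: enorm_continuous|exact: enorm0].
- move=> x; apply: (@continuous_comp 'rV[R]_n 'rV[R]_cell_dim 'rV[R]_cell_dim
    (fun x => (x - x0) *m pinvmx B) (fun w => (rho w / enorm w) *: w)).
    apply: (@continuous_comp 'rV[R]_n 'rV[R]_n 'rV[R]_cell_dim
      (fun x => x - x0) (fun w => w *m pinvmx B)); last exact: mulmxr_continuous.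
    by apply: (@continuousB _ _ _ id (cst x0)); [exact: cvg_id|exact: cst_continuous].
  apply: (@radial_continuous _ _ _ 1) => //.
  + exact: enorm_continuous.
  + by rewrite -(scale0r 0) rhoZ // mul0r.
  + by move=> v; rewrite mul1r norm_le_enorm.
- move=> v v1; have [r1 r2] := radialK eZ rhoZ e_gt0 rho_gt0 v.
  by rewrite gE r2; split => //; apply/closedP; rewrite r1.
- move=> x Hx; have xE := closed_chart x Hx.
  have := Hx; rewrite -{1}xE => /closedP w1.
  have [r1 r2] := radialK rhoZ eZ rho_gt0 e_gt0 ((x - x0) *m pinvmx B).
  by rewrite /g r1; split => //; rewrite /chi r2.
- move=> x Hx; have xE := closed_chart x Hx.
  have [r1 r2] := radialK rhoZ eZ rho_gt0 e_gt0 ((x - x0) *m pinvmx B).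
  by rewrite /g r1 -{1}xE; exact: openP.
Qed.
End Polytope.
End Radial.

(** * Cell structures on polyhedra *)

Section EmbeddedCells.
Context {R : realType}.
Variables (n : nat) (X : set 'rV[R]_n) (I : Type) (dim : I -> nat).
Variables (chi : forall i, 'rV[R]_(dim i) -> 'rV[R]_n) (g : forall i, 'rV[R]_n -> 'rV[R]_(dim i)).
Arguments chi : clear implicits.
Arguments g : clear implicits.
Let cell_set i : set 'rV[R]_n := chi i @` @eball R (dim i).
Hypothesis X0 : X !=set0.
Hypothesis chi_cont : forall i, continuous (chi i).
Hypothesis g_cont : forall i, continuous (g i).
Hypothesis chiX : forall i v, enorm v <= 1 -> X (chi i v) /\ g i (chi i v) = v.
Hypothesis cell_disj : forall i j x, cell_set i x -> cell_set j x -> i = j.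
Hypothesis cell_cover : forall x, X x -> exists i, cell_set i x.
Hypothesis cell_bd : forall i, exists (N : nat) (e : 'I_N -> I),
  (forall a, (dim (e a) < dim i)%N) /\
  forall v, enorm v = 1 -> exists a, cell_set (e a) (chi i v).
Hypothesis cell_lf : forall x, X x -> exists (U : set 'rV[R]_n) (N : nat) (e : 'I_N -> I),
  [/\ open U, U x & forall y, X y -> U y -> exists a, cell_set (e a) y].

Let T : topologicalType := set_type X.

(** Points outside [X] are sent to an arbitrary point of [X], which makes the map total. *)
Let in_subtype (x : 'rV[R]_n) : T :=
  if pselect (X x) is left Hx then exist _ x (mem_set Hx)
  else exist _ (projT1 (cid X0)) (mem_set (projT2 (cid X0))).

Let in_subtypeK x : X x -> set_val (in_subtype x) = x.
Proof. by rewrite /in_subtype; case: pselect. Qed.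

Let set_valX (t : T) : X (set_val t).
Proof. exact: set_valP. Qed.

Let set_valK (t : T) : in_subtype (set_val t) = t.
Proof. by apply: val_inj; rewrite [LHS]in_subtypeK. Qed.

Let val_cont : continuous (set_val : T -> 'rV[R]_n).
Proof. exact: initial_continuous. Qed.

Let within_in_subtype m (A : set 'rV[R]_m) (f : 'rV[R]_m -> 'rV[R]_n) :
  continuous f -> (forall x, A x -> X (f x)) -> {within A, continuous (fun x => in_subtype (f x))}.
Proof.
move=> cf AX; apply: continuous_comp_initial.
apply: (@subspace_eq_continuous _ _ _ f); last exact: continuous_subspaceT.
by move=> x /set_mem /AX fX /=; rewrite [RHS]in_subtypeK.
Qed.

(** The cells of dimension [d] are indices with a proof of [dim i = d]; [char] transports along that
    proof, which is destructed whenever a single cell is studied. *)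
Let cell (d : nat) : Type := {i : I | dim i = d}.

Let char d (c : cell d) : 'rV[R]_d -> T :=
  let: exist i e := c in
  match e in _ = d' return 'rV[R]_d' -> T with erefl => fun v => in_subtype (chi i v) end.

Let mk_cell i : cell (dim i) := exist (fun j => dim j = dim i) i erefl.

Let char_eball i t : (char (mk_cell i) @` @eball R (dim i)) t -> cell_set i (set_val t).
Proof.
by move=> [v v1 <-]; exists v => //=; rewrite in_subtypeK //; apply: (chiX (ltW v1)).1.
Qed.

Let cell_char i t : cell_set i (set_val t) -> (char (mk_cell i) @` @eball R (dim i)) t.
Proof. by move=> [v v1 vt]; exists v => //=; rewrite vt set_valK. Qed.

Lemma embedded_cells_CW (e : int) : (forall i, (dim i)%:Z <= e) ->
  homeomorphic_to_CW_dim_le R X e.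
Proof.
move=> He; exists T, cell, char; split; last 2 first.
- by move=> d [i <-].
- exists in_subtype, set_val; split.
  + by apply: (@within_in_subtype _ _ id) => // x; exact: cvg_id.
  + exact: continuous_subspaceT.
  + by move=> x Xx; split => //; exact: in_subtypeK.
  + by move=> t _; split; [exact: set_valX|exact: set_valK].
split.
- rewrite open_hausdorff => s t st.
  have st' : set_val s != set_val t :> 'rV[R]_n by apply: contra_neq st => /val_inj.
  have := @norm_hausdorff R 'rV[R]_n; rewrite open_hausdorff => /(_ _ _ st').
  move=> [[A B] /= [sA tB] [oA oB AB]].
  exists (set_val @^-1` A, set_val @^-1` B) => /=.
    by split; rewrite inE; [move/set_mem: sA|move/set_mem: tB].
  split; [by apply: open_comp => // ? _; exact: val_cont|by apply: open_comp => // ? _; exact: val_cont|].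
  apply/eqP/seteqP; split => // z [Az Bz]; have : (A `&` B) (set_val z) by [].
  by rewrite (eqP AB).
- move=> d [i ei]; case: d / ei => /=.
  by apply: within_in_subtype => // x x1; exact: (chiX x1).1.
- move=> d [i ei]; case: d / ei => /=.
  exists (fun t : T => g i (set_val t)); split.
  + by apply: within_in_subtype => // x /ltW x1; exact: (chiX x1).1.
  + apply: continuous_subspaceT => t; apply: (@continuous_comp T 'rV[R]_n 'rV[R]_(dim i) set_val (g i)).
      exact: val_cont.
    exact: g_cont.
  + move=> v v1; split; first by exists v.
    have [Xv gv] := chiX (ltW v1 : enorm v <= 1).
    by rewrite in_subtypeK.
  + move=> _ [v v1 <-]; have [Xv gv] := chiX (ltW v1 : enorm v <= 1).
    by rewrite in_subtypeK // gv.
- move=> d [i ei] d' [j ej]; case: d / ei; case: d' / ej => -[t [/char_eball ti /char_eball tj]].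
  by have ij := cell_disj ti tj; case: j / ij tj.
- move=> t; have [i ti] := cell_cover (set_valX t).
  by exists (dim i), (mk_cell i); exact: cell_char.
- move=> d [i ei]; case: d / ei; have [N [b [b1 b2]]] := cell_bd i.
  exists N, (fun a => existT cell (dim (b a)) (mk_cell (b a))); split => // _ [v v1 <-].
  have [a Ha] := b2 v v1; exists a => //; apply: cell_char => /=.
  by rewrite in_subtypeK //; apply: (chiX _).1; rewrite v1.
(* Local finiteness gives the weak topology: near [t] the set [A] is covered by its intersections
   with finitely many closed cells, and their union is closed. *)
- move=> A Acl t tA; have [U [N [b [oU Ut HU]]]] := cell_lf (set_valX t).
  pose F (a : 'I_N) : set T := A `&` char (mk_cell (b a)) @` @cball R (dim (b a)).
  have cF a : closed (F a) by exact: Acl.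
  have FE : \bigcup_(a in [set: 'I_N]) F a = \big[setU/set0]_(a <- enum 'I_N) F a.
    rewrite -bigcup_seq; congr (\bigcup_(a in _) F a).
    by apply/seteqP; split => a //= _; rewrite mem_enum.
  have clF : closed (\bigcup_(a in [set: 'I_N]) F a) by rewrite FE; exact: closed_bigsetU.
  have : (\bigcup_(a in [set: 'I_N]) F a) t.
    apply: clF => W Wt.
    have nU : nbhs t (set_val @^-1` U : set T) by apply: val_cont; exact: (near_open oU Ut).
    have [s [As [Ws Us]]] := tA _ (filterI Wt nU).
    exists s; split => //; have [a Ha] := HU _ (set_valX s) Us.
    exists a => //; split => //.
    have [v v1 vs] := Ha; exists v; first exact: ltW.
    by rewrite /= vs set_valK.
  by move=> [a _ []].
Qed.
End EmbeddedCells.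

(* Cells are cut out by the signs of the given affine forms together with the
   integer grid, which keeps them bounded. *)
Section Polyhedron.
Context {R : realType}.
Variables (n : nat) (A : finType) (c : A -> R) (l : A -> 'cV[R]_n) (X : set 'rV[R]_n).

Definition affine_form a (x : 'rV[R]_n) : R := c a + (x *m l a) 0 0.

Hypothesis X0 : X !=set0.
Hypothesis Xsign : forall x y, X x ->
  (forall a, (0 <= affine_form a x -> 0 <= affine_form a y) /\
             (affine_form a x <= 0 -> affine_form a y <= 0)) -> X y.

Let J : finType := (A + ('I_n + 'I_n))%type.
Let flr (x : 'rV[R]_n) i : R := (Num.floor (x 0 i))%:~R.

(** The constraints of the cell of [x0], oriented to be nonnegative at [x0]. Each coordinate is
    confined between consecutive integers, and it is frozen when it is integral at [x0], because a
    zero value of [cj] marks an equation. *)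
Let cj (x0 : 'rV[R]_n) (j : J) : R := match j with
  | inl a => `|affine_form a x0|
  | inr (inl i) => x0 0 i - flr x0 i
  | inr (inr i) => flr x0 i + 1 - x0 0 i
  end.

Let lj (x0 : 'rV[R]_n) (j : J) : 'cV[R]_n := match j with
  | inl a => (if affine_form a x0 < 0 then -1 else 1) *: l a
  | inr (inl i) => delta_mx i 0
  | inr (inr i) => - delta_mx i 0
  end.

(** A complete invariant of the open cell containing [x]: the signs of the forms, the integer parts
    of the coordinates, and which coordinates are integers. It depends on no centre and serves as
    the index of the cell. *)
Let key (x : 'rV[R]_n) : {ffun J -> int} := [ffun j => match j with
  | inl a => sgz (affine_form a x)
  | inr (inl i) => Num.floor (x 0 i)
  | inr (inr i) => (x 0 i == flr x i : nat)%:Z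
  end].

Let cj_ge0 x0 j : 0 <= cj x0 j.
Proof.
case: j => [a|[i|i]] /=; first exact: normr_ge0.
  by rewrite subr_ge0 floor_le.
by rewrite subr_ge0 ltW // /flr -intrD1 floorD1_gt.
Qed.

Let mul_delta (v : 'rV[R]_n) i : (v *m (delta_mx i 0 : 'cV[R]_n)) 0 0 = v 0 i.
Proof. by rewrite -colE mxE. Qed.

Let sub00 (p q : 'M[R]_1) : (p - q) 0 0 = p 0 0 - q 0 0.
Proof. by rewrite !mxE. Qed.

Let scale00 (k : R) (p : 'M[R]_1) : (k *: p) 0 0 = k * p 0 0.
Proof. by rewrite mxE. Qed.

Let formE x0 x j : cell_form (cj x0) (lj x0) x0 j x = match j with
  | inl a => (if affine_form a x0 < 0 then -1 else 1) * affine_form a x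
  | inr (inl i) => x 0 i - flr x0 i
  | inr (inr i) => flr x0 i + 1 - x 0 i
  end.
Proof.
rewrite /cell_form; case: j => [a|[i|i]] /=.
- rewrite -scalemxAr scale00 mulmxBl sub00 /affine_form.
  move: ((x *m l a) 0 0) ((x0 *m l a) 0 0) => p q.
  by case: ltrP => [/ltr0_norm ->|/ger0_norm ->]; ring.
- by rewrite mul_delta !mxE; ring.
- by rewrite mulmxN mxE mul_delta !mxE; ring.
Qed.

Let cj0 x0 j : (cj x0 j == 0) = match j with
  | inl a => affine_form a x0 == 0
  | inr (inl i) => x0 0 i == flr x0 i
  | inr (inr i) => false
  end.
Proof.
case: j => [a|[i|i]] /=; first exact: normr_eq0.
  exact: subr_eq0.
by apply/negbTE; rewrite gt_eqF // subr_gt0 /flr -intrD1 floorD1_gt.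
Qed.

Let openP x0 x : open_cell (cj x0) (lj x0) x0 x <-> key x = key x0.
Proof.
split=> H.
  apply/ffunP => -[a|[i|i]]; rewrite !ffunE.
  - have := H (inl a); rewrite cj0 formE.
    have [s0|s0|s0] := ltrgtP (affine_form a x0) 0.
    + by rewrite mulN1r oppr_gt0 => s1; rewrite !ltr0_sgz.
    + by rewrite mul1r => s1; rewrite !gtr0_sgz.
    + by rewrite mul1r s0 => ->.
  - have := H (inr (inl i)); have := H (inr (inr i)); rewrite !cj0 !formE.
    rewrite subr_gt0 => H1 H2; apply/floor_def; rewrite intrD1 H1 andbT.
    by move: H2; case: ifP => _ H2; rewrite -/(flr x0 i) -subr_ge0; [rewrite H2|exact: ltW].
  - have := H (inr (inl i)); have := H (inr (inr i)); rewrite !cj0 !formE.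
    rewrite subr_gt0 => H1 H2.
    have fE : Num.floor (x 0 i) = Num.floor (x0 0 i).
      apply/floor_def; rewrite intrD1 H1 andbT.
      by move: H2; case: ifP => _ H2; rewrite -/(flr x0 i) -subr_ge0; [rewrite H2|exact: ltW].
    rewrite /flr fE; move: H2; case: ifP => [/eqP h /eqP|h].
      by rewrite subr_eq0 => ->.
    by rewrite subr_gt0 => /gt_eqF ->.
move=> j; rewrite cj0 formE.
have Hj j' : key x j' = key x0 j' by rewrite H.
case: j => [a|[i|i]].
- have := Hj (inl a); rewrite !ffunE.
  have [s0|s0|s0] := ltrgtP (affine_form a x0) 0.
  + by rewrite (ltr0_sgz s0) mulN1r oppr_gt0 => /eqP; rewrite sgz_cp0.
  + by rewrite (gtr0_sgz s0) mul1r => /eqP; rewrite sgz_cp0.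
  + by rewrite s0 sgz0 mul1r => /eqP; rewrite sgz_eq0 => /eqP.
- have := Hj (inr (inl i)); have := Hj (inr (inr i)); rewrite !ffunE /flr => + fE.
  rewrite fE => hk.
  have <- : (x 0 i == (Num.floor (x0 0 i))%:~R) = (x0 0 i == (Num.floor (x0 0 i))%:~R).
    by move: hk; do 2!case: (_ == _).
  case: ifP => [/eqP ->|h]; first by rewrite subrr.
  by rewrite subr_gt0 lt_neqAle eq_sym h -fE floor_le.
- have := Hj (inr (inl i)); rewrite !ffunE /flr => <-.
  by rewrite subr_gt0 -intrD1 floorD1_gt.
Qed.

Let closed_bounded x0 x : closed_cell (cj x0) (lj x0) x0 x -> `|x| <= `|x0| + 2.
Proof.
move=> H; apply: norm_le_coord => [|a i]; first by rewrite addr_ge0.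
rewrite !ord1.
have := H (inr (inl i)); have := H (inr (inr i)); rewrite !cj0 !formE => H1 H2.
have {}H2 : 0 <= x 0 i - flr x0 i by move: H2; case: ifP => // _ ->.
have f1 := floor_le (x0 0 i); have f2 := floorD1_gt (x0 0 i).
rewrite intrD1 in f2; rewrite -/(flr x0 i) in f1 f2.
have := coord_le_norm x0 0 i; rewrite !ler_norml => /andP [f3 f4].
by apply/andP; split; lra.
Qed.

Let closedX x0 x : X x0 -> closed_cell (cj x0) (lj x0) x0 x -> X x.
Proof.
move=> Xx0 H; apply: Xsign Xx0 _ => a.
have := H (inl a); rewrite cj0 formE.
have [s0|s0|s0] := ltrgtP (affine_form a x0) 0.
- by rewrite mulN1r oppr_ge0.
- by rewrite mul1r.
- by rewrite mul1r => ->.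
Qed.

Let kerP x m (v : 'M[R]_(m, n)) : v *m cell_matrix (cj x) (lj x) = 0 <->
  (forall a, affine_form a x = 0 -> v *m l a = 0) /\
  (forall i, x 0 i = flr x i -> v *m (delta_mx i 0 : 'cV[R]_n) = 0).
Proof.
split=> [/cell_matrixP H|[H1 H2]].
  split=> [a ha|i hi].
    by have := H (inl a); rewrite /= ha normr0 ltxx scale1r => /(_ erefl).
  by have := H (inr (inl i)); rewrite /= hi subrr => /(_ erefl).
apply/cell_matrixP => -[a|[i|i]] /eqP; rewrite cj0 //.
  by move=> /eqP ha; rewrite /= -scalemxAr H1 // scaler0.
by move=> /eqP hi; exact: H2.
Qed.

(** All equations of the cell of [x0] persist at the boundary point [y], so its direction space
    shrinks. It shrinks strictly: the vector [x0 - y] belongs to the larger space, but changes a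
    form that vanishes at [y] and not at [x0]. Only the key of [y] matters, so [y'] may be the
    representative of its cell. *)
Let dim_lt x0 y y' : closed_cell (cj x0) (lj x0) x0 y -> ~ open_cell (cj x0) (lj x0) x0 y ->
  key y' = key y -> (cell_dim (cj y') (lj y') < cell_dim (cj x0) (lj x0))%N.
Proof.
move=> Hc Ho Hk.
have keya a : (affine_form a y' == 0) = (affine_form a y == 0).
  have /ffunP /(_ (inl a)) := Hk; rewrite !ffunE => h.
  by rewrite -(sgz_eq0 (affine_form a y')) -(sgz_eq0 (affine_form a y)) h.
have keyi i : (y' 0 i == flr y' i) = (y 0 i == flr y i).
  by have /ffunP /(_ (inr (inr i))) := Hk; rewrite !ffunE; do 2!case: eqP.
have kery m (v : 'M[R]_(m, n)) : v *m cell_matrix (cj y') (lj y') = 0 <->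
  (forall a, affine_form a y = 0 -> v *m l a = 0) /\
  (forall i, y 0 i = flr y i -> v *m (delta_mx i 0 : 'cV[R]_n) = 0).
  split=> [/kerP [H1 H2]|[H1 H2]].
    split=> [a /eqP|i /eqP]; first by rewrite -keya => /eqP; exact: H1.
    by rewrite -keyi => /eqP; exact: H2.
  apply/kerP; split=> [a /eqP|i /eqP]; first by rewrite keya => /eqP; exact: H1.
  by rewrite keyi => /eqP; exact: H2.
suff : (kermx (cell_matrix (cj y') (lj y')) < kermx (cell_matrix (cj x0) (lj x0)))%MS.
  by rewrite ltmxErank => /andP [].
rewrite ltmxE; apply/andP; split.
  apply/sub_kermxP/kerP.
  have [H1 H2] := (kery _ _).1 (mulmx_ker (cell_matrix (cj y') (lj y'))).
  split=> [a ha|i hi].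
    by apply: H1; have := Hc (inl a); rewrite cj0 ha eqxx formE ha ltxx mul1r.
  apply: H2; have := Hc (inr (inl i)); rewrite cj0 hi eqxx formE => /eqP.
  by rewrite subr_eq0 => /eqP yE; rewrite /flr yE /flr intrKfloor.
apply/negP => sub; apply: Ho => j; have := Hc j; case: ifP => // cj' q0.
rewrite lt_def q0 andbT; apply/negP => /eqP qj.
pose v := x0 - y.
have vk : (v <= kermx (cell_matrix (cj x0) (lj x0)))%MS.
  apply/sub_kermxP/cell_matrixP => j' hj'.
  have := Hc j'; rewrite hj' eqxx /cell_form hj' add0r => h.
  apply/matrixP => a b; rewrite !ord1 [RHS]mxE -[v]opprB mulNmx mxE h oppr0.
  by [].
have /sub_kermxP/kery [H1 H2] := submx_trans vk sub.
have vl : ((y - x0) *m lj x0 j) 0 0 = 0.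
  rewrite -[y - x0]opprB -/v mulNmx mxE.
  have -> : v *m lj x0 j = 0; last by rewrite mxE oppr0.
  move: qj cj'; rewrite cj0 formE; case: (j) => [a|[i|i]] /= /eqP.
  - rewrite mulf_eq0; case: ifP => _; rewrite ?oppr_eq0 oner_eq0 /= => /eqP h _;
    by rewrite -scalemxAr H1 // scaler0.
  - by rewrite subr_eq0 => /eqP h _; apply: H2; rewrite /flr h /flr intrKfloor.
  - rewrite subr_eq0 => /eqP h _; rewrite mulmxN H2 ?oppr0 //.
    by rewrite /flr -h /flr -intrD1 intrKfloor.
move: qj; rewrite /cell_form vl addr0 => /eqP; by rewrite cj'.
Qed.

Let finite_keys (S : set 'rV[R]_n) (M : R) : (forall x, S x -> `|x| <= M) ->
  finite_set (key @` S).
Proof.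
move=> SM; pose K := (`|Num.floor M|%N + 2)%N.
pose F (f : {ffun J -> 'I_(K + K)}) : {ffun J -> int} := [ffun j => (f j : nat)%:Z - K%:Z].
apply: (@sub_finite_set _ _ (F @` setT)); last exact/finite_image/finite_finset.
move=> _ [x Sx <-].
have kb j : - K%:Z <= key x j < K%:Z.
  rewrite ffunE; case: j => [a|[i|i]].
  - by rewrite /K; case: sgzP => _; lia.
  - have := coord_le_norm x 0 i; rewrite ler_norml => /andP [h1 h2].
    have h3 := SM x Sx.
    have h4 : Num.floor (x 0 i) <= Num.floor M by apply: le_floor; apply: le_trans h3.
    have h5 : - Num.floor M - 1 <= Num.floor (x 0 i).
      rewrite floor_ge_int rmorphB rmorphN /=.
      have := floorD1_gt M; rewrite intrD1 => h6.
      by lra.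
    by rewrite /K; lia.
  - by rewrite /K; case: (_ == _); lia.
have kb' j : (absz (key x j + K%:Z)%R < K + K)%N by have := kb j; lia.
exists [ffun j => Ordinal (kb' j)] => //.
by apply/ffunP => j; rewrite !ffunE /= -/(key x j); have := kb j; rewrite ffunE; lia.
Qed.

Let I : Type := {k : {ffun J -> int} | exists x, X x /\ key x = k}.

Let finite_cells (S : set 'rV[R]_n) (M : R) : (forall x, S x -> `|x| <= M) -> S `<=` X ->
  exists (N : nat) (e : 'I_N -> I),
    (forall a, exists2 x, S x & key x = sval (e a)) /\
    (forall x, S x -> exists a, sval (e a) = key x).
Proof.
move=> /finite_keys /finite_seqP [s Hs] SX.
have sP (a : 'I_(size s)) : exists2 x, S x & key x = tnth (in_tuple s) a.
  have : [set` s] (tnth (in_tuple s) a) by rewrite /= mem_tnth.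
  by rewrite -Hs => -[x Sx xk]; exists x.
have sX (a : 'I_(size s)) : exists x, X x /\ key x = tnth (in_tuple s) a.
  by have [x /SX Xx xk] := sP a; exists x.
exists (size s), (fun a => exist (fun k => exists x, X x /\ key x = k) _ (sX a)); split=> [a|x Sx] /=; first exact: sP.
have : [set` s] (key x) by rewrite -Hs; exists x.
move=> /= /(nthP (key x)) [i si <-]; exists (Ordinal si).
by rewrite (tnth_nth (key x)).
Qed.

(** The dimension is bounded through the forms that vanish at the point; the grid equations can only
    lower it further. *)
Lemma polyhedron_CW (e : nat) :
  (forall x, X x -> forall d (B : 'M[R]_(d, n)), row_free B ->
     (forall a, affine_form a x = 0 -> B *m l a = 0) -> (d <= e)%N) ->
  homeomorphic_to_CW_dim_le R X e%:Z.
Proof.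
move=> He.
pose x0 (i : I) := projT1 (cid (svalP i)).
have Xx0 i : X (x0 i) by have [] := projT2 (cid (svalP i)).
have key0 i : key (x0 i) = sval i by have [] := projT2 (cid (svalP i)).
pose dim i := cell_dim (cj (x0 i)) (lj (x0 i)).
have HP i : exists p : ('rV[R]_(dim i) -> 'rV[R]_n) * ('rV[R]_n -> 'rV[R]_(dim i)),
    [/\ continuous p.1, continuous p.2,
        (forall v, enorm v <= 1 -> closed_cell (cj (x0 i)) (lj (x0 i)) (x0 i) (p.1 v) /\ p.2 (p.1 v) = v),
        (forall x, closed_cell (cj (x0 i)) (lj (x0 i)) (x0 i) x -> enorm (p.2 x) <= 1 /\ p.1 (p.2 x) = x) &
        (forall x, closed_cell (cj (x0 i)) (lj (x0 i)) (x0 i) x ->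
          (open_cell (cj (x0 i)) (lj (x0 i)) (x0 i) x <-> enorm (p.2 x) < 1))].
  have [chi [g H]] := polytope_cell (l := lj (x0 i)) (x0 := x0 i) (cj_ge0 (x0 i))
    (ex_intro _ (`|x0 i| + 2) (@closed_bounded (x0 i))).
  by exists (chi, g).
pose chi i := (projT1 (cid (HP i))).1; pose g i := (projT1 (cid (HP i))).2.
have chiP i := projT2 (cid (HP i)).
have open_closed i x : open_cell (cj (x0 i)) (lj (x0 i)) (x0 i) x ->
    closed_cell (cj (x0 i)) (lj (x0 i)) (x0 i) x.
  by move=> H j; have := H j; case: ifP => // _ /ltW.
have cell_setP i x : (chi i @` @eball R (dim i)) x <-> key x = sval i.
  rewrite -key0 -openP; have [_ _ h3 h4 h5] := chiP i; split.
    move=> [v v1 <-]; have [hc hv] := h3 v (ltW v1).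
    by apply/(h5 _ hc); rewrite hv.
  move=> ho; have hc := open_closed _ _ ho; exists ((projT1 (cid (HP i))).2 x).
    exact/(h5 _ hc).
  by have [] := h4 _ hc.
apply: (@embedded_cells_CW R n X I dim chi g X0).
- by move=> i; have [] := chiP i.
- by move=> i; have [] := chiP i.
- by move=> i v v1; have [_ _ h3 _ _] := chiP i; have [/closedX hX hv] := h3 v v1; split => //; exact: hX.
- by move=> i j x /cell_setP h1 /cell_setP h2; apply: eq_sig_hprop => //; rewrite -h1 -h2.
- move=> x Xx; have kx : exists y, X y /\ key y = key x by exists x.
  by exists (exist (fun k => exists y, X y /\ key y = k) _ kx); apply/cell_setP.
- move=> i; pose S := closed_cell (cj (x0 i)) (lj (x0 i)) (x0 i) `\` open_cell (cj (x0 i)) (lj (x0 i)) (x0 i).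
  have [||N [b [b1 b2]]] := @finite_cells S (`|x0 i| + 2).
  + by move=> x [/closed_bounded].
  + by move=> x [/closedX h _]; exact: h.
  exists N, b; split=> [a|v v1].
    by have [y [yc yo] ky] := b1 a; apply: (dim_lt yc yo); rewrite key0.
  have [_ _ h3 _ h5] := chiP i.
  have v1' : enorm v <= 1 by rewrite v1.
  have [hc hv] := h3 v v1'.
  have [a ha] : exists a, sval (b a) = key (chi i v).
    apply: b2; split => // /(h5 _ hc); rewrite hv v1 ltxx //.
  by exists a; apply/cell_setP.
- move=> x Xx; have [||N [b [_ b2]]] := @finite_cells (X `&` ball x 1) (`|x| + 1).
  + move=> y [_]; rewrite -ball_normE /= => /ltW xy.
    rewrite -[y](subrK x) addrC; apply: le_trans (ler_normD _ _) _.
    by rewrite lerD2l distrC.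
  + by move=> y [].
  exists (ball x 1), N, b; split; [exact: ball_open|exact: ballxx|].
  by move=> y Xy xy; have [//|a ha] := b2 y; exists a; apply/cell_setP.
- move=> i; rewrite lez_nat; apply: (He _ (Xx0 i) (dim i) (row_base (kermx (cell_matrix (cj (x0 i)) (lj (x0 i)))))).
    exact: row_base_free.
  have : row_base (kermx (cell_matrix (cj (x0 i)) (lj (x0 i)))) *m cell_matrix (cj (x0 i)) (lj (x0 i)) = 0.
    by apply/sub_kermxP; rewrite eq_row_base.
  by move=> /kerP [].
Qed.
End Polyhedron.

(** * Hyperbolic cylinders *)

Section Components.
Context {T : topologicalType}.

(** [M] is relatively open and relatively closed in [Z], so a component of [Z] that meets [M] stays
    in [M]. *)
Lemma union_of_components_clopen (Z M O C : set T) : open O -> closed C ->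
  M = Z `&` O -> M = Z `&` C -> union_of_components Z M.
Proof.
move=> oO cC MO MC; split=> [x|x Mx]; first by rewrite MO => -[].
have Zx : Z x by move: Mx; rewrite MO => -[].
have KZ := @connected_component_sub T Z x.
have KM D : M = Z `&` D -> connected_component Z x `&` M = connected_component Z x `&` D.
  move=> ->; apply/seteqP; split=> y [Ky]; first by move=> [_ Dy].
  by move=> Dy; split => //; split => //; exact: KZ.
have := @component_connected T Z x (connected_component Z x `&` M).
move=> H y Ky; rewrite -H in Ky; first by case: Ky.
- by exists x; split => //; exact: connected_component_refl.
- by exists O => //; exact: KM.
- by exists C => //; exact: KM.
Qed.

Lemma connected_star (A : set T) x0 :
  (forall x, A x -> exists C, [/\ connected C, C `<=` A, C x0 & C x]) -> connected A.
Proof.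
move=> H.
have -> : A = \bigcup_(C in [set C | [/\ connected C, C `<=` A & C x0]]) C.
  apply/seteqP; split=> [x /H [C [cC CA C0 Cx]]|x [C [_ CA _] /CA //]].
  by exists C.
by apply: bigcup_connected => [|C []//]; exists x0 => C [].
Qed.

Lemma path_connected_image (R : realType) (A : set T) (gam : R -> T) :
  continuous gam -> (forall s, 0 <= s <= 1 -> A (gam s)) ->
  exists C, [/\ connected C, C `<=` A, C (gam 0) & C (gam 1)].
Proof.
move=> cg HA; exists (gam @` `[0, 1]); split.
- apply: connected_continuous_connected; first exact: segment_connected.
  exact: continuous_subspaceT.
- by move=> _ [s /= s01 <-]; apply: HA; move: s01; rewrite in_itv.
- by exists 0 => //=; rewrite in_itv /= lexx ler01.
- by exists 1 => //=; rewrite in_itv /= lexx ler01.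
Qed.

Lemma is_component_union (Z M : set T) x :
  union_of_components Z M -> connected M -> M x -> is_component Z M.
Proof.
move=> [MZ MK] cM Mx; exists x; first exact: MZ.
apply/seteqP; split; first exact: connected_component_max.
exact: MK.
Qed.
End Components.

Lemma segment_continuous (R : realType) (V : normedModType R) (z y : V) :
  continuous (fun t : R => z + t *: (y - z)).
Proof.
move=> t; apply: (@continuousD R V R (cst z) (fun t => t *: (y - z)) t); first exact: cst_continuous.
by apply: continuousZr_tmp; exact: cvg_id.
Qed.

Lemma star_shaped_connected (R : realType) (V : normedModType R) (A : set V) z :
  (forall y t, A y -> 0 <= t <= 1 -> A (z + t *: (y - z))) -> connected A.
Proof.
move=> H; apply: (connected_star (x0 := z)) => y Ay.
have [t t01|C [cC CA C0 C1]] := path_connected_image (@segment_continuous R V z y) (A := A).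
  exact: H.
exists C; split => //; first by move: C0; rewrite scale0r addr0.
by move: C1; rewrite scale1r subrKC.
Qed.

(** * Ranks, column spans and scalar quadratic functions *)

Section LinearAlgebra.
Context {R : realType}.

Lemma rank_columns k s (J : 'M[R]_(k, s)) :
  (forall mu : 'cV[R]_s, J *m mu = 0 -> mu = 0) -> \rank J = s.
Proof.
move=> H; rewrite -mxrank_tr; apply/eqP; apply: inj_row_free => v vJ.
apply: trmx_inj; rewrite trmx0; apply: H.
by apply: trmx_inj; rewrite trmx_mul trmxK vJ trmx0.
Qed.

Lemma mulmx_cols k s (J : 'M[R]_(k, s)) (mu : 'cV[R]_s) :
  J *m mu = \sum_i mu i 0 *: col i J.
Proof.
apply/matrixP => a b; rewrite ord1 summxE mxE; apply: eq_bigr => i _.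
by rewrite !mxE mulrC.
Qed.

(** A column space is its own double annihilator. This is the source of the Lagrange multipliers
    later on. *)
Lemma column_span k s (J : 'M[R]_(k, s)) (e : 'cV[R]_k) :
  (forall v : 'rV[R]_k, v *m J = 0 -> v *m e = 0) -> exists mu : 'cV[R]_s, e = J *m mu.
Proof.
move=> H; have : (e^T <= J^T)%MS.
  rewrite submxE; apply/eqP/trmx_inj; rewrite trmx0 trmx_mul trmxK.
  apply/row_matrixP => i; rewrite row_mul row0; apply: H.
  have E : (cokermx J^T)^T *m J = 0 by apply: trmx_inj; rewrite trmx_mul trmxK trmx0 mulmx_coker.
  by rewrite -row_mul E row0.
by move=> /submxP [mu /(congr1 trmx)]; rewrite trmxK trmx_mul trmxK => ->; exists mu^T.
Qed.

Lemma mx11B (p q : 'M[R]_1) : (p - q) 0 0 = p 0 0 - q 0 0.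
Proof. by rewrite !mxE. Qed.

Lemma mx11D (p q : 'M[R]_1) : (p + q) 0 0 = p 0 0 + q 0 0.
Proof. by rewrite !mxE. Qed.

Lemma mx11Z (t : R) (p : 'M[R]_1) : (t *: p) 0 0 = t * p 0 0.
Proof. by rewrite mxE. Qed.

(* [A (x + x)] is the gradient at [x], as a column. *)
Definition squadratic k (f : 'rV[R]_k -> R) (A : 'rV[R]_k -> 'cV[R]_k) :=
  (forall x x', f x - f x' = ((x - x') *m A (x + x')) 0 0) /\
  forall v w t, A (t *: v + w) - A 0 = t *: (A v - A 0) + (A w - A 0).

Lemma squadratic_rows k s (F : 'I_s -> 'rV[R]_k -> R) (A : 'I_s -> 'rV[R]_k -> 'cV[R]_k) :
  (forall i, squadratic (F i) (A i)) ->
  quadratic (fun x => \row_i F i x) (fun v => \matrix_(a, i) A i v a 0).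
Proof.
move=> H; split=> [x x'|].
  apply/rowP => i; rewrite !mxE (H i).1 mxE.
  by apply: eq_bigr => a _; rewrite !mxE.
exists (\matrix_(a, i) A i 0 a 0), (fun l => \matrix_(a, i) (A i (delta_mx 0 l) a 0 - A i 0 a 0)) => v.
apply/matrixP => a i; rewrite mxE [RHS]mxE summxE mxE.
have HL : A i v = A i 0 + \sum_l v 0 l *: (A i (delta_mx 0 l) - A i 0).
  apply/eqP; rewrite addrC -subr_eq; apply/eqP.
  rewrite {1}[v]row_sum_delta; elim/big_rec2: _ => [|l y1 y2 _ <-]; first by rewrite subrr.
  by rewrite (H i).2.
rewrite {1}HL mxE summxE; congr (_ + _); apply: eq_bigr => l _.
by rewrite !mxE.
Qed.

Lemma squadratic_continuous k (f : 'rV[R]_k -> R) A : squadratic f A -> continuous f.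
Proof.
move=> fA x; have Q := squadratic_rows (fun _ : 'I_1 => fA).
rewrite (_ : f = fun x => (\row_(i < 1) f x) 0 0).
  by apply: coord_continuous_at; exact: (quadratic_continuous Q).
by apply/funext => y; rewrite mxE.
Qed.

Lemma squadratic_diff k (f : 'rV[R]_k -> R) A g B : squadratic f A -> squadratic g B ->
  squadratic (fun x => f x - g x) (fun v => A v - B v).
Proof.
move=> [f1 f2] [g1 g2]; split=> [x x'|v w t].
  by rewrite mulmxBr mx11B -f1 -g1; ring.
have a := f2 v w t; have b := g2 v w t.
apply/matrixP => i j; move/matrixP/(_ i j): a; move/matrixP/(_ i j): b; rewrite !mxE.
by move=> h1 h2; rewrite opprD addrACA -opprD; lra.
Qed.

Lemma squadratic_affine k (c : R) (l : 'cV[R]_k) :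
  squadratic (fun x => c + (x *m l) 0 0) (fun _ => l).
Proof.
split=> [x x'|v w t]; last by rewrite !subrr scaler0 addr0.
by rewrite mulmxBl mx11B; ring.
Qed.
End LinearAlgebra.

(** * Domains bounded by hyperbolic cylinders in general position *)

Section HyperbolicData.
Context {R : realType}.
Variables (q r : nat).
Let n := q.+2.
Variables (xi : 'I_r -> 'cV[R]_n) (a b c : 'I_r -> R) (sg : 'I_r -> R).

Definition hyp_form j (x : 'rV[R]_n) : R := (x 0 ord0 - b j) * ((x *m xi j) 0 0 - a j) - c j.

Definition hyp_poly j : mpoly n R :=
  (mpolyX R (mnm1 ord0) - mpolyC n (b j)) *
    (\sum_i xi j i 0 *: mpolyX R (mnm1 i) - mpolyC n (a j)) - mpolyC n (c j).

(** The sign [sg j] selects one of the two branches of the hyperbola. *)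
Definition hyp_surface j : set 'rV[R]_n :=
  [set x | hyp_form j x = 0 /\ 0 < sg j * (x 0 ord0 - b j)].

Definition hyp_grad j (x : 'rV[R]_n) : 'cV[R]_n :=
  (x 0 ord0 - b j) *: xi j + ((x *m xi j) 0 0 - a j) *: delta_mx ord0 0.

(** Polarization of the gradient: at [x + x'] this is the mean of the gradients at [x] and [x'],
    which for a quadratic function gives the exact difference quotient. *)
Definition hyp_slope j (v : 'rV[R]_n) : 'cV[R]_n := 2^-1 *:
  ((v 0 ord0 - 2 * b j) *: xi j + ((v *m xi j) 0 0 - 2 * a j) *: delta_mx ord0 0).

Definition hyp_closed : set 'rV[R]_n := [set x | forall j, 0 <= hyp_form j x].
Definition hyp_open : set 'rV[R]_n := [set x | forall j, 0 < hyp_form j x].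

Lemma peval_hyp_poly j x : peval (hyp_poly j) x = hyp_form j x.
Proof.
rewrite /peval /hyp_poly /hyp_form !(mevalB, mevalM, mevalC, mevalXU) raddf_sum /=.
congr (_ * (_ - _) - _); rewrite mxE; apply: eq_bigr => i _.
by rewrite mevalZ mevalXU mulrC.
Qed.

(** [mmeasure mdeg] is the degree plus one on nonzero polynomials, so the bound 3 means degree at
    most 2; the two affine factors have measure at most 2 each. *)
Lemma hyp_poly_size j : (mmeasure mdeg (hyp_poly j) <= 3)%N.
Proof.
have s1 (p : mpoly n R) (d : R) : (mmeasure mdeg p <= 2)%N -> (mmeasure mdeg (p - mpolyC n d) <= 2)%N.
  move=> p2; apply: leq_trans (mmeasureD_le _ _ _) _; rewrite geq_max p2 mmeasureN mmeasureC.
  by case: (_ != _).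
rewrite /hyp_poly; apply: leq_trans (mmeasureD_le _ _ _) _.
rewrite geq_max mmeasureN mmeasureC (leq_trans (leq_b1 _)) // andbT.
set p1 := _ - _; set p2 := _ - _.
have p12 : (mmeasure mdeg p1 <= 2)%N by apply: s1; rewrite msizeX mdeg1.
have p22 : (mmeasure mdeg p2 <= 2)%N.
  apply: s1; apply: leq_trans (mmeasure_sum _ _ _ _) _.
  apply/bigmax_leqP => i _; apply: leq_trans (mmeasureZ_le _ _ _) _.
  by rewrite msizeX mdeg1.
have [->|p10] := eqVneq p1 0; first by rewrite mul0r mmeasure0.
have [->|p20] := eqVneq p2 0; first by rewrite mulr0 mmeasure0.
by rewrite msizeM //; have := leq_add p12 p22; case: (_ + _)%N => // k; rewrite ltnS.
Qed.

Lemma mul_e0 k (v : 'rV[R]_k.+1) : (v *m (delta_mx ord0 0 : 'cV[R]_k.+1)) 0 0 = v 0 ord0.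
Proof. by rewrite -colE mxE. Qed.

Lemma hyp_form_squadratic j : squadratic (hyp_form j) (hyp_slope j).
Proof.
split=> [x x'|v w t].
  rewrite /hyp_slope /hyp_form -scalemxAr mulmxDr -!scalemxAr mx11Z mx11D !mx11Z mul_e0.
  rewrite !mulmxBl !mulmxDl mx11B mx11D !mxE.
  by field.
apply/matrixP => i k; rewrite ord1 /hyp_slope mulmxDl -scalemxAl mx11D mx11Z mul0mx.
have -> : (0 : 'M[R]_1) 0 0 = 0 by rewrite mxE.
move: ((v *m xi j) 0 0) ((w *m xi j) 0 0) => m1 m2; rewrite !mxE.
by field.
Qed.

Lemma hyp_slope_grad j x : hyp_slope j (x + x) = hyp_grad j x.
Proof.
apply/matrixP => i k; rewrite ord1 /hyp_slope /hyp_grad mulmxDl mx11D !mxE.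
by field.
Qed.

Lemma hyp_form_segment j (p v : 'rV[R]_n) (e : R) :
  hyp_form j (p + e *: v) = hyp_form j p + e * (v *m hyp_grad j p) 0 0 +
    e ^+ 2 * (v 0 ord0 * (v *m xi j) 0 0).
Proof.
rewrite /hyp_form /hyp_grad mulmxDl -scalemxAl mulmxDr -!scalemxAr !mx11D !mx11Z mul_e0.
by rewrite !mxE; ring.
Qed.

Lemma hyp_form_continuous j : continuous (hyp_form j).
Proof. exact: squadratic_continuous (hyp_form_squadratic j). Qed.

Lemma coord_diff_continuous k (i : 'I_k) (d : R) : continuous (fun x : 'rV[R]_k => x 0 i - d).
Proof.
move=> x; apply: (@continuousB _ _ _ (fun x : 'rV[R]_k => x 0 i) (cst d)).
  exact: coord_continuous.
exact: cst_continuous.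
Qed.

Hypothesis xi00 : forall j, xi j ord0 0 = 0.
Hypothesis xi_neq0 : forall j, xi j != 0.
Hypothesis c_neq0 : forall j, c j != 0.
Hypothesis sg1 : forall j, sg j = 1 \/ sg j = -1.
Hypothesis closed_surface : forall x j, hyp_closed x -> hyp_form j x = 0 -> hyp_surface j x.
Hypothesis transverse : forall (L : {set 'I_r}) x mu, (forall j, j \in L -> hyp_surface j x) ->
  \sum_(j in L) mu j *: hyp_grad j x = 0 -> forall j, j \in L -> mu j = 0.

Let sg_neq0 j : sg j != 0.
Proof. by case: (sg1 j) => ->; rewrite ?oppr_eq0 oner_eq0. Qed.

Let off_pole j x : hyp_form j x = 0 -> x 0 ord0 - b j != 0.
Proof.
move=> H; apply: contra_neq (c_neq0 j) => H0.
by move: H; rewrite /hyp_form H0 mul0r sub0r => /eqP; rewrite oppr_eq0 => /eqP.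
Qed.

Let side_continuous j : continuous (fun x : 'rV[R]_n => sg j * (x 0 ord0 - b j)).
Proof.
move=> x; apply: (@continuousM _ _ (cst (sg j)) (fun x : 'rV[R]_n => x 0 ord0 - b j) x).
  exact: cst_continuous.
exact: coord_diff_continuous.
Qed.

Let side_open j : open [set x : 'rV[R]_n | 0 < sg j * (x 0 ord0 - b j)].
Proof.
apply: (@open_comp _ _ (fun x : 'rV[R]_n => sg j * (x 0 ord0 - b j)) [set z | 0 < z]).
  by move=> x _; exact: side_continuous.
exact: open_gt.
Qed.

Let side_closed j : closed [set x : 'rV[R]_n | 0 <= sg j * (x 0 ord0 - b j)].
Proof.
apply: (@preimage_closed _ _ (fun x : 'rV[R]_n => sg j * (x 0 ord0 - b j)) [set z | 0 <= z]).
  by move=> x _; exact: side_continuous.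
exact: closed_ge.
Qed.

Lemma hyp_surfaceE j x : hyp_form j x = 0 -> 0 <= sg j * (x 0 ord0 - b j) -> hyp_surface j x.
Proof.
move=> H0 H1; split => //; rewrite lt_def H1 andbT mulf_neq0 //.
exact: off_pole H0.
Qed.

Lemma hyp_grad_neq0 j x : hyp_form j x = 0 -> hyp_grad j x != 0.
Proof.
move=> /off_pole H; apply/eqP => G; case/eqP: (xi_neq0 j).
apply/matrixP => i k; rewrite ord1 [RHS]mxE; have [->|i0] := eqVneq i ord0; first exact: xi00.
move/matrixP/(_ i 0): G; rewrite !mxE (negbTE i0) mulr0 addr0 => /eqP.
by rewrite mulf_eq0 (negbTE H) => /eqP.
Qed.

Section Strata.
Variables (s : nat) (J : 'I_s -> 'I_r).
Let F := fun x : 'rV[R]_n => \row_i hyp_form (J i) x.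
Let FA := fun v : 'rV[R]_n => \matrix_(k, i) hyp_slope (J i) v k 0.

Lemma hyp_rows_quadratic : quadratic F FA.
Proof. by apply: squadratic_rows => i; exact: hyp_form_squadratic. Qed.

Let FA_col x i : col i (FA (x + x)) = hyp_grad (J i) x.
Proof. by apply/matrixP => k l; rewrite ord1 [LHS]mxE [LHS]mxE hyp_slope_grad. Qed.

Lemma hyp_rows_rank x : injective J -> (forall i, hyp_surface (J i) x) -> \rank (FA (x + x)) = s.
Proof.
move=> injJ SJ; apply: rank_columns => mu Hmu.
pose L := [set J i | i : 'I_s]%SET.
pose nu j := if [pick i | J i == j] is Some i then mu i 0 else 0.
have nuJ i : nu (J i) = mu i 0.
  by rewrite /nu; case: pickP => [k /eqP /injJ -> //|/(_ i)]; rewrite eqxx.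
have HL j : j \in L -> hyp_surface j x by move=> /imsetP [i _ ->].
have E : \sum_(j in L) nu j *: hyp_grad j x = 0.
  rewrite big_imset /=; last by move=> i k _ _ /injJ.
  rewrite -[RHS]Hmu mulmx_cols; apply: eq_bigr => i _.
  by rewrite nuJ FA_col.
apply/matrixP => i k; rewrite ord1 mxE -nuJ; apply: (transverse HL E).
by apply/imsetP; exists i.
Qed.

Let S := [set x | forall i, hyp_surface (J i) x].

(** Since [c j] is nonzero, a zero of the form never lies on [x_0 = b j]. Strict and large
    inequalities thus select the same zeros, so the chosen branches are relatively clopen, and on
    them the rows of forms have full rank by transversality. *)
Lemma strata_nonsingular : injective J -> S !=set0 ->
  [/\ (s <= n)%N, nonsingular_by (fun i => hyp_poly (J i)) (n - s) S &
      forall x, S x -> tangent_space (n - s) S x = [set v | forall i, v *m hyp_grad (J i) x = 0]].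
Proof.
move=> injJ [x0 Sx0].
have rk x (Sx : S x) := hyp_rows_rank injJ Sx.
have sn : (s <= n)%N by rewrite -(rk _ Sx0) rank_leq_row.
have pE : pmap (fun i => hyp_poly (J i)) = F.
  by apply/funext => x; apply/rowP => i; rewrite !mxE peval_hyp_poly.
have zE : zeros (fun i => hyp_poly (J i)) = [set x | F x = 0].
  apply/seteqP; split=> x H; first by apply/rowP => i; rewrite !mxE -peval_hyp_poly.
  by move=> i; rewrite peval_hyp_poly; move/rowP/(_ i): H; rewrite !mxE.
pose O := [set x : 'rV[R]_n | forall i, 0 < sg (J i) * (x 0 ord0 - b (J i))].
have oO : open O by apply: (@open_forall _ _ (fun i => [set x : 'rV[R]_n | 0 < sg (J i) * (x 0 ord0 - b (J i))])).
have dE : n = (s + (n - s))%N by rewrite subnKC.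
have SO y : O y -> (S y <-> F y = 0).
  move=> Oy; split=> [Sy|Fy i]; first by apply/rowP => i; rewrite !mxE; case: (Sy i).
  by split; [move/rowP/(_ i): Fy; rewrite !mxE|exact: Oy].
have subS : submanifold (n - s) S.
  apply: (submanifold_regular_zeros dE) => x Sx.
  by exists O, F, FA; split => //; [move=> i; case: (Sx i)|exact: hyp_rows_quadratic|exact: rk].
have J_F x := quadratic_differential hyp_rows_quadratic x.
split => //.
- split => //; last by move=> x Sx; rewrite pE (J_F x).2 rk // subKn.
  + apply: (union_of_components_clopen (O := O)
      (C := \bigcap_(i in [set: 'I_s]) [set x | 0 <= sg (J i) * (x 0 ord0 - b (J i))])) => //.
    * by apply: closed_bigI => i _; exact: side_closed.
    * rewrite zE; apply/seteqP; split=> x; first by move=> Sx; have Ox : O x by [move=> i; case: (Sx i)]; split => //; apply/SO.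
      by move=> [Fx Ox]; apply/SO.
    * rewrite zE; apply/seteqP; split=> x.
        move=> Sx; have Ox : O x by [move=> i; case: (Sx i)].
        by split; [apply/SO|move=> i _; exact/ltW/Ox].
      move=> [Fx Cx] i; apply: hyp_surfaceE; first by move/rowP/(_ i): Fx; rewrite !mxE.
      exact: Cx.
  + exact: leq_subr.
- move=> x Sx; rewrite (tangent_spaceE dE subS Sx oO _ (J_F x).1); last 3 first.
  + by move=> i; case: (Sx i).
  + by move=> y Sy _; apply/rowP => i; rewrite !mxE; case: (Sy i).
  + by rewrite (J_F x).2 rk.
  rewrite (J_F x).2; apply/seteqP; split=> v /=.
    by move=> H i; rewrite -FA_col colE mulmxA H mul0mx.
  move=> H; apply/rowP => i; rewrite [RHS]mxE.
  have <- : (v *m col i (FA (x + x))) 0 0 = 0 by rewrite FA_col H mxE.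
  by rewrite !mxE; apply: eq_bigr => m _; rewrite !mxE.
Qed.
End Strata.

Lemma hyp_surface_nonsingular j : hyp_surface j !=set0 ->
  nonsingular_by (fun _ : 'I_1 => hyp_poly j) (n - 1) (hyp_surface j) /\
  forall x, hyp_surface j x ->
    tangent_space (n - 1) (hyp_surface j) x = [set v | v *m hyp_grad j x = 0].
Proof.
have SE : [set x | forall i : 'I_1, hyp_surface j x] = hyp_surface j.
  by apply/seteqP; split=> x H; [exact: H ord0|move=> _].
have inj1 : injective (fun _ : 'I_1 => j) by move=> i k _; rewrite !ord1.
rewrite -SE => /(strata_nonsingular inj1) [_ ns tg]; split => // x Sx.
by rewrite tg //; apply/seteqP; split=> v //= H; exact: H ord0.
Qed.

(** Translation along [xi j], which preserves x_0 because [xi j] has no such component; the scalar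
    is the solution of the form, affine on each level. The surface becomes the continuous image of a
    half-space, hence is nonempty and connected. *)
Let lift_surface j (x : 'rV[R]_n) : 'rV[R]_n :=
  x + ((a j + c j / (x 0 ord0 - b j) - (x *m xi j) 0 0) / ((xi j)^T *m xi j) 0 0) *: (xi j)^T.

Let xi_sqr j : ((xi j)^T *m xi j) 0 0 != 0.
Proof.
have -> : ((xi j)^T *m xi j) 0 0 = \sum_i ((xi j)^T) 0 i ^+ 2.
  by rewrite mxE; apply: eq_bigr => i _; rewrite !mxE expr2.
rewrite -sqr_enorm sqrf_eq0 gt_eqF // enorm_gt0 //.
by apply: contra_neq (xi_neq0 j) => /(congr1 trmx); rewrite trmxK trmx0.
Qed.

Let lift_surfaceP j (x : 'rV[R]_n) : 0 < sg j * (x 0 ord0 - b j) -> hyp_surface j (lift_surface j x).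
Proof.
move=> H; have h0 : x 0 ord0 - b j != 0 by apply: contraTneq H => ->; rewrite mulr0 ltxx.
have e0 : (lift_surface j x) 0 ord0 = x 0 ord0.
  by rewrite !mxE xi00 mulr0 addr0.
split; last by rewrite e0.
rewrite /hyp_form e0 mulmxDl -scalemxAl mx11D mx11Z divfK ?xi_sqr //.
by field.
Qed.

Lemma hyp_surface_neq0 j : hyp_surface j !=set0.
Proof.
exists (lift_surface j (const_mx (b j + sg j))); apply: lift_surfaceP.
rewrite mxE addrAC subrr add0r -expr2; rewrite exprn_even_gt0 //=; exact: sg_neq0.
Qed.

Lemma hyp_surface_connected j : connected (hyp_surface j).
Proof.
pose H := [set x : 'rV[R]_n | 0 < sg j * (x 0 ord0 - b j)].
have -> : hyp_surface j = lift_surface j @` H.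
  apply/seteqP; split=> [x [fx Hx]|_ [x Hx <-]]; last exact: lift_surfaceP.
  exists x => //; rewrite /lift_surface.
  have h0 := off_pole fx.
  suff -> : a j + c j / (x 0 ord0 - b j) - (x *m xi j) 0 0 = 0 by rewrite mul0r scale0r addr0.
  move: fx; rewrite /hyp_form => /eqP; rewrite subr_eq0 => /eqP <-.
  by field.
apply: connected_continuous_connected.
- apply: (star_shaped_connected (z := const_mx (b j + sg j))) => x t Hx /andP [t0 t1].
  rewrite /H /= !mxE.
  have -> : sg j * (b j + sg j + t * (x 0 ord0 - (b j + sg j)) - b j) =
     (1 - t) * sg j ^+ 2 + t * (sg j * (x 0 ord0 - b j)) by ring.
  have -> : sg j ^+ 2 = 1 by case: (sg1 j) => ->; rewrite ?sqrrN expr1n.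
  move: Hx; rewrite /H /=; move: (sg j * _) => y y0.
  have [->|t0'] := eqVneq t 0; first by rewrite subr0 mul0r addr0 mulr1.
  have : 0 < t * y by rewrite mulr_gt0 // lt_def t0' t0.
  by rewrite mulr1; lra.
- apply: continuous_in_subspaceT => x /set_mem Hx.
  have h0 : x 0 ord0 - b j != 0 by apply: contraTneq Hx => h; rewrite /H /= h mulr0 ltxx.
  apply: (@continuousD _ _ _ id); first exact: cvg_id.
  apply: continuousZr_tmp.
  apply: (@continuousM _ _ _ (cst _)); last exact: cst_continuous.
  apply: (@continuousB _ _ _ (fun x : 'rV[R]_n => a j + c j / (x 0 ord0 - b j))
    (fun x : 'rV[R]_n => (x *m xi j) 0 0)).
    apply: (@continuousD _ _ _ (cst (a j)) (fun x : 'rV[R]_n => c j / (x 0 ord0 - b j))).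
      exact: cst_continuous.
    apply: (@continuousM _ _ (cst (c j)) (fun x : 'rV[R]_n => (x 0 ord0 - b j)^-1)).
      exact: cst_continuous.
    by apply: (@continuousV _ _ (fun x : 'rV[R]_n => x 0 ord0 - b j)) => //; exact: coord_diff_continuous.
  apply: (@coord_continuous_at _ _ _ _ (fun x : 'rV[R]_n => x *m xi j)).
  exact: mulmxr_continuous.
Qed.

Lemma hyp_surface_component j : is_component (zeros (fun _ : 'I_1 => hyp_poly j)) (hyp_surface j).
Proof.
have [x Sx] := hyp_surface_neq0 j.
have [[uc _ _ _] _] := hyp_surface_nonsingular (hyp_surface_neq0 j).
exact: (is_component_union uc (@hyp_surface_connected j) Sx).
Qed.

(** The linear forms [xi j] and x_0 are independent, as [xi j] is nonzero without x_0-component.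
    They are completed to linear coordinates, in which the first two satisfy the equation of the
    hyperbola. *)
Lemma hyp_surface_cylinder j : hyperbola_cylinder q (hyp_surface j).
Proof.
pose J : 'M[R]_(n, 1 + 1) := row_mx (xi j) (delta_mx ord0 0).
have rJ : \rank J = (1 + 1)%N.
  apply: rank_columns => mu; rewrite -[mu]vsubmxK mul_row_col => H.
  have h1 : usubmx mu 0 0 = 0.
    apply/eqP; apply: contraT => m0; case/eqP: (xi_neq0 j).
    apply/matrixP => i k; rewrite ord1 [RHS]mxE; have [->|i0] := eqVneq i ord0; first exact: xi00.
    move/matrixP/(_ i 0): H; rewrite !mxE !big_ord1 !mxE (negbTE i0) mul0r addr0 => /eqP.
    rewrite mulf_eq0 => /orP [/eqP ->//|/eqP h]; case/eqP: m0.
    by rewrite mxE -[RHS]h; congr (mu _ _); apply: val_inj.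
  have u0 : usubmx mu = 0 by apply/matrixP => i k; rewrite !ord1 h1 mxE.
  move: H; rewrite u0 mulmx0 add0r => H.
  have -> : dsubmx mu = 0; last by rewrite col_mx0.
  apply/matrixP => i k; rewrite !ord1 [RHS]mxE.
  by move/matrixP/(_ ord0 0): H; rewrite !mxE big_ord1 !mxE eqxx mul1r => <-.
have [N [K [JK _]]] := complete_columns (erefl : n = ((1 + 1) + q)%N) rJ.
pose H := [set x : 'rV[R]_2 | (x 0 0 - a j) * (x 0 1 - b j) = c j].
exists (row_mx J N), 0, (H `&` [set x : 'rV[R]_2 | 0 < sg j * (x 0 1 - b j)]); split.
- by have [] := mulmx1_unit JK.
- exists (a j), (b j), (c j); split => //=; case: (sg1 j) => ->; [left|right];
    apply: (congr1 (setI H)); apply/seteqP; split=> x /=; rewrite ?mul1r ?mulN1r ?oppr_gt0 ?subr_gt0 ?subr_lt0 //.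
have E (x : 'rV[R]_n) : lsubmx (x *m row_mx J N + 0 : 'rV[R]_((1 + 1) + q)) = x *m J.
  by rewrite addr0 mul_mx_row row_mxKl.
have E0 (x : 'rV[R]_n) : (x *m J) 0 0 = (x *m xi j) 0 0.
  rewrite mul_mx_row; have -> : (0 : 'I_2) = (lshift 1 (0 : 'I_1) : 'I_(1 + 1)) by apply: val_inj.
  by rewrite row_mxEl.
have E1 (x : 'rV[R]_n) : (x *m J) 0 1 = x 0 ord0.
  rewrite mul_mx_row; have -> : (1 : 'I_2) = (rshift 1 (0 : 'I_1) : 'I_(1 + 1)) by apply: val_inj.
  by rewrite row_mxEr mul_e0.
apply/seteqP; split=> x; rewrite /hyp_surface /H /=.
  move=> [h1 h2]; rewrite E E0 E1; split => //.
  by apply/eqP; rewrite -subr_eq0 mulrC; apply/eqP.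
by rewrite E E0 E1 => -[h1 h2]; split => //; rewrite /hyp_form mulrC h1 subrr.
Qed.

Hypothesis r_gt0 : (0 < r)%N.
Hypothesis open_connected : connected hyp_open.

(** Independent gradients allow their values on a direction to be prescribed; the value 1 on all the
    active ones makes the direction point strictly inward. *)
Lemma hyp_active_direction p : hyp_closed p ->
  exists v : 'rV[R]_n, forall j, hyp_form j p = 0 -> (v *m hyp_grad j p) 0 0 = 1.
Proof.
move=> cp; pose L := [set j : 'I_r | hyp_form j p == 0]%SET.
have SL i : hyp_surface (@enum_val _ (mem L) i) p.
  by apply: closed_surface => //; have := enum_valP i; rewrite inE => /eqP.
have /eqP rk := hyp_rows_rank (@enum_val_inj _ (mem L)) SL.
have /row_fullP [K HK] : row_full (\matrix_(k, i) hyp_slope (@enum_val _ (mem L) i) (p + p) k 0) by [].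
exists (const_mx 1 *m K) => j fj.
have jL : j \in L by rewrite inE fj.
have -> : hyp_grad j p = col (enum_rank_in jL j) (\matrix_(k, i) hyp_slope (@enum_val _ (mem L) i) (p + p) k 0).
  by apply/matrixP => k i; rewrite ord1 -hyp_slope_grad [RHS]mxE [RHS]mxE enum_rankK_in.
rewrite colE -mulmxA [K *m _]mulmxA HK mul1mx mxE (bigD1 (enum_rank_in jL j)) //= big1 ?addr0.
  by rewrite !mxE !eqxx mulr1.
by move=> i ij; rewrite !mxE (negbTE ij) mulr0.
Qed.

(** Along the inward direction [v] an active form grows like [e + k e^2] and an inactive one stays
    positive, so every point of the closed set is a limit of points of the open one. *)
Lemma hyp_closure : closure hyp_open = hyp_closed.
Proof.
apply/seteqP; split=> [p|p cp].
  have -> : hyp_closed = \bigcap_(j in [set: 'I_r]) [set x | 0 <= hyp_form j x].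
    by apply/seteqP; split=> x H j; [move=> _|]; exact: H.
  rewrite [X in _ -> X p](_ : _ = closure (\bigcap_(j in [set: 'I_r]) [set x | 0 <= hyp_form j x])).
    by apply: closureS => x H j _; apply/ltW.
  apply/closure_id; apply: closed_bigI => j _.
  apply: (@preimage_closed _ _ (hyp_form j) [set z | 0 <= z]); last exact: closed_ge.
  by move=> x _; exact: hyp_form_continuous.
have [v Hv] := hyp_active_direction cp => B nB.
have cv : continuous (fun e : R => p + e *: v).
  move=> e; apply: (@continuousD R 'rV[R]_n R (cst p) (fun e => e *: v) e); first exact: cst_continuous.
  by apply: continuousZr_tmp; exact: cvg_id.
have p0 : p + (0 : R) *: v = p by rewrite scale0r addr0.
suff /filter_ex [e [He Be]] : \forall e \near (0 : R)^'+, hyp_open (p + e *: v) /\ B (p + e *: v).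
  by exists (p + e *: v).
apply: filterI; last first.
  by apply: cvg_within; apply: cv; rewrite p0.
suff H j : \forall e \near (0 : R)^'+, 0 < hyp_form j (p + e *: v) by exact: filter_forall H.
have [fj|fj] := eqVneq (hyp_form j p) 0.
  pose k := v 0 ord0 * (v *m xi j) 0 0.
  near=> e; rewrite hyp_form_segment fj Hv // add0r mulr1 -/k.
  have e0 : 0 < e by near: e; exact: nbhs_right_gt.
  have k0 : 0 < 1 + `|k| by rewrite ltr_pwDl.
  have ek : e < (1 + `|k|)^-1 by near: e; apply: nbhs_right_lt; rewrite invr_gt0.
  have : e * (1 + `|k|) < 1 by rewrite -ltr_pdivlMr // mul1r.
  have := ler_norm (- k); rewrite normrN => nk ek1.
  have : 0 < e * (1 + e * k) by rewrite mulr_gt0 //; nra.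
  by rewrite mulrDr mulr1 mulrA -expr2.
apply: cvg_within.
apply: (@open_nbhs_nbhs _ (0 : R) [set e : R | 0 < hyp_form j (p + e *: v)]).
split.
  apply: (@open_comp _ _ (fun e : R => hyp_form j (p + e *: v)) [set z | 0 < z]); last exact: open_gt.
  move=> e _; apply: (@continuous_comp _ _ _ (fun e : R => p + e *: v) (hyp_form j)); first exact: cv.
  exact: hyp_form_continuous.
by rewrite /= p0 lt_def fj cp.
Unshelve. all: by end_near. Qed.

Lemma hyp_NC_set : NC_set hyp_poly hyp_surface hyp_open.
Proof.
have open_E : hyp_open = [set x | forall j, 0 < peval (hyp_poly j) x].
  by apply/seteqP; split=> x H j; have := H j; rewrite peval_hyp_poly.
have closed_E : hyp_closed = [set x | forall j, 0 <= peval (hyp_poly j) x].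
  by apply/seteqP; split=> x H j; have := H j; rewrite peval_hyp_poly.
split => //.
- apply: (@open_forall _ _ (fun j => [set x | 0 < hyp_form j x])) => j.
  apply: (@open_comp _ _ (hyp_form j) [set z | 0 < z]); last exact: open_gt.
  by move=> x _; exact: hyp_form_continuous.
- by rewrite hyp_closure.
- by move=> j; have [] := hyp_surface_nonsingular (hyp_surface_neq0 j).
- move=> j; apply/seteqP; split=> // x; rewrite hyp_closure => -[[Zx nSx] cx]; apply: nSx.
  by apply: closed_surface => //; rewrite -peval_hyp_poly; exact: (Zx ord0).
- move=> L L0 I; have [->|/set0P I0] := eqVneq I set0; [by left|right].
  have IE : I = [set x | forall i, hyp_surface (@enum_val _ (mem L) i) x].
    apply/seteqP; split=> x H; first by move=> i; apply: H; exact: enum_valP.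
    by move=> j jL; have := H (enum_rank_in jL j); rewrite enum_rankK_in.
  rewrite IE in I0 *.
  have [Ln ns tg] := strata_nonsingular (@enum_val_inj _ (mem L)) I0.
  split => //; first by exists #|L|, (fun i => hyp_poly (@enum_val _ (mem L) i)).
  move=> p Ip; rewrite tg //; apply/seteqP; split=> v /= H.
    move=> j jL; have Sj : hyp_surface j p.
      by have := Ip (enum_rank_in jL j); rewrite enum_rankK_in.
    have [_ ->] := hyp_surface_nonsingular (hyp_surface_neq0 j) => //=.
    by have := H (enum_rank_in jL j); rewrite enum_rankK_in.
  move=> i; have [_ tgj] := hyp_surface_nonsingular (hyp_surface_neq0 (@enum_val _ (mem L) i)).
  by have := H _ (enum_valP i); rewrite tgj.
Qed.

Definition hyp_facet j := hyp_surface j `&` hyp_closed.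

(** The forms other than [j] that vanish at [x] are the corner coordinates there. The neighbourhood
    is restricted to the branch of [j] and to the points where the inactive forms remain
    positive. *)
Lemma hyp_facet_corners j : submanifold_corners (n - 1) (hyp_facet j).
Proof.
apply: submanifold_corners_regular => // x [Sx cx].
pose L := [set i : 'I_r | (hyp_form i x == 0) && (i != j)]%SET.
pose e := @enum_val _ (mem L).
have eP i : hyp_form (e i) x = 0 /\ e i != j.
  by have := enum_valP i; rewrite inE => /andP [/eqP].
pose J (i : 'I_(1 + #|L|)) := match fintype.split i with inl _ => j | inr k => e k end.
have injJ : injective J.
  move=> i1 i2; rewrite /J; case: (splitP i1) => k1 E1; case: (splitP i2) => k2 E2.
  - by move=> _; apply: val_inj; rewrite /= E1 E2 !ord1.
  - by move=> E; case: (eP k2) => _; rewrite -E eqxx.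
  - by move=> E; case: (eP k1) => _; rewrite E eqxx.
  - by move=> /enum_val_inj k12; apply: val_inj; rewrite /= E1 E2 k12.
have SJ i : hyp_surface (J i) x.
  rewrite /J; case: fintype.split => // k; apply: closed_surface => //; exact: (eP k).1.
exists #|L|, [set y : 'rV[R]_n | 0 < sg j * (y 0 ord0 - b j) /\
    forall i, i \notin L -> i != j -> 0 < hyp_form i y],
  (fun y => \row_(i < 1) hyp_form j y), (fun v => \matrix_(k < n, i < 1) hyp_slope j v k 0),
  (fun y => \row_i hyp_form (e i) y), (fun v => \matrix_(k, i) hyp_slope (e i) v k 0).
split.
- split.
  + apply: openI; first exact: side_open.
    apply: (@open_forall _ _ (fun i => [set y : 'rV[R]_n | i \notin L -> i != j -> 0 < hyp_form i y])) => i.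
    have [iL|iL] := boolP (i \in L).
      by rewrite (_ : mkset _ = setT); [exact: openT|apply/seteqP; split].
    have [ij|ij] := eqVneq i j.
      by rewrite (_ : mkset _ = setT); [exact: openT|apply/seteqP; split].
    rewrite (_ : mkset _ = [set y | 0 < hyp_form i y]); last first.
      by apply/seteqP; split=> y /= H; [exact: H|move=> _ _].
    apply: (@open_comp _ _ (hyp_form i) [set z | 0 < z]); last exact: open_gt.
    by move=> y _; exact: hyp_form_continuous.
  + split; first by case: Sx.
    by move=> i; rewrite inE => + ij; rewrite ij andbT lt_def => ->; rewrite cx.
  + by apply: squadratic_rows => i; exact: hyp_form_squadratic.
  + by apply: squadratic_rows => i; exact: hyp_form_squadratic.
- apply: etrans (hyp_rows_rank injJ SJ); congr (\rank _); apply/matrixP => k i.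
  by rewrite [RHS]mxE [LHS]mxE /J; case: fintype.split => ?; rewrite [LHS]mxE.
- move=> y [sy Uy]; split.
    move=> [[fy _] cy]; split; first by apply/rowP => i; rewrite !mxE.
    by move=> i; rewrite mxE; exact: cy.
  move=> [/rowP /(_ 0)]; rewrite !mxE => fy Hy; split; first by [].
  move=> i; have [->|ij] := eqVneq i j; first by rewrite fy.
  have [iL|iL] := boolP (i \in L); last exact/ltW/Uy.
  by have := Hy (enum_rank_in iL i); rewrite mxE /e enum_rankK_in.
Qed.

Lemma hyp_boundary : closure hyp_open `\` hyp_open = \bigcup_j hyp_facet j.
Proof.
rewrite hyp_closure; apply/seteqP; split=> x.
  move=> [cx nx]; have [j fj] : exists j, hyp_form j x = 0.
    apply: contrapT => H; apply: nx => j; rewrite lt_def cx andbT.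
    by apply/eqP => fj; apply: H; exists j.
  by exists j => //; split => //; exact: closed_surface.
move=> [j _ [[fj _] cx]]; split => // ox.
by have := ox j; rewrite fj ltxx.
Qed.
End HyperbolicData.

(** * The manifold lying over a domain *)

Section Blocks.
Context {R : realType}.
Variables (r : nat) (ks : 'I_r -> nat).
Let N := (\sum_(i < r) (ks i).+1)%N.

Definition block (y : 'rV[R]_N) j : 'rV[R]_(ks j).+1 := submxrow (q_ := fun i => (ks i).+1) y j.

Definition block_proj j : 'M[R]_(N, (ks j).+1) := submxrow (q_ := fun i => (ks i).+1) 1%:M j.

Definition glue (w : forall j, 'rV[R]_(ks j).+1) : 'rV[R]_N := \mxrow_j w j.

Lemma blockE y j : block y j = y *m block_proj j.
Proof. by rewrite mul_submxrow mulmx1. Qed.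

Lemma block_glue w j : block (glue w) j = w j.
Proof. exact: mxrowK. Qed.

Lemma block_inj y y' : (forall j, block y j = block y' j) -> y = y'.
Proof. by move=> H; apply/mxrowP. Qed.

Lemma block_projK j : (block_proj j)^T *m block_proj j = 1%:M.
Proof.
rewrite mul_submxrow mulmx1 tr_submxrow trmx1; apply/matrixP => a b.
by rewrite !mxE -val_eqE tagnat.eq_Rank eqxx.
Qed.

Lemma block_proj_ortho i j : i != j -> (block_proj i)^T *m block_proj j = 0.
Proof.
move=> ij; rewrite mul_submxrow mulmx1 tr_submxrow trmx1; apply/matrixP => a b.
by rewrite !mxE -val_eqE tagnat.eq_Rank (negbTE ij).
Qed.

Lemma glue_continuous (T : topologicalType) (w : T -> forall j, 'rV[R]_(ks j).+1) x :
  (forall j, {for x, continuous (w ^~ j)}) -> {for x, continuous (fun t => glue (w t))}.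
Proof.
move=> H; apply: rV_continuous_at => i k.
rewrite (_ : (fun t => glue (w t) i k) = fun t => w t (tagnat.sig1 k) 0 (tagnat.sig2 k)).
  exact: coord_continuous_at.
by apply/funext => t; rewrite mxE ord1.
Qed.

Definition block_sqr (y : 'rV[R]_N) j : R := \sum_i block y j 0 i ^+ 2.

Lemma block_sqr_form y j : block_sqr y j = (block y j *m (block y j)^T) 0 0.
Proof. by rewrite [RHS]mxE; apply: eq_bigr => i _; rewrite [(_^T) _ _]mxE expr2. Qed.

Lemma block_coord (y : 'rV[R]_N) q : y 0 q = block y (tagnat.sig1 q) 0 (tagnat.sig2 q).
Proof. by rewrite mxE tagnat.sig2K. Qed.
End Blocks.
Arguments block_proj {R r} ks j.

Lemma row_mx_continuous_at (R : realType) (T : topologicalType) a b (u : T -> 'rV[R]_a) (v : T -> 'rV[R]_b) x :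
  {for x, continuous u} -> {for x, continuous v} -> {for x, continuous (fun t => row_mx (u t) (v t))}.
Proof.
move=> cu cv; apply: rV_continuous_at => i l; rewrite -(splitK l); case: (fintype.split l) => a' /=.
  rewrite (_ : (fun t => _) = fun t => u t i a'); first exact: coord_continuous_at.
  by apply/funext => t; rewrite row_mxEl.
rewrite (_ : (fun t => _) = fun t => v t i a'); first exact: coord_continuous_at.
by apply/funext => t; rewrite row_mxEr.
Qed.

(** A circular arc in the plane of the first axis and a unit vector [q] orthogonal to it. If [y]
    lies on that axis, [q] is an arbitrary basis vector, which exists because [d] is positive; on a
    pair of points there would be no path. *)
Lemma sphere_path (R : realType) d (y : 'rV[R]_d.+1) : (0 < d)%N ->
  exists gam : R -> 'rV[R]_d.+1,
    [/\ continuous gam, gam 0 = enorm y *: delta_mx 0 0, gam 1 = y &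
        forall s, \sum_i gam s 0 i ^+ 2 = \sum_i y 0 i ^+ 2].
Proof.
move=> d0; pose e0 : 'rV[R]_d.+1 := delta_mx 0 0.
pose y' := y - y 0 0 *: e0; pose rho := enorm y.
have sy : \sum_i y 0 i ^+ 2 = rho ^+ 2 by rewrite sqr_enorm.
have y'0 : y' 0 0 = 0 by rewrite !mxE !eqxx mulr1 subrr.
have decomp (v : 'rV[R]_d.+1) (a b : R) : v 0 0 = 0 ->
    \sum_i (a *: e0 + b *: v) 0 i ^+ 2 = a ^+ 2 + b ^+ 2 * \sum_i v 0 i ^+ 2.
  move=> v0; rewrite !big_ord_recl !mxE v0 !eqxx mulr1 mulr0 addr0 expr0n add0r.
  congr (_ + _); rewrite mulr_sumr; apply: eq_bigr => i _; rewrite !mxE /= mulr0 add0r.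
  by rewrite exprMn.
have [q q0 [q1 yq]] : exists2 q : 'rV[R]_d.+1, q 0 0 = 0 &
    \sum_i q 0 i ^+ 2 = 1 /\ y' = enorm y' *: q.
  have [y'z|y'n] := eqVneq y' 0.
    pose k : 'I_d.+1 := inord 1; have k1 : k = 1%N :> nat by rewrite inordK.
    have k0 : k != 0 by apply/eqP => /(congr1 val); rewrite /= k1.
    exists (delta_mx 0 k); first by rewrite mxE eq_sym (negbTE k0) andbF.
    rewrite y'z enorm0 scale0r; split => //.
    rewrite (bigD1 k) //= big1 ?mxE ?eqxx ?expr1n ?addr0 // => i ik.
    by rewrite mxE (negbTE ik) andbF expr0n.
  have p0 := enorm_gt0 y'n.
  exists ((enorm y')^-1 *: y'); first by rewrite mxE y'0 mulr0.
  split; last by rewrite scalerA divff ?scale1r // gt_eqF.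
  by rewrite -sqr_enorm enormZ ger0_norm ?invr_ge0 ?(ltW p0) // mulVf ?expr1n ?gt_eqF.
have ydec : y = y 0 0 *: e0 + enorm y' *: q by rewrite -yq addrC subrK.
have rho2 : rho ^+ 2 = y 0 0 ^+ 2 + enorm y' ^+ 2.
  by rewrite -sy [in LHS]ydec decomp // q1 mulr1.
have rho_ge0 : 0 <= rho := enorm_ge0 y.
have [th [cth sth]] : exists th, rho * cos th = y 0 0 /\ rho * sin th = enorm y'.
  have [rz|rn] := eqVneq rho 0.
    have : y 0 0 ^+ 2 + enorm y' ^+ 2 = 0 by rewrite -rho2 rz expr0n.
    move/eqP; rewrite paddr_eq0 ?sqr_ge0 // !sqrf_eq0 => /andP [/eqP -> /eqP ->].
    by exists 0; rewrite rz !mul0r.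
  have rp : 0 < rho by rewrite lt_def rn.
  have c1 : (y 0 0 / rho) ^+ 2 <= 1.
    rewrite expr_div_n ler_pdivrMr ?exprn_gt0 // mul1r rho2 lerDl; exact: sqr_ge0.
  have c2 : -1 <= y 0 0 / rho <= 1 by rewrite -ler_norml -(@expr_le1 _ 2) // real_normK ?num_real.
  exists (acos (y 0 0 / rho)); rewrite acosK ?in_itv //= mulrC divfK // sin_acos //; split => //.
  rewrite -[X in X * _](ger0_norm rho_ge0) -sqrtr_sqr -sqrtrM ?sqr_ge0 //.
  rewrite mulrBr mulr1 expr_div_n mulrC divfK ?expf_neq0 // rho2 addrAC subrr add0r.
  by rewrite sqrtr_sqr ger0_norm // enorm_ge0.
exists (fun s => (rho * cos (s * th)) *: e0 + (rho * sin (s * th)) *: q); split.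
- move=> s; have cM : {for s, continuous (fun s : R => s * th)}.
    by apply: (@continuousM _ _ id (cst th)); [exact: cvg_id|exact: cst_continuous].
  have aux (f : R -> R) (v : 'rV[R]_d.+1) : continuous f ->
      {for s, continuous (fun s : R => (rho * f (s * th)) *: v)}.
    move=> cf; apply: (@continuousZr_tmp _ _ _ (fun s : R => rho * f (s * th)) v s).
    apply: (@continuousM _ _ (cst rho) (fun s : R => f (s * th)) s); first exact: cst_continuous.
    by apply: (@continuous_comp _ _ _ (fun s : R => s * th) f) => //; exact: cf.
  apply: (@continuousD R 'rV[R]_d.+1 R (fun s : R => (rho * cos (s * th)) *: e0)
    (fun s : R => (rho * sin (s * th)) *: q) s); apply: aux; [exact: continuous_cos|exact: continuous_sin].
- by rewrite mul0r cos0 sin0 mulr0 mulr1 scale0r addr0.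
- by rewrite mul1r cth sth -ydec.
- by move=> s; rewrite decomp // q1 sy; have := cos2Dsin2 (s * th); nra.
Qed.

Section Squadratic.
Context {R : realType}.

Lemma squadratic_comp a k (f : 'rV[R]_k -> R) A (D : 'M[R]_(a, k)) : squadratic f A ->
  squadratic (fun z => f (z *m D)) (fun v => D *m A (v *m D)).
Proof.
move=> [f1 f2]; split=> [x x'|v w t]; first by rewrite f1 mulmxA -mulmxDl -mulmxBl.
by rewrite -!mulmxBr mulmxDl -scalemxAl mul0mx f2 mulmxDr -scalemxAr.
Qed.

Lemma squadratic_norm a k (C : 'M[R]_(a, k)) :
  squadratic (fun z : 'rV[R]_a => (z *m C *m (z *m C)^T) 0 0) (fun v => C *m (v *m C)^T).
Proof.
split=> [x x'|v w t].
  rewrite mulmxA mulmxBl [(x + x') *m C]mulmxDl.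
  move: (x *m C) (x' *m C) => p p'.
  have sym : (p *m p'^T) 0 0 = (p' *m p^T) 0 0 by rewrite -[p *m p'^T]trmxK trmx_mul trmxK [LHS]mxE.
  by rewrite linearD /= mulmxDr !mulmxBl mx11D !mx11B sym; ring.
rewrite mul0mx trmx0 mulmx0 !subr0 mulmxDl -scalemxAl linearD linearZ /=.
by rewrite mulmxDr scalemxAr.
Qed.
End Squadratic.

Section HomeoCW.
Context {R : realType}.

Lemma within_continuous_comp (X Y Z : topologicalType) (A : set X) (B : set Y) (f : X -> Y) (g : Y -> Z) :
  {within A, continuous f} -> {within B, continuous g} -> (forall x, A x -> B (f x)) ->
  {within A, continuous (g \o f)}.
Proof.
move=> /subspace_continuousP cf /subspace_continuousP cg AB; apply/subspace_continuousP => x Ax U nU.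
have := cf x Ax _ (cg _ (AB _ Ax) U nU); rewrite /= /nbhs /= /within /= => H.
by apply: filterS H => t H At; apply: H => //; exact: AB.
Qed.

Lemma homeo_CW (X Y : topologicalType) (A : set X) (B : set Y) (h : X -> Y) (g : Y -> X) e :
  continuous h -> continuous g ->
  (forall x, A x -> B (h x) /\ g (h x) = x) -> (forall y, B y -> A (g y) /\ h (g y) = y) ->
  homeomorphic_to_CW_dim_le R B e -> homeomorphic_to_CW_dim_le R A e.
Proof.
move=> ch cg AB BA [T [cell [chi [cw de [h' [g' [ch' cg' H1 H2]]]]]]].
exists T, cell, chi; split => //; exists (h' \o h), (g \o g'); split.
- apply: within_continuous_comp ch' _; first exact: continuous_subspaceT.
  by move=> x /AB [].
- apply: (within_continuous_comp (B := setT) cg') => //; exact: continuous_subspaceT.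
- by move=> x Ax /=; have [Bx gx] := AB _ Ax; have [_ ->] := H1 _ Bx.
- by move=> y _ /=; have [By hy] := H2 y I; have [Ax ->] := BA _ By.
Qed.
End HomeoCW.

(** * Radial change from the squared Euclidean norm to the supremum norm *)

Section SupNorm.
Context {R : realType}.
Implicit Types d : nat.

Lemma norm_coordP d (w : 'rV[R]_d.+1) v :
  `|w| = v <-> (forall i, `|w 0 i| <= v) /\ exists i, `|w 0 i| = v.
Proof.
split=> [<-|[wv [i wi]]].
  split=> [i|]; first exact: coord_le_norm.
  have [->|w0] := eqVneq w 0; first by exists 0; rewrite mxE !normr0.
  have [i] : exists i, mx_norm w = `|w i.1 i.2|.
    by apply: mx_norm_neq0; apply: contra_neq w0; exact: mx_norm_eq0.
  by rewrite [i.1]ord1 => H; exists i.2.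
apply/le_anti/andP; split; last by rewrite -wi coord_le_norm.
apply: norm_le_coord => [|a b]; first by rewrite -wi.
by rewrite [a]ord1.
Qed.

(** A radial rescaling whose result has supremum norm equal to the squared Euclidean norm of [w];
    [of_sup] undoes it. At [w = 0] the division by zero is harmless, the vector being 0. *)
Definition to_sup d (w : 'rV[R]_d) : 'rV[R]_d := (enorm w ^+ 2 / `|w|) *: w.
Definition of_sup d (w : 'rV[R]_d) : 'rV[R]_d := (Num.sqrt `|w| / enorm w) *: w.

Lemma to_sup_continuous d : continuous (@to_sup d).
Proof.
apply: (@radial_continuous _ _ _ _ 1) => //.
- rewrite (_ : (fun w => enorm w ^+ 2) = fun w : 'rV[R]_d => \sum_(i < d) w 0 i ^+ 2).
    exact: sum_sqr_continuous.
  by apply/funext => w; rewrite sqr_enorm.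
- by move=> w; exact: norm_continuous.
- by rewrite enorm0 expr0n.
- by move=> v; rewrite mul1r.
Qed.

Lemma of_sup_continuous d : continuous (@of_sup d).
Proof.
apply: (@radial_continuous _ _ _ _ 1) => //.
- move=> w; apply: (@continuous_comp _ _ _ (fun w : 'rV[R]_d => `|w|) Num.sqrt); first exact: norm_continuous.
  exact: sqrt_continuous.
- exact: enorm_continuous.
- by rewrite normr0 sqrtr0.
- by move=> v; rewrite mul1r norm_le_enorm.
Qed.

Lemma to_supK d (w : 'rV[R]_d) : `|to_sup w| = enorm w ^+ 2 /\ of_sup (to_sup w) = w.
Proof.
have [->|w0] := eqVneq w 0; first by rewrite /to_sup /of_sup !scaler0 enorm0 normr0 expr0n.
have e0 := enorm_gt0 w0; have s0 : 0 < `|w| by rewrite normr_gt0.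
have c0 : 0 <= enorm w ^+ 2 / `|w| by rewrite divr_ge0 ?exprn_ge0 // ltW.
have nE : `|to_sup w| = enorm w ^+ 2.
  by rewrite /to_sup normrZ ger0_norm // divfK // gt_eqF.
split=> //; rewrite /of_sup nE sqrtr_sqr ger0_norm ?ltW // /to_sup enormZ ger0_norm // scalerA.
move: (enorm w) (`|w|) e0 s0 => a b a0 b0; rewrite (_ : _ * _ = 1) ?scale1r //.
by field; rewrite !gt_eqF.
Qed.

Lemma of_supK d (w : 'rV[R]_d) : enorm (of_sup w) ^+ 2 = `|w| /\ to_sup (of_sup w) = w.
Proof.
have [->|w0] := eqVneq w 0; first by rewrite /to_sup /of_sup !scaler0 enorm0 normr0 expr0n.
have e0 := enorm_gt0 w0; have s0 : 0 < `|w| by rewrite normr_gt0.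
have q0 : 0 < Num.sqrt `|w| by rewrite sqrtr_gt0.
have c0 : 0 <= Num.sqrt `|w| / enorm w by rewrite divr_ge0 // ltW.
have eE : enorm (of_sup w) = Num.sqrt `|w|.
  by rewrite /of_sup enormZ ger0_norm // divfK // gt_eqF.
rewrite eE sqr_sqrtr ?normr_ge0 //; split=> //.
rewrite /to_sup eE sqr_sqrtr ?normr_ge0 // /of_sup normrZ ger0_norm // scalerA.
have key (a q b : R) : 0 < a -> 0 < q -> q ^+ 2 = b -> b / (q / a * b) * (q / a) = 1.
  by move=> a0 q1 <-; field; rewrite !gt_eqF.
rewrite (_ : _ * _ = 1) ?scale1r //; apply: key => //; exact: sqr_sqrtr (ltW s0).
Qed.
End SupNorm.

(* [lifted] is the set of the (x, y) with |y_j|^2 = f_j(x) for all j, where y is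
   cut into blocks y_j of sizes [ks j + 1]. *)
Section Lifting.
Context {R : realType}.
Variables (n r : nat) (ks : 'I_r -> nat).
Let N := (\sum_(i < r) (ks i).+1)%N.
Let k := (n + N)%N.
Variables (f : 'I_r -> 'rV[R]_n -> R) (sl : 'I_r -> 'rV[R]_n -> 'cV[R]_n).

Definition base_proj : 'M[R]_(k, n) := col_mx 1%:M 0.
Definition fib_proj j : 'M[R]_(k, (ks j).+1) := col_mx 0 (block_proj ks j).
Let D := base_proj.
Let C := fib_proj.

Lemma base_projE (z : 'rV[R]_k) : z *m D = lsubmx z.
Proof. by rewrite -[in LHS](hsubmxK z) mul_row_col mulmx1 mulmx0 addr0. Qed.

Lemma fib_projE (z : 'rV[R]_k) j : z *m C j = block (rsubmx z) j.
Proof. by rewrite -[in LHS](hsubmxK z) mul_row_col mulmx0 add0r -blockE. Qed.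

Lemma base_projK : D^T *m D = 1%:M.
Proof. by rewrite /D /base_proj tr_col_mx mul_row_col trmx0 trmx1 mulmx1 mulmx0 addr0. Qed.

Lemma base_fib j : D^T *m C j = 0.
Proof. by rewrite /D /base_proj tr_col_mx mul_row_col trmx0 mulmx0 mul0mx addr0. Qed.

Lemma fib_base j : (C j)^T *m D = 0.
Proof. by rewrite -[LHS]trmxK trmx_mul trmxK base_fib trmx0. Qed.

Lemma fib_projK j : (C j)^T *m C j = 1%:M.
Proof. by rewrite tr_col_mx mul_row_col mulmx0 add0r block_projK. Qed.

Lemma fib_ortho i j : i != j -> (C i)^T *m C j = 0.
Proof. by move=> ij; rewrite tr_col_mx mul_row_col mulmx0 add0r block_proj_ortho. Qed.

Definition lifted : set 'rV[R]_k := [set z | forall j, block_sqr (rsubmx z) j = f j (lsubmx z)].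

Definition lift_form j (z : 'rV[R]_k) := block_sqr (rsubmx z) j - f j (lsubmx z).

Definition lift_slope j (v : 'rV[R]_k) : 'cV[R]_k := C j *m (v *m C j)^T - D *m sl j (v *m D).

Let E := [set x | forall j, 0 <= f j x].
Let gr j x := sl j (x + x).
Let act x (mu : 'I_r -> R) := forall j, f j x != 0 -> mu j = 0.

Hypothesis fq : forall j, squadratic (f j) (sl j).
Hypothesis indep : forall x mu, E x -> act x mu -> \sum_j mu j *: gr j x = 0 -> forall j, mu j = 0.

Let f_continuous j : continuous (f j).
Proof. exact: squadratic_continuous (fq j). Qed.

Lemma lifted_base z : lifted z -> E (lsubmx z).
Proof. by move=> Mz j; rewrite -Mz; apply: sumr_ge0 => i _; exact: sqr_ge0. Qed.

Lemma block_sqr_eq0 (y : 'rV[R]_N) j : block_sqr y j = 0 -> block y j = 0.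
Proof.
rewrite /block_sqr -sqr_enorm => /eqP; rewrite sqrf_eq0 => /eqP H.
by apply/eqP; apply: contraT => /enorm_gt0; rewrite H ltxx.
Qed.

Lemma lift_squadratic j : squadratic (lift_form j) (lift_slope j).
Proof.
rewrite (_ : lift_form j = fun z => (z *m C j *m (z *m C j)^T) 0 0 - f j (z *m D)); last first.
  by apply/funext => z; rewrite /lift_form block_sqr_form fib_projE base_projE.
exact: squadratic_diff (squadratic_norm _) (squadratic_comp _ (fq j)).
Qed.

Definition lift_jac (v : 'rV[R]_k) : 'M[R]_(k, r) := \matrix_(a, j) lift_slope j v a 0.

Let lift_jac_mul (z : 'rV[R]_k) (mu : 'cV[R]_r) :
  lift_jac (z + z) *m mu = \sum_j mu j 0 *: (2 *: (C j *m (block (rsubmx z) j)^T) - D *m gr j (lsubmx z)).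
Proof.
rewrite mulmx_cols; apply: eq_bigr => j _; congr (_ *: _).
apply/matrixP => a b; rewrite ord1 [LHS]mxE [LHS]mxE /lift_slope !mulmxDl fib_projE base_projE.
by rewrite linearD /= mulmxDr scaler_nat mulr2n.
Qed.

(** Multiplication by the transpose of [C i] isolates [2 mu_i y_i], so [mu_i] vanishes wherever
    [y_i], equivalently [f_i], does not. Multiplication by the transpose of [D] leaves the relation
    between gradients on the base. [Q] holds the linear functions of x under study. *)
Lemma lift_kernel e (Q : 'M[R]_(n, e)) z (mu : 'cV[R]_r) (nu : 'cV[R]_e) : lifted z ->
  lift_jac (z + z) *m mu + (D *m Q) *m nu = 0 <->
  act (lsubmx z) (mu ^~ 0) /\ Q *m nu = \sum_j mu j 0 *: gr j (lsubmx z).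
Proof.
move=> Mz; rewrite lift_jac_mul.
set x := lsubmx z; set y := fun j => (block (rsubmx z) j)^T.
have -> : \sum_j mu j 0 *: (2 *: (C j *m y j) - D *m gr j x) + D *m Q *m nu =
    \sum_j (mu j 0 * 2) *: (C j *m y j) + D *m (Q *m nu - \sum_j mu j 0 *: gr j x).
  rewrite mulmxBr mulmxA addrA addrAC; congr (_ + _); rewrite mulmx_sumr -sumrB.
  by apply: eq_bigr => j _; rewrite scalerBr scalerA -scalemxAr.
split=> [H|[amu ->]].
  have HD : Q *m nu = \sum_j mu j 0 *: gr j x.
    have KD (S : 'cV[R]_k) (X : 'cV[R]_n) : D^T *m (S + D *m X) = D^T *m S + X.
    by rewrite mulmxDr [D^T *m (D *m X)]mulmxA base_projK mul1mx.
  move: (congr1 (mulmx D^T) H); rewrite mulmx0 KD mulmx_sumr.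
    rewrite big1 ?add0r => [/eqP|j _]; first by rewrite subr_eq0 => /eqP.
    by rewrite -scalemxAr mulmxA base_fib mul0mx scaler0.
  split=> // i fi; move: (congr1 (mulmx (C i)^T) H).
  rewrite HD subrr !mulmx0 addr0 mulmx_sumr (bigD1 i) //= big1 ?addr0 => [|j ji].
    rewrite -scalemxAr mulmxA fib_projK mul1mx => /eqP; rewrite scaler_eq0 mulf_eq0 pnatr_eq0 orbF.
    move=> /orP [/eqP //|/eqP yi0]; case/eqP: fi; rewrite -Mz block_sqr_form -/(y i) yi0 mulmx0.
    by rewrite mxE.
  by rewrite -scalemxAr mulmxA fib_ortho ?mul0mx ?scaler0 // eq_sym.
rewrite subrr mulmx0 addr0 big1 // => j _; have [fj|fj] := eqVneq (f j x) 0.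
  by rewrite /y block_sqr_eq0 ?trmx0 ?mulmx0 ?scaler0 // Mz.
by rewrite amu // mul0r scale0r.
Qed.

Let independent_of x e (Q : 'M[R]_(n, e)) := forall mu (nu : 'cV[R]_e), act x mu ->
  Q *m nu = \sum_j mu j *: gr j x -> nu = 0.

Lemma lift_rank e (Q : 'M[R]_(n, e)) z : lifted z -> independent_of (lsubmx z) Q ->
  \rank (row_mx (lift_jac (z + z)) (D *m Q)) = (r + e)%N.
Proof.
move=> Mz IQ; apply: rank_columns => mu; rewrite -[mu]vsubmxK mul_row_col.
move=> /(lift_kernel _ _ _ Mz) [amu HQ]; have nu0 := IQ _ _ amu HQ.
rewrite nu0 mulmx0 in HQ; have mu0 := indep (lifted_base Mz) amu (esym HQ).
by rewrite nu0 (_ : usubmx mu = 0) ?col_mx0 //; apply/colP => j; rewrite mu0 mxE.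
Qed.

Let lift_formE z : (\row_j lift_form j z = 0) <-> lifted z.
Proof.
split=> [/rowP H j|Mz]; last by apply/rowP => j; rewrite !mxE /lift_form Mz subrr.
by have := H j; rewrite !mxE => /eqP; rewrite subr_eq0 => /eqP.
Qed.

Let lift_quadratic : quadratic (fun z => \row_j lift_form j z) lift_jac.
Proof. by apply: squadratic_rows => j; exact: lift_squadratic. Qed.

(** One statement for three uses: [Q] has no column for the lifted set itself, one column for the
    levels of x_0, and is the identity for the fibres over points of the base. *)
Lemma lifted_submanifold e (Q : 'M[R]_(n, e)) tau d : k = ((r + e) + d)%N ->
  (forall x, E x -> x *m Q = tau -> independent_of x Q) ->
  submanifold d (lifted `&` [set z | lsubmx z *m Q = tau]).
Proof.
move=> kE IQ; apply: (submanifold_regular_zeros kE) => z [Mz Qz].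
exists setT, (fun z => row_mx (\row_j lift_form j z) (- tau + z *m (D *m Q))),
  (fun v => row_mx (lift_jac v) (D *m Q)); split => //.
- exact: openT.
- exact: row_mx_quadratic lift_quadratic (affine_quadratic _ _).
- by apply: lift_rank => //; apply: IQ => //; exact: lifted_base.
- move=> y _; rewrite mulmxA base_projE; split=> [[My Qy]|].
    by rewrite Qy addNr (lift_formE y).2 // row_mx0.
  rewrite -(row_mx0 _ 1 r e) => /eq_row_mx [/lift_formE My /eqP].
  by rewrite addrC subr_eq0 => /eqP.
Qed.

Lemma lifted_rank0 z : lifted z -> \rank (lift_jac (z + z)) = r.
Proof.
move=> Mz; apply: rank_columns => mu H.
have : lift_jac (z + z) *m mu + D *m (0 : 'M[R]_(n, 1)) *m 0 = 0 by rewrite mulmx0 addr0.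
move=> /(lift_kernel _ _ _ Mz) [amu]; rewrite mulmx0 => /esym /(indep (lifted_base Mz) amu) mu0.
by apply/colP => j; rewrite mu0 mxE.
Qed.

Variable m : nat.
Hypothesis km : k = (r + m)%N.

Lemma lifted_manifold : submanifold m lifted.
Proof.
have -> : lifted = lifted `&` [set z | lsubmx z *m (0 : 'M[R]_(n, 0)) = 0].
  by apply/seteqP; split=> [z Mz|z []//]; split => //=; rewrite mulmx0.
apply: lifted_submanifold; first by rewrite addn0.
by move=> x _ _ mu nu _ _; apply/matrixP => -[].
Qed.

(** Lagrange multipliers: tangent vectors are the kernel of [lift_jac], so a combination [Q nu] has
    zero differential along them iff it lies in the column space of [lift_jac]. By [lift_kernel]
    this becomes a relation between active gradients on the base. *)
Lemma lift_singular e (Q : 'M[R]_(n, e)) z (W : set 'rV[R]_m) phi w :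
  local_param lifted z W phi w ->
  (\rank (jacobian ((fun z => z *m (D *m Q)) \o phi) w) < e)%N <->
  exists (mu : 'I_r -> R) (nu : 'cV[R]_e),
    [/\ nu != 0, act (lsubmx z) mu & Q *m nu = \sum_j mu j *: gr j (lsubmx z)].
Proof.
move=> lp; have [dphi _ _ _] := local_param_rank lp.
have Mz : lifted z.
  have [_ Ww phiw [U [_ [psi [_ _ H1 _]]]]] := lp.
  by have [] := H1 w Ww; rewrite phiw => -[].
have [dQ JQ] := quadratic_differential (affine_quadratic 0 (D *m Q)) (phi w).
have [_ JC] := jacobian_comp dphi dQ.
have -> : (fun z : 'rV[R]_k => z *m (D *m Q)) = fun z => 0 + z *m (D *m Q).
  by apply/funext => ?; rewrite add0r.
rewrite JC JQ.
have [dF JF] := quadratic_differential lift_quadratic z.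
have F0 y : lifted y -> setT y -> \row_j lift_form j y = 0 by move=> /lift_formE.
have T := local_param_tangent km lp openT I dF F0.
rewrite JF lifted_rank0 // in T.
have J0 := local_param_jacobian0 lp openT I dF F0; rewrite JF in J0.
set J1 := jacobian phi w in T J0 *.
split=> [rk|[mu [nu [nu0 amu HQ]]]].
  have /existsNP [nu /not_implyP [nuJ nu0]] :
      ~ forall nu : 'cV[R]_e, J1 *m (D *m Q) *m nu = 0 -> nu = 0.
    by move=> /rank_columns H; rewrite H ltnn in rk.
  have [|mu Hmu] := @column_span _ _ _ (lift_jac (z + z)) (D *m Q *m nu).
    by move=> v /(T erefl) [u ->]; rewrite -mulmxA [J1 *m _]mulmxA nuJ mulmx0.
  have : lift_jac (z + z) *m (- mu) + D *m Q *m nu = 0 by rewrite mulmxN Hmu addNr.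
  move=> /(lift_kernel _ _ _ Mz) [amu HQ].
  by exists (fun j => (- mu) j 0), nu; split => //; exact/eqP.
have H : lift_jac (z + z) *m (\col_j mu j) + D *m Q *m nu = 0.
  apply/(lift_kernel _ _ _ Mz); split; first by move=> j /amu; rewrite mxE.
  by rewrite HQ; apply: eq_bigr => j _; rewrite mxE.
have JD : J1 *m (D *m Q) *m nu = 0.
  by move: (congr1 (mulmx J1) H); rewrite mulmxDr mulmxA J0 mul0mx add0r mulmx0 mulmxA.
have := mulmx0_rank_max JD; rewrite -ltnS.
have : (0 < \rank nu)%N by rewrite lt0n mxrank_eq0.
case: (\rank nu) => // b _; rewrite addnS ltnS; apply: leq_ltn_trans; exact: leq_addr.
Qed.

Lemma lifted_polynomials : (forall j, exists P : mpoly k R, forall z, peval P z = f j (lsubmx z)) ->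
  exists g : 'I_r -> mpoly k R, nonsingular_by g m lifted /\ zeros g = lifted.
Proof.
move=> /choice [P HP].
exists (fun j => \sum_i mpolyX R (mnm1 (rshift n (tagnat.Rank j i))) * mpolyX R (mnm1 (rshift n (tagnat.Rank j i))) - P j).
set g := fun j => _.
have gE j z : peval (g j) z = lift_form j z.
  rewrite /lift_form -HP /peval mevalB raddf_sum /=; congr (_ - _); apply: eq_bigr => i _.
  by rewrite mevalM mevalXU expr2 !mxE.
have zE : zeros g = lifted.
  apply/seteqP; split=> z H.
    by apply/lift_formE/rowP => j; rewrite !mxE -gE.
  by move=> j; rewrite gE; move/lift_formE: H => /rowP /(_ j); rewrite !mxE.
split=> //; split => //.
- by rewrite zE; split => // z Mz; exact: connected_component_sub.
- exact: lifted_manifold.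
- by rewrite km leq_addl.
- move=> z Mz; have -> : pmap g = fun z => \row_j lift_form j z.
    by apply/funext => y; apply/rowP => j; rewrite !mxE gE.
  by rewrite (quadratic_differential lift_quadratic z).2 lifted_rank0 // km addnK.
Qed.

(** * Parts of the lifted set over subsets of the base, and its fibres *)

Let lsubmx_continuous : continuous (fun z : 'rV[R]_k => lsubmx z).
Proof.
rewrite (_ : (fun z => lsubmx z) = fun z => z *m D); first exact: mulmxr_continuous.
by apply/funext => z; rewrite base_projE.
Qed.

(** Every [y_j] is placed on the first axis. As [Num.sqrt] is 0 on negative numbers, the section is
    continuous on the whole space. *)
Definition lift_section (x : 'rV[R]_n) : 'rV[R]_k :=
  row_mx x (glue (fun j => Num.sqrt (f j x) *: (delta_mx 0 0 : 'rV[R]_(ks j).+1))).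

Lemma lift_sectionP x : E x -> lifted (lift_section x) /\ lsubmx (lift_section x) = x.
Proof.
move=> Ex; split; last by rewrite row_mxKl.
move=> j; rewrite row_mxKl row_mxKr /block_sqr block_glue -sqr_enorm enormZ.
have -> : enorm (delta_mx 0 0 : 'rV[R]_(ks j).+1) = 1.
  rewrite /enorm big_ord_recl big1 ?addr0 => [|i _]; last by rewrite mxE expr0n.
  by rewrite mxE expr1n sqrtr1.
by rewrite mulr1 ger0_norm ?sqrtr_ge0 // sqr_sqrtr.
Qed.

Lemma lift_section_continuous : continuous lift_section.
Proof.
move=> x; apply: (@row_mx_continuous_at _ _ _ _ id); first exact: cvg_id.
apply: glue_continuous => j; apply: (@continuousZr_tmp _ _ _ (fun x => Num.sqrt (f j x))).
apply: (@continuous_comp _ _ _ (f j) Num.sqrt); first exact: f_continuous.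
exact: sqrt_continuous.
Qed.

Definition lifted_over (X : set 'rV[R]_n) := lifted `&` [set z | X (lsubmx z)].

Lemma lifted_over_image X : X `<=` E -> (fun z => lsubmx z) @` lifted_over X = X.
Proof.
move=> XE; apply/seteqP; split=> [_ [z [_ /= Xz] <-] //|x Xx].
have [Ms sx] := lift_sectionP (XE _ Xx).
by exists (lift_section x) => //; split => //=; rewrite sx.
Qed.

(** Rotating each block to the first axis joins a point, inside its fibre, to the section, whose
    image over [X] is connected. Blocks of sphere dimension 0 could not be rotated, whence
    [0 < ks j]. *)
Lemma lifted_over_connected X : (forall j, (0 < ks j)%N) -> X `<=` E -> connected X ->
  connected (lifted_over X).
Proof.
move=> ks0 XE cX; have [[x1 Xx1]|X0] := pselect (X !=set0); last first.
  rewrite (_ : lifted_over X = set0); first exact: connected0.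
  by apply/seteqP; split=> // z [_ Xz]; apply: X0; exists (lsubmx z).
apply: (connected_star (x0 := lift_section x1)) => z [Mz Xz].
have sX : lift_section @` X `<=` lifted_over X.
  by move=> _ [x Xx <-]; have [Ms sx] := lift_sectionP (XE _ Xx); split => //=; rewrite sx.
have csX : connected (lift_section @` X).
  by apply: connected_continuous_connected cX _; apply: continuous_subspaceT; exact: lift_section_continuous.
have [gam Hgam] : exists gam : forall j, R -> 'rV[R]_(ks j).+1, forall j,
    [/\ continuous (gam j), gam j 0 = enorm (block (rsubmx z) j) *: delta_mx 0 0, gam j 1 = block (rsubmx z) j &
        forall s, \sum_i gam j s 0 i ^+ 2 = block_sqr (rsubmx z) j].
  exists (fun j => sval (cid (sphere_path (block (rsubmx z) j) (ks0 j)))) => j.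
  by case: cid.
have [||K [cK KA K0 K1]] := @path_connected_image _ R (lifted_over X)
    (fun s => row_mx (lsubmx z) (glue (fun j => gam j s))).
- move=> s; apply: (@row_mx_continuous_at _ _ _ _ (cst (lsubmx z)) (fun s => glue (gam^~ s)) s); first exact: cst_continuous.
  by apply: glue_continuous => j; have [cg _ _ _] := Hgam j; exact: cg.
- move=> s _; split; last by rewrite /= row_mxKl.
  by move=> j; rewrite row_mxKl row_mxKr /block_sqr block_glue -Mz; have [_ _ _ H] := Hgam j; exact: H.
exists (lift_section @` X `|` K); split.
- apply: connectedU => //; exists (lift_section (lsubmx z)); split; first by exists (lsubmx z).
  suff -> : lift_section (lsubmx z) = row_mx (lsubmx z) (glue (fun j => gam j 0)) by [].
  rewrite /lift_section; congr row_mx; apply: block_inj => j; rewrite !block_glue.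
  by have [_ -> _ _] := Hgam j; rewrite /enorm -Mz.
- by move=> y [/sX|/KA].
- by left; exists x1.
- right; move: K1; rewrite (_ : glue _ = rsubmx z) ?hsubmxK //.
  by apply: block_inj => j; rewrite block_glue; have [] := Hgam j.
Qed.

Lemma lifted_connected : (forall j, (0 < ks j)%N) -> connected E -> connected lifted.
Proof.
move=> ks0 cE; have := lifted_over_connected ks0 (@subset_refl _ E) cE.
by rewrite (_ : lifted_over E = lifted) //; apply/seteqP; split=> [z []//|z Mz]; split => //; exact: lifted_base.
Qed.

Let compact_norm_bound a (A : set 'rV[R]_a) : compact A -> exists2 c, 0 <= c & forall x, A x -> `|x| <= c.
Proof.
move=> /compact_bounded [c [_ Hc]]; exists (`|c| + 1); first by rewrite addr_ge0.
by apply: Hc; rewrite (le_lt_trans (ler_norm c)) // ltrDl.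
Qed.

Lemma lifted_over_compact X : compact X -> compact (lifted_over X).
Proof.
move=> cX; apply: bounded_closed_compact.
  have [c c0 Hc] := compact_norm_bound cX.
  have [c' c'0 Hc'] : exists2 c', 0 <= c' & forall x, X x -> `|\row_j f j x| <= c'.
    have : compact ((fun x => \row_j f j x) @` X).
      apply: continuous_compact cX; apply: continuous_subspaceT.
      apply: rV_continuous => i j x; rewrite (_ : (fun y => _) = f j); first exact: f_continuous.
      by apply/funext => y; rewrite mxE.
    by move=> /compact_norm_bound [c' c'0 H]; exists c' => // x Xx; apply: H; exists x.
  exists (c + c' + 1); split; first exact: num_real.
  move=> B cB z [Mz /= Xz]; apply: le_trans (ltW cB); apply: norm_le_coord; first by rewrite !addr_ge0.
  move=> i l; rewrite ord1 -[z]hsubmxK -(splitK l); case: (fintype.split l) => a /=.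
    rewrite row_mxEl; apply: le_trans (coord_le_norm _ _ _) _.
    by apply: le_trans (Hc _ Xz) _; rewrite -addrA lerDl addr_ge0.
  rewrite row_mxEr block_coord; set j := tagnat.sig1 a; set q := tagnat.sig2 a.
  have sq : block (rsubmx z) j 0 q ^+ 2 <= c'.
    apply: le_trans (_ : block_sqr (rsubmx z) j <= _); last first.
      rewrite Mz; apply: le_trans (ler_norm _) _; apply: le_trans (Hc' _ Xz).
      by have := coord_le_norm (\row_j f j (lsubmx z)) 0 j; rewrite mxE.
    by rewrite /block_sqr (bigD1 q) //= lerDl; apply: sumr_ge0 => ? _; exact: sqr_ge0.
  rewrite -(@ler_pXn2r _ 2) ?nnegrE ?addr_ge0 // real_normK ?num_real //.
  by apply: le_trans sq _; nra.
apply: closedI.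
  rewrite (_ : lifted = [set z | \row_j lift_form j z = 0]); last first.
    by apply/seteqP; split=> z /lift_formE.
  apply: (@preimage_closed _ _ (fun z => \row_j lift_form j z) [set 0]).
    by move=> z _; exact: (quadratic_continuous lift_quadratic).
  by apply: compact_closed; [exact: norm_hausdorff|exact: compact_set1].
apply: (@preimage_closed _ _ (fun z : 'rV[R]_k => lsubmx z) X).
  by move=> z _; exact: lsubmx_continuous.
by apply: compact_closed cX; exact: norm_hausdorff.
Qed.

Lemma lifted_over_unbounded X : X `<=` E -> (forall c, exists2 x, X x & c < `|x|) ->
  ~ compact (lifted_over X).
Proof.
move=> XE unb cL.
have : compact X.
  rewrite -(lifted_over_image XE); apply: continuous_compact cL.
  by apply: continuous_subspaceT; exact: lsubmx_continuous.
move=> /compact_norm_bound [c _ Hc]; have [x Xx] := unb c.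
by rewrite ltNge Hc.
Qed.

(** The fibre satisfies [r + n] independent equations: the [n] coordinates of x are fixed, and each
    block gives one more, its sphere equation if [f j y0] is nonzero and its first coordinate if the
    block is forced to be 0. *)
Lemma lifted_fiber_dim_le y0 : dim_le (lifted `&` [set z | lsubmx z = y0]) (m%:Z - n%:Z).
Proof.
move=> d Nn [z Nz] sN NL; have [Mz zy] := NL _ Nz; rewrite /= in zy.
pose e0 j : 'cV[R]_(ks j).+1 := delta_mx 0 0.
pose G j (z : 'rV[R]_k) : R := if f j y0 == 0 then 0 + (z *m (C j *m e0 j)) 0 0
  else (z *m C j *m (z *m C j)^T) 0 0 - (f j y0 + (z *m (0 : 'cV[R]_k)) 0 0).
pose A j (v : 'rV[R]_k) : 'cV[R]_k := if f j y0 == 0 then C j *m e0 j else C j *m (v *m C j)^T - 0.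
have GA j : squadratic (G j) (A j).
  rewrite /G /A; case: eqP => _; first exact: squadratic_affine.
  exact: squadratic_diff (squadratic_norm _) (squadratic_affine _ _).
have qF := row_mx_quadratic (squadratic_rows GA) (affine_quadratic (- y0) D).
have [dF JF] := quadratic_differential qF z.
have F0 y : Nn y -> row_mx (\row_j G j y) (- y0 + y *m D) = 0.
  move=> /NL [My yy]; rewrite base_projE yy addNr (_ : \row_j _ = 0) ?row_mx0 //.
  apply/rowP => j; rewrite !mxE /G mulmx0; case: eqP => [fj|_].
    by rewrite add0r mulmxA fib_projE block_sqr_eq0 ?mul0mx ?mxE // My yy.
  by rewrite fib_projE -block_sqr_form My yy [(0 : 'M[R]_1) _ _]mxE addr0 subrr.
have := submanifold_dim_le sN Nz dF F0; rewrite JF.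
have -> : \rank (row_mx (\matrix_(a, i) A i (z + z) a 0) D) = (r + n)%N.
  apply: rank_columns => mu; rewrite -[mu]vsubmxK mul_row_col mulmx_cols.
  set w := fun j => if f j y0 == 0 then e0 j else 2 *: (block (rsubmx z) j)^T.
  have w0 j : w j != 0.
    rewrite /w; case: (f j y0 =P 0) => [_|/eqP fj].
      by apply/eqP => /matrixP /(_ 0 0); rewrite !mxE eqxx => /eqP; rewrite oner_eq0.
    rewrite scaler_eq0 pnatr_eq0 /=; apply: contra fj => /eqP bz.
    by rewrite -zy -Mz block_sqr_form bz mulmx0 mxE.
  have -> : \sum_i usubmx mu i 0 *: col i (\matrix_(a, i) A i (z + z) a 0) =
      \sum_i usubmx mu i 0 *: (C i *m w i).
    apply: eq_bigr => i _; congr (_ *: _); apply/matrixP => a b; rewrite ord1 [LHS]mxE [LHS]mxE /A /w.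
    by case: eqP => // _; rewrite subr0 mulmxDl fib_projE linearD /= scaler_nat mulr2n.
  move=> H.
  have u0 i : usubmx mu i 0 = 0.
    move: (congr1 (mulmx (C i)^T) H); rewrite mulmx0 mulmxDr mulmxA fib_base mul0mx addr0 mulmx_sumr.
    rewrite (bigD1 i) //= big1 ?addr0 => [|j ji].
      rewrite -scalemxAr mulmxA fib_projK mul1mx => /eqP; rewrite scaler_eq0 (negbTE (w0 i)) orbF.
      by move=> /eqP.
    by rewrite -scalemxAr mulmxA fib_ortho ?mul0mx ?scaler0 // eq_sym.
  have us0 : usubmx mu = 0 by apply/colP => i; rewrite u0 mxE.
  move: H; rewrite big1 ?add0r => [H|i _]; last by rewrite u0 scale0r.
  have ds0 : dsubmx mu = 0 by rewrite -[dsubmx mu]mul1mx -base_projK -mulmxA H mulmx0.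
  by rewrite us0 ds0 col_mx0.
move: km; lia.
Qed.

Lemma lifted_fiber_spheres y0 : (forall j, 0 < f j y0) ->
  diffeomorphic (lifted `&` [set z | lsubmx z = y0]) (sphere_product ks).
Proof.
move=> f0; pose L (s : 'I_r -> R) : 'M[R]_N := \sum_j s j *: (block_proj ks j *m (block_proj ks j)^T).
have LE s (y : 'rV[R]_N) i : block (y *m L s) i = s i *: block y i.
  rewrite blockE mulmx_sumr mulmx_suml (bigD1 i) //= [X in _ + X]big1 => [|j ji].
    by rewrite addr0 -scalemxAr -scalemxAl -!mulmxA block_projK mulmx1 -blockE.
  by rewrite -scalemxAr -scalemxAl -!mulmxA block_proj_ortho // !mulmx0 scaler0.
pose rt j := Num.sqrt (f j y0).
have rt0 j : 0 < rt j by rewrite sqrtr_gt0.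
exists (fun z => 0 + z *m col_mx 0 (L (fun j => (rt j)^-1))), (fun y => row_mx y0 0 + y *m row_mx 0 (L rt)).
have hE (z : 'rV[R]_k) : 0 + z *m col_mx 0 (L (fun j => (rt j)^-1)) = rsubmx z *m L (fun j => (rt j)^-1).
  by rewrite add0r -[in LHS](hsubmxK z) mul_row_col mulmx0 add0r.
have gE y : row_mx y0 0 + y *m row_mx 0 (L rt) = row_mx y0 (y *m L rt).
  by rewrite mul_mx_row mulmx0 add_row_mx addr0 add0r.
split.
- apply: (smooth_on_open openT) => //.
  exact: (quadratic_smooth (affine_quadratic 0 (col_mx 0 (L (fun j => (rt j)^-1)))) openT).
- apply: (smooth_on_open openT) => //.
  exact: (quadratic_smooth (affine_quadratic (row_mx y0 0) (row_mx 0 (L rt))) openT).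
- move=> z [Mz /= zy]; rewrite hE gE; split.
    move=> i; rewrite -[submxrow _ _]/(block (rsubmx z *m L (fun j => (rt j)^-1)) i) LE /usphere /=.
    rewrite enormZ ger0_norm ?invr_ge0 ?ltW // /enorm -[\sum_(_ < _) _]/(block_sqr (rsubmx z) i) Mz zy.
    by rewrite mulVf // gt_eqF // rt0.
  rewrite -[RHS]hsubmxK zy; congr row_mx; apply: block_inj => i.
  by rewrite !LE scalerA divff ?scale1r // gt_eqF.
- move=> y Sy; rewrite gE hE row_mxKr; split.
    split; last by rewrite /= row_mxKl.
    move=> j; rewrite row_mxKl row_mxKr /block_sqr LE -sqr_enorm enormZ.
    by rewrite -[block y j]/(submxrow y j) (Sy j) mulr1 ger0_norm ?ltW // sqr_sqrtr // ltW.
  apply: block_inj => i.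
  by rewrite !LE scalerA mulVf ?scale1r // gt_eqF.
Qed.

(** For the dimension: at each point of the polyhedron every block has a coordinate attaining the
    norm, so [r] forms vanish besides the level equation. They are independent, and cells have
    dimension at most [k - r - 1 = m - 1]. *)
Lemma lifted_level_CW (q : 'cV[R]_n) tau (fc : 'I_r -> R) (fl : 'I_r -> 'cV[R]_n) :
  q != 0 -> (forall j x, (x *m q) 0 0 = tau -> f j x = fc j + (x *m fl j) 0 0) -> (0 < m)%N ->
  let F := lifted `&` [set z | (lsubmx z *m q) 0 0 = tau] in
  F !=set0 -> homeomorphic_to_CW_dim_le R F (m%:Z - 1).
Proof.
move=> q0 faff m0 F [z1 Fz1].
pose v j (z : 'rV[R]_k) := fc j + (lsubmx z *m fl j) 0 0.
pose X := [set z : 'rV[R]_k | (lsubmx z *m q) 0 0 = tau /\ forall j, `|block (rsubmx z) j| = v j z].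
pose bl (phi : forall d, 'rV[R]_d -> 'rV[R]_d) (z : 'rV[R]_k) : 'rV[R]_k :=
  row_mx (lsubmx z) (glue (fun j => phi _ (block (rsubmx z) j))).
have bl_cont (phi : forall d, 'rV[R]_d -> 'rV[R]_d) : (forall d, continuous (phi d)) -> continuous (bl phi).
  move=> cphi z; apply: row_mx_continuous_at; first exact: lsubmx_continuous.
  apply: glue_continuous => j.
  apply: (@continuous_comp _ _ _ (fun z : 'rV[R]_k => block (rsubmx z) j) (phi _)); last exact: cphi.
  rewrite (_ : (fun z => _) = fun z => z *m C j); first exact: mulmxr_continuous.
  by apply/funext => t; rewrite fib_projE.
have blK (phi psi : forall d, 'rV[R]_d -> 'rV[R]_d) z : (forall d w, psi d (phi d w) = w) -> bl psi (bl phi z) = z.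
  move=> H; rewrite /bl row_mxKl row_mxKr -[RHS]hsubmxK; congr row_mx.
  by apply: block_inj => j; rewrite !block_glue H.
have FX z : F z -> X (bl (@to_sup R) z).
  move=> [Mz zt]; rewrite /X /bl /v /= row_mxKl row_mxKr; split=> // j.
  by rewrite block_glue (to_supK _).1 -faff // -Mz sqr_enorm.
have XF z : X z -> F (bl (@of_sup R) z).
  move=> [zt Xz]; split; last by rewrite /bl /= row_mxKl.
  by move=> j; rewrite /bl row_mxKl row_mxKr /block_sqr block_glue -sqr_enorm (of_supK _).1 Xz faff.
apply: (homeo_CW (B := X) (h := bl (@to_sup R)) (g := bl (@of_sup R))).
- exact/bl_cont/to_sup_continuous.
- exact/bl_cont/of_sup_continuous.
- by move=> z Fz; split; [exact: FX|apply: blK => d w; exact: (to_supK w).2].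
- by move=> z Xz; split; [exact: XF|apply: blK => d w; exact: (of_supK w).2].
(* [None] is the level equation and [Some] gives the forms [v_j + y_i] and [v_j - y_i]. Membership
   in [X] depends on signs only: the level form is zero, the others are nonnegative, and for each
   [j] one of them is zero. *)
pose A : finType := option ({j : 'I_r & 'I_(ks j).+1} * bool).
pose c (a : A) : R := match a with None => - tau | Some (u, _) => fc (tag u) end.
pose sgn (b : bool) : R := (-1) ^+ b.
pose l (a : A) : 'cV[R]_k := match a with
  | None => D *m q
  | Some (u, b) => D *m fl (tag u) + sgn b *: (C (tag u) *m delta_mx (tagged u) 0)
  end.
have formN z : affine_form c l None z = (lsubmx z *m q) 0 0 - tau.
  by rewrite /affine_form /= mulmxA base_projE addrC.
have formS j (i : 'I_(ks j).+1) b z : affine_form c l (Some (Tagged (fun j => 'I_(ks j).+1) i, b)) z =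
    v j z + sgn b * block (rsubmx z) j 0 i.
  rewrite /affine_form /= mulmxDr -scalemxAr !mulmxA base_projE fib_projE mx11D mx11Z addrA.
  by rewrite -colE [(col _ _) _ _]mxE.
have normE (y w : R) : (`|y| <= w) <-> forall b, 0 <= w + sgn b * y.
  rewrite ler_norml; split=> [/andP [h1 h2] [] | H]; rewrite /sgn ?expr1 ?expr0; try by lra.
  by have := H true; have := H false; rewrite /sgn expr1 expr0 => h1 h2; apply/andP; split; lra.
have normE' (y w : R) : `|y| <= w -> (`|y| = w <-> exists b, w + sgn b * y = 0).
  move=> /[dup] yw; rewrite ler_norml => /andP [h1 h2]; split.
    by case: (ger0P y) => _ yw'; [exists true|exists false]; rewrite /sgn ?expr1 ?expr0; lra.
  move=> [b]; rewrite /sgn => H; case: (ger0P y) => y0; case: b H; rewrite ?expr1 ?expr0; lra.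
have -> : m%:Z - 1 = m.-1%:Z by lia.
apply: (@polyhedron_CW _ _ _ c l).
- by exists (bl (@to_sup R) z1); exact: FX.
- move=> z z' [zt Xz] H; have H0 a : affine_form c l a z = 0 -> affine_form c l a z' = 0.
    by move=> az; have [h1 h2] := H a; apply/le_anti; rewrite h1 ?h2 // az.
  split=> [|j].
    by have := H0 None; rewrite !formN zt subrr => /(_ erefl) /eqP; rewrite subr_eq0 => /eqP.
  have [le_v [i iv]] := (norm_coordP _ _).1 (Xz j).
  have le_v' i' : `|block (rsubmx z') j 0 i'| <= v j z'.
    apply/normE => b; rewrite -formS; apply: (H _).1; rewrite formS.
    by move/normE: (le_v i'); apply.
  apply/norm_coordP; split=> //; exists i; apply/(normE' _ _ (le_v' i)).
  by have [b hb] := (normE' _ _ (le_v i)).1 iv; exists b; rewrite -formS H0 // formS.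
move=> z [zt Xz] d B Bfree Bl.
(* One vanishing form is selected in each block: a coordinate attaining the norm, with its sign. *)
have [w Hw] : exists w : forall j, 'I_(ks j).+1 * bool,
    forall j, affine_form c l (Some (Tagged (fun j => 'I_(ks j).+1) (w j).1, (w j).2)) z = 0.
  have H j : exists p : 'I_(ks j).+1 * bool,
      affine_form c l (Some (Tagged (fun j => 'I_(ks j).+1) p.1, p.2)) z = 0.
    have [le_v [i iv]] := (norm_coordP _ _).1 (Xz j).
    by have [b hb] := (normE' _ _ (le_v i)).1 iv; exists (i, b); rewrite formS.
  by exists (fun j => sval (cid (H j))) => j; case: cid.
pose lw j := l (Some (Tagged (fun j => 'I_(ks j).+1) (w j).1, (w j).2)).
have BL : B *m row_mx (\matrix_(a, j) lw j a 0) (D *m q) = 0.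
  rewrite mul_mx_row -(row_mx0 _ d r 1); congr row_mx.
    apply/matrixP => a j; have /matrixP /(_ a 0) := Bl _ (Hw j); rewrite !mxE => BH; rewrite -[RHS]BH.
    by apply: eq_bigr => i _; rewrite mxE.
  by apply: (Bl None); rewrite formN zt subrr.
have rL : \rank (row_mx (\matrix_(a, j) lw j a 0) (D *m q)) = (r + 1)%N.
  apply: rank_columns => mu; rewrite -[mu]vsubmxK mul_row_col mulmx_cols => H.
  have u0 i : usubmx mu i 0 = 0.
    move: (congr1 (mulmx (C i)^T) H); rewrite mulmx0 mulmxDr [_ *m (D *m q *m _)]mulmxA [_ *m (D *m q)]mulmxA.
    rewrite fib_base !mul0mx addr0 mulmx_sumr.
    have colw j : (C i)^T *m col j (\matrix_(a, j) lw j a 0) =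
        sgn (w j).2 *: ((C i)^T *m C j *m delta_mx (w j).1 0).
      have -> : col j (\matrix_(a, j) lw j a 0) = lw j by apply/matrixP => a b; rewrite ord1 !mxE.
      by rewrite /lw /l mulmxDr mulmxA fib_base mul0mx add0r -scalemxAr mulmxA.
    rewrite (bigD1 i) //= [X in _ + X]big1 => [|j ji].
      rewrite addr0 -scalemxAr colw fib_projK mul1mx => /matrixP /(_ (w i).1 0).
      rewrite [LHS]mxE [X in _ * X]mxE [X in _ * (_ * X)]mxE !eqxx [RHS]mxE mulr1 => /eqP.
      by rewrite mulf_eq0 signr_eq0 orbF => /eqP.
    by rewrite -scalemxAr colw fib_ortho ?mul0mx ?scaler0 // eq_sym.
  have us0 : usubmx mu = 0 by apply/colP => i; rewrite u0 mxE.
  move: H; rewrite big1 ?add0r => [H|i _]; last by rewrite u0 scale0r.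
  have : q *m dsubmx mu = 0 by rewrite -[q]mul1mx -base_projK -!mulmxA [D *m _]mulmxA H mulmx0.
  rewrite [dsubmx mu]mx11_scalar mul_mx_scalar => /eqP; rewrite scaler_eq0 (negbTE q0) orbF => /eqP mu0.
  by rewrite us0 mu0 raddf0 col_mx0.
have := mulmx0_rank_max BL; rewrite rL (eqP Bfree); move: km; lia.
Qed.
End Lifting.

Lemma linear_smooth_ra_map (R : realType) k b (L : 'M[R]_(k, b)) (M : set 'rV[R]_k) :
  smooth_ra_map M (fun z => z *m L).
Proof.
split.
  apply: (smooth_on_open openT) => //.
  rewrite (_ : (fun z => z *m L) = fun z => 0 + z *m L); last by apply/funext => z; rewrite add0r.
  exact: (quadratic_smooth (affine_quadratic 0 L) openT).
exists (fun i => \sum_a L a i *: mpolyX R (mnm1 a)) => z _; apply/rowP => i.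
rewrite !mxE /peval raddf_sum /=; apply: eq_bigr => a _.
by rewrite mevalZ mevalXU mulrC.
Qed.

(* What the construction of the manifold needs from a family of hyperbolic
   cylinders: the domain that they bound lies over [t_1, t_l], the function x_0
   is critical on its stratified closure exactly over the t_j, and the levels
   over (t_j, t_(j+1)) are bounded iff [lambda j] is false. *)
Record level_arrangement (R : realType) (l : nat) (t : nat -> R) (lambda : nat -> bool) q r
    (xi : 'I_r -> 'cV[R]_q.+2) (a b c sg : 'I_r -> R) : Prop := LevelArrangement {
  la_xi00 : forall j, xi j ord0 0 = 0;
  la_xi_neq0 : forall j, xi j != 0;
  la_c_neq0 : forall j, c j != 0;
  la_sg : forall j, sg j = 1 \/ sg j = -1;
  la_closed_surface : forall x j, hyp_closed xi a b c x -> hyp_form xi a b c j x = 0 ->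
    hyp_surface xi a b c sg j x;
  la_transverse : forall (L : {set 'I_r}) x mu, (forall j, j \in L -> hyp_surface xi a b c sg j x) ->
    \sum_(j in L) mu j *: hyp_grad xi a b j x = 0 -> forall j, j \in L -> mu j = 0;
  la_connected : connected (hyp_open xi a b c);
  la_facet_connected : forall j, connected (hyp_facet xi a b c sg j);
  la_facet_neq0 : exists j, hyp_facet xi a b c sg j !=set0;
  la_level : forall x, hyp_closed xi a b c x -> t 1%N <= x 0 ord0 <= t l;
  la_level_neq0 : forall tau, t 1%N <= tau <= t l -> exists2 x, hyp_closed xi a b c x & x 0 ord0 = tau;
  la_critical : forall x mu s, hyp_closed xi a b c x -> s != 0 ->
    (forall j, hyp_form xi a b c j x != 0 -> mu j = 0) ->
    s *: delta_mx ord0 0 = \sum_j mu j *: hyp_grad xi a b j x ->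
    exists2 j, (1 <= j <= l)%N & x 0 ord0 = t j;
  la_vertex : forall i, (1 <= i <= l)%N -> exists x mu, [/\ hyp_closed xi a b c x, x 0 ord0 = t i,
    (forall j, hyp_form xi a b c j x != 0 -> mu j = 0) &
    delta_mx ord0 0 = \sum_j mu j *: hyp_grad xi a b j x];
  la_bounded : forall i tau, (1 <= i < l)%N -> lambda i = false -> t i < tau < t i.+1 ->
    exists M, forall x, hyp_closed xi a b c x -> x 0 ord0 = tau -> `|x| <= M;
  la_unbounded : forall i tau M, (1 <= i < l)%N -> lambda i = true -> t i < tau < t i.+1 ->
    exists x, [/\ hyp_closed xi a b c x, x 0 ord0 = tau & M < `|x|]
}.

(** * The arrangement of cylinders *)

(* Coordinates x_0, X_i, Z_i on R^n, with u = x_0 - a0.  In the coordinates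
   (u, lam) with lam_i = 1 + u X_i, the facets [inl _] bound a simplex with
   vertices at the heights T_i (twice for the lowest and the highest one); the
   facets [inr (i, _)] bound Z_i, except at the heights in [al i, be i], where
   Z_i is unbounded above. *)
Section Arrangement.
Context {R : realType}.
Variables (l' : nat) (T : nat -> R) (a0 : R).
Local Notation l := l'.+2.
Local Notation n := (l' + l'.+2).+3.
Variables (al be : 'I_l -> R).
Let T0 := T 0.
Let Tl := T l'.+1.

Definition height (x : 'rV[R]_n) : R := x 0 ord0 - a0.
Definition cX (x : 'rV[R]_n) : 'rV[R]_l := lsubmx (rsubmx (x : 'rV[R]_(1 + (l + l)))).
Definition cZ (x : 'rV[R]_n) : 'rV[R]_l := rsubmx (rsubmx (x : 'rV[R]_(1 + (l + l)))).
Definition pt_of (u : R) (X Z : 'rV[R]_l) : 'rV[R]_n :=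
  (row_mx (const_mx (u + a0) : 'rV[R]_1) (row_mx X Z) : 'rV[R]_(1 + (l + l))).

Let ord0E : (ord0 : 'I_n) = (lshift (l + l) (ord0 : 'I_1) : 'I_(1 + (l + l))).
Proof. exact: val_inj. Qed.

Lemma pt_of0 u X Z : pt_of u X Z 0 ord0 = u + a0.
Proof. by rewrite ord0E; apply: etrans (row_mxEl _ _ _ _) _; rewrite mxE. Qed.

Lemma height_pt_of u X Z : height (pt_of u X Z) = u.
Proof. by rewrite /height pt_of0 addrK. Qed.

Lemma cX_pt_of u X Z : cX (pt_of u X Z) = X.
Proof. by rewrite /cX /pt_of row_mxKr row_mxKl. Qed.

Lemma cZ_pt_of u X Z : cZ (pt_of u X Z) = Z.
Proof. by rewrite /cZ /pt_of row_mxKr row_mxKr. Qed.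

Lemma pt_of_coords x : pt_of (height x) (cX x) (cZ x) = x.
Proof.
have e1 : const_mx (height x + a0) = lsubmx (x : 'rV[R]_(1 + (l + l))).
  by apply/rowP => i; rewrite ord1 !mxE /height subrK; congr (x _ _); apply: val_inj.
rewrite /pt_of e1 /cX /cZ hsubmxK; exact: (@hsubmxK R 1 1 (l + l) x).
Qed.

(** The forms are lam_k, u - T0 - sum (T_i - T0) lam_i and Tl - u - sum (Tl - T_i) lam_i. They bound
    the simplex with vertices (T0, 0), (Tl, 0) and (T_i, e_i), where e_i are the basis vectors of
    the lam-space. *)
Definition coef (j : 'I_l + bool) (i : 'I_l) : R := match j with
  | inl k => (k == i)%:R | inr true => - (T i - T0) | inr false => - (Tl - T i) end.
Definition slope (j : 'I_l + bool) : R := match j with inl _ => 0 | inr true => 1 | inr false => -1 end.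
Definition const (j : 'I_l + bool) : R := match j with inl _ => 0 | inr true => - T0 | inr false => Tl end.
Definition sform j u (lam : 'I_l -> R) := const j + slope j * u + \sum_i coef j i * lam i.

(** The forms of a block are 1 + u Z, 1 + (u - al) Z and 1 + (be - u) Z. For u > 0 the first gives Z
    >= -1/u; the second gives Z <= 1/(al - u) below al, and the third Z <= 1/(u - be) above be.
    [side] tells on which side of its pole a form may vanish on the domain. *)
Definition eps (k : option bool) : R := if k is Some false then -1 else 1.
Definition del (i : 'I_l) (k : option bool) : R := match k with
  | None => 0 | Some true => al i | Some false => be i end.
Definition side (k : option bool) : R := if k is Some true then -1 else 1.

Definition facet : finType := (('I_l + bool) + 'I_l * option bool)%type.

Definition facet_xi (j : facet) : 'cV[R]_n := match j with
  | inl j => (col_mx (0 : 'cV[R]_1) (col_mx (\col_i coef j i) 0) : 'cV[R]_(1 + (l + l)))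
  | inr (i, k) => (col_mx (0 : 'cV[R]_1) (col_mx 0 (eps k *: delta_mx i 0)) : 'cV[R]_(1 + (l + l)))
  end.
(** Substituting lam_i = 1 + u X_i into a simplex form gives const + sum coef_i + u (slope + sum
    coef_i X_i), from which the parameters of the hyperbola are read off. *)
Definition facet_a (j : facet) : R := if j is inl j then - slope j else 0.
Definition facet_b (j : facet) : R := if j is inr (i, k) then a0 + del i k else a0.
Definition facet_c (j : facet) : R := if j is inl j then - (const j + \sum_i coef j i) else -1.
Definition facet_sg (j : facet) : R := if j is inr (_, k) then side k else 1.

Definition facet_form (j : facet) (x : 'rV[R]_n) : R := match j with
  | inl j => sform j (height x) (fun i => 1 + height x * cX x 0 i)
  | inr (i, k) => 1 + eps k * (height x - del i k) * cZ x 0 i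
  end.

Let r := #|facet|.
Let xi (j : 'I_r) := facet_xi (enum_val j).
Let a (j : 'I_r) := facet_a (enum_val j).
Let b (j : 'I_r) := facet_b (enum_val j).
Let c (j : 'I_r) := facet_c (enum_val j).
Let sg (j : 'I_r) := facet_sg (enum_val j).

Let mul_blocks (x : 'rV[R]_n) (p q : 'cV[R]_l) :
  x *m (col_mx (0 : 'cV[R]_1) (col_mx p q) : 'cV[R]_(1 + (l + l))) = cX x *m p + cZ x *m q.
Proof.
suff gen (y : 'rV[R]_(1 + (l + l))) :
  y *m col_mx 0 (col_mx p q) = lsubmx (rsubmx y) *m p + rsubmx (rsubmx y) *m q by exact: gen x.
rewrite -[in LHS](hsubmxK y) mul_row_col mulmx0 add0r.
by rewrite -[in LHS](hsubmxK (rsubmx y)) mul_row_col.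
Qed.

Let mul_xi (x : 'rV[R]_n) (j : facet) : (x *m facet_xi j) 0 0 = match j with
  | inl j => \sum_i coef j i * cX x 0 i
  | inr (i, k) => eps k * cZ x 0 i
  end.
Proof.
case: j => [j|[i k]]; rewrite /facet_xi mul_blocks mulmx0 ?addr0 ?add0r.
  by rewrite [LHS]mxE; apply: eq_bigr => i _; rewrite [(\col_i _) _ _]mxE mulrC.
by rewrite -scalemxAr mx11Z -colE [col _ _ _ _]mxE.
Qed.

Lemma facet_formE j x : hyp_form xi a b c j x = facet_form (enum_val j) x.
Proof.
rewrite /hyp_form /xi /a /b /c mul_xi; case: (enum_val j) => [k|[i k]] /=; last by rewrite /height; ring.
rewrite /sform /height; under [in RHS]eq_bigr do rewrite mulrDr mulr1 mulrCA.
by rewrite big_split -mulr_sumr /=; ring.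
Qed.

(** The derivative of [facet_form j] at [x] in the direction [v], expanded in coordinates. *)
Definition dual_grad (j : facet) (x v : 'rV[R]_n) : R := match j with
  | inl j => height x * (\sum_i coef j i * cX v 0 i) + (\sum_i coef j i * cX x 0 i + slope j) * v 0 ord0
  | inr (i, k) => eps k * ((height x - del i k) * cZ v 0 i + cZ x 0 i * v 0 ord0)
  end.

Arguments dual_grad : simpl never.

Lemma dual_gradE j x v : (v *m hyp_grad xi a b j x) 0 0 = dual_grad (enum_val j) x v.
Proof.
rewrite /hyp_grad mulmxDr -!scalemxAr mx11D !mx11Z mul_e0 /xi !mul_xi /a /b.
by case: (enum_val j) => [k|[i k]]; rewrite /dual_grad /facet_a /facet_b /height; ring.
Qed.

Lemma sum_dual_grad (mu : 'I_r -> R) x v :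
  (v *m \sum_j mu j *: hyp_grad xi a b j x) 0 0 = \sum_(j : facet) mu (enum_rank j) * dual_grad j x v.
Proof.
rewrite mulmx_sumr summxE (reindex (@enum_rank facet)) /=; last exact: onW_bij (enum_rank_bij _).
by apply: eq_bigr => j _; rewrite -scalemxAr mx11Z dual_gradE enum_rankK.
Qed.

Lemma sum_facets (F : facet -> R) : \sum_j F j =
  (\sum_i F (inl (inl i)) + (F (inl (inr true)) + F (inl (inr false)))) + \sum_i \sum_k F (inr (i, k)).
Proof. by rewrite big_sumType /= big_sumType /= big_bool pair_bigA /=; congr (_ + _); apply: eq_bigr => -[]. Qed.

(* [s] is 0 for transversality and nonzero at the critical points of x_0. *)
Lemma dependency (nu : facet -> R) x s :
  (forall v, \sum_j nu j * dual_grad j x v = s * v 0 ord0) ->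
  (forall j, nu (inl j) != 0 -> height x != 0) ->
  (forall i k k', nu (inr (i, k)) != 0 -> nu (inr (i, k')) != 0 -> k = k') ->
  (forall i k, nu (inr (i, k)) != 0 -> height x != del i k) ->
  [/\ forall i k, nu (inr (i, k)) = 0,
      forall i, nu (inl (inl i)) = nu (inl (inr true)) * (T i - T0) + nu (inl (inr false)) * (Tl - T i) &
      nu (inl (inr true)) - nu (inl (inr false)) = s].
Proof.
move=> H u0 uniq off.
have z0 i : (0 : 'rV[R]_l) 0 i = 0 by rewrite mxE.
have d0 i m : (delta_mx 0 i : 'rV[R]_l) 0 m = (m == i)%:R by rewrite mxE.
(* [pt_of] adds [a0] to its first argument, so these test vectors have no x_0-component; without
   X-part either, they see only the walls of the blocks. *)
have simplX j Z : dual_grad (inl j) x (pt_of (- a0) 0 Z) = 0.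
  by rewrite /dual_grad pt_of0 addNr cX_pt_of mulr0 addr0 big1 ?mulr0 // => i _; rewrite z0 mulr0.
have simplZ m k i : dual_grad (inr (m, k)) x (pt_of (- a0) 0 (delta_mx 0 i)) =
    eps k * (height x - del m k) * (m == i)%:R.
  by rewrite /dual_grad pt_of0 addNr cZ_pt_of mulr0 addr0 d0 mulrA.
have blocks0 i k : nu (inr (i, k)) = 0.
  apply/eqP; apply: contraT => nk; have := H (pt_of (- a0) 0 (delta_mx 0 i)).
  rewrite pt_of0 addNr mulr0 sum_facets big1 => [|m _]; last by rewrite simplX mulr0.
  rewrite !simplX !mulr0 !add0r (bigD1 i) //= [X in _ + X]big1 => [|m mi]; last first.
    by apply: big1 => m' _; rewrite simplZ (negbTE mi) !mulr0.
  rewrite addr0 (bigD1 k) //= [X in _ + X]big1 => [|m mk']; last first.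
    suff -> : nu (inr (i, m)) = 0 by rewrite mul0r.
    by apply/eqP; apply: contraT => nm; case/eqP: mk'; exact: uniq nm nk.
  rewrite addr0 simplZ eqxx mulr1 => /eqP; rewrite !mulf_eq0 (negbTE nk) /= subr_eq0.
  by rewrite (negbTE (off _ _ nk)) orbF /eps; case: k nk => [[]|] _; rewrite ?oppr_eq0 oner_eq0.
have noblocks v : \sum_i \sum_k nu (inr (i, k)) * dual_grad (inr (i, k)) x v = 0.
  by apply: big1 => i _; apply: big1 => k _; rewrite blocks0 mul0r.
(* The total coefficient of lam_i in the combination of simplex forms. Testing against the direction
   X_i shows that it vanishes, which expresses the multiplier of lam_i by those of the lower and
   upper forms. *)
pose S := fun i => \sum_k nu (inl (inl k)) * coef (inl k) i +
  (nu (inl (inr true)) * coef (inr true) i + nu (inl (inr false)) * coef (inr false) i).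
have SE v : height x * (\sum_i S i * cX v 0 i) + (\sum_i S i * cX x 0 i +
    (nu (inl (inr true)) - nu (inl (inr false)))) * v 0 ord0 = s * v 0 ord0.
  rewrite -(H v) sum_facets noblocks addr0.
  have swap (w : 'I_l -> R) : \sum_i S i * w i = \sum_k nu (inl (inl k)) * (\sum_i coef (inl k) i * w i) +
     (nu (inl (inr true)) * (\sum_i coef (inr true) i * w i) + nu (inl (inr false)) * (\sum_i coef (inr false) i * w i)).
    rewrite /S; under eq_bigr do rewrite mulrDl mulrDl mulr_suml.
    rewrite big_split /= big_split /= exchange_big /=; congr (_ + (_ + _)).
    - by apply: eq_bigr => k _; rewrite mulr_sumr; apply: eq_bigr => i _; rewrite mulrA.
    - by rewrite mulr_sumr; apply: eq_bigr => i _; rewrite mulrA.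
    - by rewrite mulr_sumr; apply: eq_bigr => i _; rewrite mulrA.
  rewrite !swap /dual_grad.
  under [in RHS]eq_bigr do rewrite addr0 mulrDr mulrCA [_ * (_ * v 0 ord0)]mulrA.
  rewrite big_split /= -mulr_sumr -mulr_suml /slope.
  by ring.
have S0 i : S i = 0.
  have [un0|un0] := eqVneq (height x) 0.
    have n0 j : nu (inl j) = 0 by apply/eqP; apply: contraT => /u0; rewrite un0 eqxx.
    by rewrite /S !n0 !mul0r !addr0 big1 // => k _; rewrite n0 mul0r.
  have := SE (pt_of (- a0) (delta_mx 0 i) 0).
  rewrite pt_of0 addNr !mulr0 addr0 (bigD1 i) //= big1 => [|m mi]; last first.
    by rewrite cX_pt_of d0 (negbTE mi) mulr0.
  by rewrite cX_pt_of d0 !eqxx mulr1 addr0 => /eqP; rewrite mulf_eq0 (negbTE un0) => /eqP.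
split=> //.
  move=> i; have := S0 i; rewrite /S (bigD1 i) //= big1 => [|k ki]; last first.
    by rewrite (negbTE ki) mulr0.
  by rewrite eqxx mulr1 addr0; lra.
have := SE (pt_of (1 - a0) 0 0); rewrite pt_of0 subrK !mulr1 !big1 ?mulr0 ?add0r //.
- by move=> i _; rewrite S0 mul0r.
- by move=> i _; rewrite S0 mul0r.
Qed.

(** * Geometry of the simplex, choice of branches and critical points *)

Hypothesis T_lt : forall i j, (i < j)%N -> (j < l)%N -> T i < T j.
Hypothesis T0_gt0 : 0 < T 0.
Hypothesis Tl_big : l%:R * (T l'.+1 - T 0) < T l'.+1.
Hypothesis al_gt0 : forall i, 0 < al i.
Hypothesis al_be : forall i, al i <= be i.
Hypothesis be_lt : forall i, be i < 2 * T 0.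

Let T_bounds (i : 'I_l) : T0 <= T i <= Tl.
Proof.
apply/andP; split.
  by case: i => -[|i] /= il; [exact: lexx|exact/ltW/T_lt].
have := ltn_ord i; rewrite ltnS leq_eqVlt => /orP [/eqP -> //|il]; exact/ltW/T_lt.
Qed.

Let T0l : T0 < Tl.
Proof. exact: T_lt. Qed.

Let T_inj (i k : 'I_l) : T i = T k -> i = k.
Proof.
move=> H; apply: val_inj; case: (ltngtP i k) => // ik.
  by have := T_lt ik (ltn_ord k); rewrite H ltxx.
by have := T_lt ik (ltn_ord i); rewrite H ltxx.
Qed.

Lemma sform_lam k u lam : sform (inl k) u lam = lam k.
Proof.
rewrite /sform mul0r !add0r (bigD1 k) //= big1 ?addr0 ?eqxx ?mul1r // => i ik.
by rewrite eq_sym (negbTE ik) mul0r.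
Qed.

Lemma sform_lo u lam : sform (inr true) u lam = u - T0 - \sum_(i < l) (T i - T0) * lam i.
Proof. by rewrite /sform /= -sumrN mul1r [- T0 + u]addrC; congr (_ + _); apply: eq_bigr => i _; rewrite mulNr. Qed.

Lemma sform_hi u lam : sform (inr false) u lam = Tl - u - \sum_(i < l) (Tl - T i) * lam i.
Proof. by rewrite /sform /= -sumrN mulN1r; congr (_ + _); apply: eq_bigr => i _; rewrite mulNr. Qed.

Let weight_sum (lam : 'I_l -> R) :
  \sum_(i < l) (T i - T0) * lam i + \sum_(i < l) (Tl - T i) * lam i = (Tl - T0) * \sum_i lam i.
Proof. by rewrite -big_split mulr_sumr /=; apply: eq_bigr => i _; ring. Qed.

(** The lower and upper forms add up to (Tl - T0) (1 - sum lam), so the nonnegative lam_i have sum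
    at most 1. *)
Lemma simplex_range u lam : (forall j, 0 <= sform j u lam) -> T0 <= u <= Tl /\ forall i, 0 <= lam i <= 1.
Proof.
move=> H; have lam0 i : 0 <= lam i by have := H (inl i); rewrite sform_lam.
have := H (inr true); have := H (inr false); rewrite sform_lo sform_hi => hi lo.
have s1 : 0 <= \sum_(i < l) (T i - T0) * lam i.
  by apply: sumr_ge0 => i _; rewrite mulr_ge0 // subr_ge0; case/andP: (T_bounds i).
have s2 : 0 <= \sum_(i < l) (Tl - T i) * lam i.
  by apply: sumr_ge0 => i _; rewrite mulr_ge0 // subr_ge0; case/andP: (T_bounds i).
split=> [|i]; first by apply/andP; split; lra.
rewrite lam0 /=; have := weight_sum lam => ws.
have : \sum_i lam i <= 1.
  by rewrite -(@ler_pM2l _ (Tl - T0)) ?subr_gt0 // mulr1 -ws; lra.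
by rewrite (bigD1 i) //=; have : 0 <= \sum_(k | k != i) lam k by [exact: sumr_ge0]; lra.
Qed.

Lemma arr_closedP x : hyp_closed xi a b c x <-> forall j, 0 <= facet_form j x.
Proof.
split=> H j; last by rewrite facet_formE.
by have := H (enum_rank j); rewrite facet_formE enum_rankK.
Qed.

Lemma arr_openP x : hyp_open xi a b c x <-> forall j, 0 < facet_form j x.
Proof.
split=> H j; last by rewrite facet_formE.
by have := H (enum_rank j); rewrite facet_formE enum_rankK.
Qed.

Lemma arr_range x : hyp_closed xi a b c x ->
  T0 <= height x <= Tl /\ forall i, 0 <= 1 + height x * cX x 0 i <= 1.
Proof. by move=> /arr_closedP H; apply: simplex_range => j; exact: (H (inl j)). Qed.

Lemma arr_level_range x : hyp_closed xi a b c x -> T0 + a0 <= x 0 ord0 <= Tl + a0.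
Proof. by move=> /arr_range [+ _]; rewrite /height lerBrDr lerBlDr. Qed.

Lemma arr_xi00 j : xi j ord0 0 = 0.
Proof.
rewrite /xi ord0E; case: (enum_val j) => [k|[i k]]; apply: etrans (col_mxEu _ _ _ _) _; exact: mxE.
Qed.

Let sum_coef_delta j m : \sum_i coef j i * (delta_mx 0 m : 'rV[R]_l) 0 i = coef j m.
Proof.
rewrite (bigD1 m) //= big1 => [|i im]; first by rewrite mxE !eqxx mulr1 addr0.
by rewrite mxE (negbTE im) andbF mulr0.
Qed.

Lemma arr_xi_neq0 j : xi j != 0.
Proof.
rewrite /xi; suff [x] : exists x : 'rV[R]_n, (x *m facet_xi (enum_val j)) 0 0 != 0.
  by apply: contra_neq => ->; rewrite mulmx0 mxE.
case: (enum_val j) => [[m|[]]|[i k]].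
- by exists (pt_of 0 (delta_mx 0 m) 0); rewrite mul_xi cX_pt_of sum_coef_delta /= eqxx oner_eq0.
- exists (pt_of 0 (delta_mx 0 ord_max) 0); rewrite mul_xi cX_pt_of sum_coef_delta /=.
  by rewrite oppr_eq0 subr_eq0 gt_eqF.
- exists (pt_of 0 (delta_mx 0 ord0) 0); rewrite mul_xi cX_pt_of sum_coef_delta /=.
  by rewrite oppr_eq0 subr_eq0 gt_eqF.
- exists (pt_of 0 0 (delta_mx 0 i)); rewrite mul_xi cZ_pt_of mxE !eqxx mulr1 /eps.
  by case: k => [[]|]; rewrite ?oppr_eq0 oner_eq0.
Qed.

(** For a simplex wall [- c j] is the value of the form at u = 0, lam = (1, ..., 1): it is 1 for
    lam_k, negative for the lower form as [T 0 > 0], and positive for the upper one exactly by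
    [Tl_big]. *)
Lemma arr_c_neq0 j : c j != 0.
Proof.
rewrite /c; case: (enum_val j) => [m|[i k]]; last by rewrite /= oppr_eq0 oner_eq0.
rewrite /= oppr_eq0; have -> : const m + \sum_i coef m i = sform m 0 (fun=> 1).
  by rewrite /sform mulr0 addr0; congr (_ + _); apply: eq_bigr => i _; rewrite mulr1.
case: m => [m|[]]; first by rewrite sform_lam oner_eq0.
  rewrite sform_lo lt_eqF //; have : 0 <= \sum_(i < l) (T i - T0) * 1.
    by apply: sumr_ge0 => i _; rewrite mulr1 subr_ge0; case/andP: (T_bounds i).
  by have := T0_gt0; rewrite -/T0; lra.
rewrite sform_hi gt_eqF //; have : \sum_(i < l) (Tl - T i) * 1 <= \sum_(i < l) (Tl - T0).
  by apply: ler_sum => i _; rewrite mulr1 lerD2l lerN2; case/andP: (T_bounds i).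
rewrite sumr_const card_ord -mulr_natl; move: Tl_big; rewrite -/T0 -/Tl; lra.
Qed.

Lemma arr_sg j : sg j = 1 \/ sg j = -1.
Proof. by rewrite /sg; case: (enum_val j) => [k|[i [[]|]]] /=; [left|right|left|left]. Qed.

Let facet_side (j : facet) (x : 'rV[R]_n) := facet_sg j * (x 0 ord0 - facet_b j).

Let facet_sideE (j : facet) (x : 'rV[R]_n) : facet_side j x = match j with
  | inl _ => height x | inr (i, k) => side k * (height x - del i k) end.
Proof.
rewrite /facet_side; case: j => [j|[i k]] /=; first by rewrite mul1r.
by congr (_ * _); rewrite /height; ring.
Qed.

(** On the wrong side of its pole a vanishing block form gives Z = -1/(u - al) with u > al, or Z =
    -1/(be - u) with u < be. Both are less than -1/u, the latter because be < 2 T0 <= 2 u, and so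
    contradict 1 + u Z >= 0; at the pole itself the form equals 1. *)
Lemma arr_closed_surface x j : hyp_closed xi a b c x -> hyp_form xi a b c j x = 0 ->
  hyp_surface xi a b c sg j x.
Proof.
move=> cx fj; split=> //; rewrite facet_formE in fj.
have [/andP [u0 _] _] := arr_range cx; have F := (arr_closedP x).1 cx.
have u_gt0 : 0 < height x := lt_le_trans T0_gt0 u0.
rewrite -[X in _ < X]/(facet_side (enum_val j) x) facet_sideE.
case: (enum_val j) fj => [//|[i k]] fj.
have := F (inr (i, None)); rewrite /= subr0 mul1r => f0.
have := al_gt0 i; have := be_lt i; rewrite -/T0 => bi ai.
case: k fj => [[]|] /=; rewrite ?mul1r ?subr0 // ?mulN1r.
- move: (height x) (cZ x 0 i) f0 u_gt0 => u z f0 u_gt0 fj; rewrite oppr_gt0 subr_lt0 ltNge; apply/negP => ua.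
  have uz : (u - al i) * z = -1 by lra.
  have : (u - al i) * (1 + u * z) = - al i.
    by rewrite mulrDr mulr1 mulrCA uz; ring.
  by have : 0 <= (u - al i) * (1 + u * z) by [rewrite mulr_ge0 // subr_ge0]; lra.
- move: u0; move: (height x) (cZ x 0 i) f0 u_gt0 => u z f0 u_gt0 u0 fj; rewrite subr_gt0 ltNge; apply/negP => ub.
  have uz : (be i - u) * z = -1 by lra.
  have : (be i - u) * (1 + u * z) = be i - 2 * u.
    by rewrite mulrDr mulr1 mulrCA uz; ring.
  by have : 0 <= (be i - u) * (1 + u * z) by [rewrite mulr_ge0 // subr_ge0]; lra.
Qed.

Let surfaceP (j : facet) x : hyp_surface xi a b c sg (enum_rank j) x ->
  facet_form j x = 0 /\ 0 < facet_side j x.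
Proof. by move=> [+ +]; rewrite facet_formE /sg /b enum_rankK. Qed.

Lemma arr_dependency (mu : 'I_r -> R) x s :
  (forall j, mu j != 0 -> hyp_surface xi a b c sg j x) ->
  s *: delta_mx ord0 0 = \sum_j mu j *: hyp_grad xi a b j x ->
  let nu j := mu (enum_rank j) in
  [/\ forall i k, nu (inr (i, k)) = 0,
      forall i, nu (inl (inl i)) = nu (inl (inr true)) * (T i - T0) + nu (inl (inr false)) * (Tl - T i) &
      nu (inl (inr true)) - nu (inl (inr false)) = s].
Proof.
move=> HS Hs nu; have Snu j : nu j != 0 -> facet_form j x = 0 /\ 0 < facet_side j x.
  by move=> /HS; exact: surfaceP.
apply: (@dependency nu x s).
- by move=> v; rewrite -sum_dual_grad -Hs -scalemxAr mx11Z mul_e0.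
- by move=> j /Snu [_]; rewrite facet_sideE => /lt0r_neq0.
(* At most one wall of a block is active: those with poles al and be require u < al and u > be, and
   either of them together with 1 + u Z = 0 would force Z = 0. *)
- have disj i k k' : nu (inr (i, k)) != 0 -> nu (inr (i, k')) != 0 ->
      match k, k' with
      | None, Some _ => False | Some true, Some false => False | _, _ => True end.
    move=> /Snu [+ +] /Snu [+ +]; rewrite !facet_sideE /=.
    have := al_gt0 i; have := al_be i; move: (height x) (cZ x 0 i) => u z; clear Hs.
    case: k k' => [[]|] [[]|] //=; rewrite ?mul1r ?mulN1r ?subr0 => ab a_gt0 f1 s1 f2 s2.
    + by lra.
    + by have : al i * z = 0 by [lra]; move=> /eqP; rewrite mulf_eq0 (gt_eqF a_gt0) => /eqP z0; rewrite z0 in f1; lra.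
    + have : (be i - 2 * u) * z = 0 by lra.
      move=> /eqP; rewrite mulf_eq0 => /orP [/eqP|/eqP z0]; first by lra.
      by rewrite z0 in f1; lra.
  move=> i k k' nk nk'; move: (disj i k k' nk nk') (disj i k' k nk' nk).
  by case: k {nk} => [[]|]; case: k' {nk'} => [[]|].
- move=> i k /Snu [_]; rewrite facet_sideE => H.
  by apply: contraTneq H => ->; rewrite subrr mulr0 ltxx.
Qed.

Let facet_neq_rank (nu : 'I_r -> R) : (forall j, nu (enum_rank j) = 0) -> forall j, nu j = 0.
Proof. by move=> H j; rewrite -[j]enum_valK. Qed.

(** With [s = 0] the lower and upper multipliers coincide, and the one of each lam_i is Tl - T0
    times their value. If this is nonzero, all facets of the simplex meet at one point, giving both
    u = T0 and u = Tl. *)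
Lemma arr_transverse (L : {set 'I_r}) x mu : (forall j, j \in L -> hyp_surface xi a b c sg j x) ->
  \sum_(j in L) mu j *: hyp_grad xi a b j x = 0 -> forall j, j \in L -> mu j = 0.
Proof.
move=> LS H; pose mu' j := if j \in L then mu j else 0.
have mu'S j : mu' j != 0 -> hyp_surface xi a b c sg j x.
  by rewrite /mu'; case: ifP => [/LS //|_]; rewrite eqxx.
have Hs : 0 *: delta_mx ord0 0 = \sum_j mu' j *: hyp_grad xi a b j x.
  rewrite scale0r -[LHS]H big_mkcond /=; apply: eq_bigr => j _; rewrite /mu'.
  by case: ifP => // _; rewrite scale0r.
have [nb nl /eqP] := arr_dependency mu'S Hs; rewrite subr_eq0 => /eqP nt.
have lamE i : mu' (enum_rank (inl (inl i))) = mu' (enum_rank (inl (inr true))) * (Tl - T0).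
  by rewrite nl nt; ring.
suff nt0 : mu' (enum_rank (inl (inr true))) = 0.
  have all0 : forall j, mu' j = 0.
    apply: facet_neq_rank => -[[i|[]]|[i k]]; [by rewrite lamE nt0 mul0r|exact: nt0|by rewrite -nt|exact: nb].
  by move=> j jL; have := all0 j; rewrite /mu' jL.
apply/eqP; apply: contraT => t0.
have lam0 i : 1 + height x * cX x 0 i = 0.
  have : mu' (enum_rank (inl (inl i))) != 0 by rewrite lamE mulf_neq0 // subr_eq0 gt_eqF.
  by move=> /mu'S /surfaceP [+ _]; rewrite /= sform_lam.
have := t0 => /mu'S /surfaceP [+ _]; rewrite /= sform_lo big1 ?subr0 => [lo|i _]; last by rewrite lam0 mulr0.
rewrite nt in t0; have := t0 => /mu'S /surfaceP [+ _]; rewrite /= sform_hi big1 ?subr0 => [hi|i _]; last by rewrite lam0 mulr0.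
by have := T0l; lra.
Qed.

(** If the multiplier [n1] or [n0] is zero, only vertices at the highest or lowest height remain. If
    neither is, both forms vanish, so sum lam = 1; the multiplier of lam_i is affine in T_i with
    nonzero slope proportional to [s], hence vanishes for a single i, and lam = e_i. *)
Lemma arr_critical x mu s : hyp_closed xi a b c x -> s != 0 ->
  (forall j, hyp_form xi a b c j x != 0 -> mu j = 0) ->
  s *: delta_mx ord0 0 = \sum_j mu j *: hyp_grad xi a b j x ->
  exists i : 'I_l, x 0 ord0 = T i + a0.
Proof.
move=> cx s0 amu Hs.
have muS j : mu j != 0 -> hyp_surface xi a b c sg j x.
  move=> mj; apply: arr_closed_surface => //; apply/eqP; apply: contraT => /amu mj0.
  by rewrite mj0 eqxx in mj.
have [_ nl nt] := arr_dependency muS Hs; clear Hs.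
set n1 := mu (enum_rank (inl (inr true))) in nl nt; set n0 := mu (enum_rank (inl (inr false))) in nl nt.
suff [i hi] : exists i : 'I_l, height x = T i by exists i; rewrite -hi /height subrK.
have lam0 (i : 'I_l) : n1 * (T i - T0) + n0 * (Tl - T i) != 0 -> 1 + height x * cX x 0 i = 0.
  by rewrite -nl => /muS /surfaceP [+ _]; rewrite /= sform_lam.
have lo0 : n1 != 0 -> height x - T0 = \sum_(i < l) (T i - T0) * (1 + height x * cX x 0 i).
  by move=> /muS /surfaceP [/eqP + _]; rewrite /= sform_lo subr_eq0 => /eqP.
have hi0 : n0 != 0 -> Tl - height x = \sum_(i < l) (Tl - T i) * (1 + height x * cX x 0 i).
  by move=> /muS /surfaceP [/eqP + _]; rewrite /= sform_hi subr_eq0 => /eqP.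
have [n10|n10] := eqVneq n1 0.
  exists ord_max; have n00 : n0 != 0 by apply: contra_neq s0 => n00; rewrite -nt n10 n00 subrr.
  have := hi0 n00; rewrite big1 => [/eqP|i _]; first by rewrite subr_eq0 => /eqP <-.
  have [->|im] := eqVneq i ord_max; first by rewrite subrr mul0r.
  rewrite lam0 ?mulr0 // n10 mul0r add0r mulf_neq0 // subr_eq0.
  by apply: contra_neq im => /esym; exact: (@T_inj i ord_max).
have [n00|n00] := eqVneq n0 0.
  exists ord0; have := lo0 n10; rewrite big1 => [/eqP|i _]; first by rewrite subr_eq0 => /eqP.
  have [->|im] := eqVneq i ord0; first by rewrite subrr mul0r.
  rewrite lam0 ?mulr0 // n00 mul0r addr0 mulf_neq0 // subr_eq0.
  by apply: contra_neq im; exact: (@T_inj i ord0).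
have sum1 : \sum_i (1 + height x * cX x 0 i) = 1.
  apply: (@mulfI _ (Tl - T0)); first by rewrite subr_eq0 gt_eqF.
  by rewrite -weight_sum -lo0 // -hi0 // mulr1; ring.
have [i li] : exists i, 1 + height x * cX x 0 i != 0.
  apply: contrapT => H; move: sum1; rewrite big1 => [/esym /eqP|i _]; first by rewrite oner_eq0.
  by apply/eqP; apply: contraT => li; case: H; exists i.
have ni : n1 * (T i - T0) + n0 * (Tl - T i) = 0.
  by apply/eqP; apply: contraT => /lam0 /eqP; rewrite (negbTE li).
have others m : m != i -> 1 + height x * cX x 0 m = 0.
  move=> mi; apply: lam0; apply: contra_neq mi => nm.
  have : s * (T m - T i) = 0.
    by rewrite -nt; transitivity (n1 * (T m - T0) + n0 * (Tl - T m) - (n1 * (T i - T0) + n0 * (Tl - T i)));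
      [ring|rewrite nm ni subrr].
  by move=> /eqP; rewrite mulf_eq0 (negbTE s0) subr_eq0 => /eqP /T_inj.
exists i; have := lo0 n10; rewrite (bigD1 i) //= big1 ?addr0 => [|m mi]; last by rewrite others ?mulr0.
move: sum1; rewrite (bigD1 i) //= big1 ?addr0 => [-> |m mi]; last exact: others.
by rewrite mulr1; lra.
Qed.

Lemma col_ext (A B : 'cV[R]_n) : (forall v : 'rV[R]_n, (v *m A) 0 0 = (v *m B) 0 0) -> A = B.
Proof. by move=> H; apply/colP => i; have := H (delta_mx 0 i); rewrite -!rowE !mxE. Qed.

Let facet_form_pt_of0 j u X : facet_form j (pt_of u X 0) = match j with
  | inl j => sform j u (fun i => 1 + u * X 0 i) | inr _ => 1 end.
Proof.
by case: j => [j|[i k]]; rewrite /facet_form height_pt_of ?cX_pt_of // cZ_pt_of [(0 : 'rV[R]_l) _ _]mxE mulr0 addr0.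
Qed.

Lemma arr_vertex (i : 'I_l) : exists x mu, [/\ hyp_closed xi a b c x, x 0 ord0 = T i + a0,
  (forall j, hyp_form xi a b c j x != 0 -> mu j = 0) &
  delta_mx ord0 0 = \sum_j mu j *: hyp_grad xi a b j x].
Proof.
have Ti : 0 < T i by apply: lt_le_trans T0_gt0 _; case/andP: (T_bounds i).
pose X : 'rV[R]_l := \row_m (if m == i then 0 else - (T i)^-1).
have lamE m : 1 + T i * X 0 m = (m == i)%:R.
  rewrite mxE; case: eqP => _; first by rewrite mulr0 addr0.
  by rewrite mulrN divff ?subrr // gt_eqF.
have sumlam (w : 'I_l -> R) : \sum_m w m * (m == i)%:R = w i.
  by rewrite (bigD1 i) //= big1 ?addr0 ?eqxx ?mulr1 // => m mi; rewrite (negbTE mi) mulr0.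
have formE j : facet_form j (pt_of (T i) X 0) = match j with
    | inl (inl m) => (m == i)%:R | inl (inr _) => 0 | inr _ => 1 end.
  rewrite facet_form_pt_of0; case: j => [[m|[]]|//]; first by rewrite sform_lam lamE.
    by rewrite sform_lo; under eq_bigr do rewrite lamE; rewrite sumlam; ring.
  by rewrite sform_hi; under eq_bigr do rewrite lamE; rewrite sumlam; ring.
(* The solution of n1 - n0 = 1 for which the multiplier of lam_i is zero, this being the one simplex
   form that does not vanish at the vertex. *)
pose n1 := (Tl - T i) / (Tl - T0); pose n0 := - ((T i - T0) / (Tl - T0)).
have d0 : Tl - T0 != 0 by rewrite subr_eq0 gt_eqF.
pose nu (j : facet) : R := match j with
  | inl (inl m) => n1 * (T m - T0) + n0 * (Tl - T m)
  | inl (inr true) => n1 | inl (inr false) => n0 | inr _ => 0 end.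
exists (pt_of (T i) X 0), (fun j => nu (enum_val j)); split.
- apply/arr_closedP => j; rewrite formE; case: j => [[m|[]]|//]; rewrite ?ler01 ?lexx //; exact: ler0n.
- by rewrite pt_of0.
- move=> j; rewrite facet_formE formE /nu; case: (enum_val j) => [[m|[]]|_] //=; rewrite ?eqxx //.
  case: (m =P i) => [->|_]; last by rewrite eqxx.
  by move=> _; rewrite /n1 /n0; field.
- apply: col_ext => v; rewrite mul_e0 sum_dual_grad.
  transitivity (\sum_j nu j * dual_grad j (pt_of (T i) X 0) v); last first.
    by apply: eq_bigr => j _; rewrite enum_rankK.
  rewrite sum_facets [X in _ + X]big1 ?addr0 => [|m _]; last by apply: big1 => k _; rewrite mul0r.
  rewrite /nu /dual_grad height_pt_of cX_pt_of.
  have sumc (m : 'I_l) (w : 'I_l -> R) : \sum_k coef (inl m) k * w k = w m.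
    rewrite /= (bigD1 m) //= big1 ?addr0 ?eqxx ?mul1r // => k km.
    by rewrite eq_sym (negbTE km) mul0r.
  under eq_bigr do rewrite !sumc addr0.
  have sumr_ (w : 'I_l -> R) : \sum_(k < l) (n1 * (T k - T0) + n0 * (Tl - T k)) * w k =
     - (n1 * \sum_k coef (inr true) k * w k + n0 * \sum_k coef (inr false) k * w k).
    by rewrite !mulr_sumr -big_split -sumrN /=; apply: eq_bigr => k _; ring.
  rewrite (eq_bigr (fun k : 'I_l => T i * ((n1 * (T k - T0) + n0 * (Tl - T k)) * cX v 0 k) +
    (n1 * (T k - T0) + n0 * (Tl - T k)) * X 0 k * v 0 ord0)); last by move=> k _; ring.
  rewrite big_split -mulr_sumr -mulr_suml /= !sumr_.
  have n10 : n1 - n0 = 1 by rewrite /n1 /n0; field.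
  transitivity ((n1 - n0) * v 0 ord0); first by rewrite n10 mul1r.
  rewrite /slope; set s1 := \sum_(_ < _) _; set s2 := \sum_(_ < _) _; set s3 := \sum_(_ < _) _; set s4 := \sum_(_ < _) _.
  by ring.
Qed.

(** The edge lam = 0 of the simplex joins (T0, 0) to (Tl, 0) and crosses every level; with Z = 0 all
    block forms equal 1. Lying on the walls of the lam_i, the point also shows that such a facet is
    nonempty. *)
Lemma arr_level_neq0 tau : T0 + a0 <= tau <= Tl + a0 ->
  exists x, [/\ hyp_closed xi a b c x, x 0 ord0 = tau & forall i, facet_form (inl (inl i)) x = 0].
Proof.
move=> /andP [t0 tl]; have u0 : 0 < tau - a0 by have := T0_gt0; rewrite -/T0; lra.
pose x := pt_of (tau - a0) (const_mx (- (tau - a0)^-1)) 0.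
have lam0 i : 1 + (tau - a0) * (const_mx (- (tau - a0)^-1) : 'rV[R]_l) 0 i = 0.
  by rewrite mxE mulrN divff ?subrr // gt_eqF.
exists x; split.
- apply/arr_closedP => j; rewrite facet_form_pt_of0; case: j => [[i|[]]|//].
  + by rewrite sform_lam lam0.
  + by rewrite sform_lo big1 => [|i _]; [lra|rewrite lam0 mulr0].
  + by rewrite sform_hi big1 => [|i _]; [lra|rewrite lam0 mulr0].
- by rewrite pt_of0 subrK.
- by move=> i; rewrite facet_form_pt_of0 sform_lam lam0.
Qed.

(** * Connectedness of the domain and of its facets *)

Let segment_mix (p q s : R) : 0 <= s <= 1 -> 0 <= p -> 0 <= q -> 0 <= p + s * (q - p).
Proof. by move=> /andP [s0 s1] p0 q0; case: (lerP p q) => pq; nra. Qed.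

Let segment_mix_gt (p q s : R) : 0 <= s <= 1 -> 0 < p -> 0 < q -> 0 < p + s * (q - p).
Proof. by move=> /andP [s0 s1] p0 q0; case: (lerP p q) => pq; nra. Qed.

Let convex_pred (P : R -> Prop) := forall p q s, 0 <= s <= 1 -> P p -> P q -> P (p + s * (q - p)).

Let const_mx_continuous_at (X : topologicalType) (g : X -> R) x : {for x, continuous g} ->
  {for x, continuous (fun t => const_mx (g t) : 'rV[R]_1)}.
Proof.
move=> cg; apply: rV_continuous_at => i k.
by rewrite (_ : (fun t => _) = g) //; apply/funext => t; rewrite mxE.
Qed.

Let pt_of_continuous_at (X : topologicalType) (g : X -> R) (p q : X -> 'rV[R]_l) x :
  {for x, continuous g} -> {for x, continuous p} -> {for x, continuous q} ->
  {for x, continuous (fun t => pt_of (g t) (p t) (q t))}.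
Proof.
move=> cg cp cq; apply: (@row_mx_continuous_at R X 1 (l + l) (fun t => const_mx (g t + a0))
  (fun t => row_mx (p t) (q t))); last exact: row_mx_continuous_at.
apply: (const_mx_continuous_at (g := fun t => g t + a0)).
by apply: (@continuousD R R X g (cst a0) x) => //; exact: cst_continuous.
Qed.

(* The Z-part is first contracted to [zeta u]; what remains is convex in the
   coordinates (u, w) with w = u X. *)
Lemma simplex_connected (A : set 'rV[R]_n) (cond : 'I_l + bool -> R -> Prop) (ok : R -> Prop)
    (zeta : R -> 'rV[R]_l) :
  (forall j, convex_pred (cond j)) -> convex_pred ok ->
  (forall u, 0 < u -> ok u -> {for u, continuous zeta}) ->
  (forall x, A x -> [/\ 0 < height x, ok (height x) & forall j, cond j (facet_form (inl j) x)]) ->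
  (forall u (X : 'rV[R]_l), 0 < u -> ok u -> (forall j, cond j (sform j u (fun i => 1 + u * X 0 i))) ->
     A (pt_of u X (zeta u))) ->
  (forall x s, A x -> 0 <= s <= 1 ->
     A (pt_of (height x) (cX x) (cZ x + s *: (zeta (height x) - cZ x)))) ->
  connected A.
Proof.
move=> Hcond Hok Hzeta HA Hcore Hpath.
pose pu (p : 'rV[R]_(1 + l)) : R := p 0 (lshift l ord0).
pose F j (p : 'rV[R]_(1 + l)) := sform j (pu p) (fun i => 1 + rsubmx p 0 i).
pose K := [set p | [/\ 0 < pu p, ok (pu p) & forall j, cond j (F j p)]].
pose phi p := pt_of (pu p) ((pu p)^-1 *: rsubmx p) (zeta (pu p)).
have pu_aff p q s : pu (p + s *: (q - p)) = pu p + s * (pu q - pu p) by rewrite /pu !mxE.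
have F_aff j p q s : F j (p + s *: (q - p)) = F j p + s * (F j q - F j p).
  rewrite /F /sform pu_aff.
  have -> : \sum_i coef j i * (1 + rsubmx (p + s *: (q - p)) 0 i) =
      \sum_i coef j i * (1 + rsubmx p 0 i) +
      s * (\sum_i coef j i * (1 + rsubmx q 0 i) - \sum_i coef j i * (1 + rsubmx p 0 i)).
    by rewrite mulrBr !mulr_sumr -sumrB -big_split /=; apply: eq_bigr => i _; rewrite !mxE; ring.
  by ring.
have cK : connected K.
  have [[z Kz]|K0] := pselect (K !=set0); last first.
    by rewrite (_ : K = set0); [exact: connected0|apply/seteqP; split=> // p Kp; apply: K0; exists p].
  apply: (star_shaped_connected (z := z)) => p s [p1 p2 p3] s01; case: Kz => z1 z2 z3.
  split; rewrite ?pu_aff; [exact: segment_mix_gt|exact: Hok|].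
  by move=> j; rewrite F_aff; apply: Hcond.
have pu_cont : continuous pu by exact: coord_continuous.
have cphi : connected (phi @` K).
  apply: connected_continuous_connected cK _; apply: continuous_in_subspaceT => p /set_mem [p1 p2 _].
  apply: pt_of_continuous_at; first exact: pu_cont.
    apply: (@continuousZ _ _ _ (fun p => (pu p)^-1) (fun p : 'rV[R]_(1 + l) => rsubmx p)).
      by apply: continuousV; [rewrite gt_eqF|exact: pu_cont].
    rewrite (_ : (fun p : 'rV[R]_(1 + l) => rsubmx p) = fun p => p *m col_mx 0 1%:M).
      exact: mulmxr_continuous.
    by apply/funext => y; rewrite -[in RHS](hsubmxK y) mul_row_col mulmx0 mulmx1 add0r.
  by apply: (@continuous_comp _ _ _ pu zeta); [exact: pu_cont|exact: Hzeta].
have phiA : phi @` K `<=` A.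
  move=> _ [p [p1 p2 p3] <-]; apply: Hcore => // j; rewrite (_ : sform _ _ _ = F j p) //.
  by congr (sform _ _ _); apply/funext => i; rewrite [X in _ * X]mxE mulrA divff ?mul1r // gt_eqF.
have toK x : A x -> exists2 p, K p & phi p = pt_of (height x) (cX x) (zeta (height x)).
  move=> /HA [x1 x2 x3].
  pose p : 'rV[R]_(1 + l) := row_mx (const_mx (height x)) (height x *: cX x).
  have pE : pu p = height x by rewrite /pu row_mxEl mxE.
  exists p; last by rewrite /phi pE /p row_mxKr scalerA mulVf ?scale1r // gt_eqF.
  split; rewrite ?pE // => j; rewrite /F pE (_ : sform _ _ _ = facet_form (inl j) x) //.
  by congr (sform _ _ _); apply/funext => i; rewrite /p row_mxKr [X in 1 + X]mxE.
have [[x1 Ax1]|A0] := pselect (A !=set0); last first.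
  by rewrite (_ : A = set0); [exact: connected0|apply/seteqP; split=> // p Kp; apply: A0; exists p].
have [p1 Kp1 _] := toK _ Ax1.
apply: (connected_star (x0 := phi p1)) => x Ax.
have [||B [cB BA B0 B1]] := @path_connected_image _ R A
    (fun s => pt_of (height x) (cX x) (cZ x + s *: (zeta (height x) - cZ x))).
- move=> s; apply: (@pt_of_continuous_at R (cst (height x)) (cst (cX x))
    (fun s : R => cZ x + s *: (zeta (height x) - cZ x))); [exact: cst_continuous|exact: cst_continuous|].
  exact: segment_continuous.
- by move=> s s01; exact: Hpath.
exists (phi @` K `|` B); split.
- have [p Kp pE] := toK _ Ax; apply: connectedU => //; exists (phi p); split; first by exists p.
  by move: B1; rewrite scale1r subrKC pE.
- by move=> y [/phiA|/BA].
- by left; exists p1.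
- by right; move: B0; rewrite scale0r addr0 pt_of_coords.
Qed.

Let facet_form_pt_of_inl j u X Z : facet_form (inl j) (pt_of u X Z) = sform j u (fun i => 1 + u * X 0 i).
Proof. by rewrite /facet_form height_pt_of cX_pt_of. Qed.

Let facet_form_pt_of_inr i k u X Z : facet_form (inr (i, k)) (pt_of u X Z) = 1 + eps k * (u - del i k) * Z 0 i.
Proof. by rewrite /facet_form height_pt_of cZ_pt_of. Qed.

Let block_segment (k z w s : R) : 1 + k * (z + s * (w - z)) = (1 + k * z) + s * ((1 + k * w) - (1 + k * z)).
Proof. by ring. Qed.

Let entry_segment (z w : 'rV[R]_l) s i : (z + s *: (w - z)) 0 i = z 0 i + s * (w 0 i - z 0 i).
Proof. by rewrite !mxE. Qed.

Lemma arr_open_connected : connected (hyp_open xi a b c).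
Proof.
have open_closed x : hyp_open xi a b c x -> hyp_closed xi a b c x by move=> H j; exact/ltW/H.
apply: (@simplex_connected _ (fun _ v => 0 < v) (fun _ => True) (fun _ => 0)).
- by move=> j p q s; exact: segment_mix_gt.
- by [].
- by move=> u _ _; exact: cst_continuous.
- move=> x Ox; have [/andP [u0 _] _] := arr_range (open_closed _ Ox).
  by split => //; [exact: lt_le_trans T0_gt0 u0|move=> j; exact: (arr_openP x).1 Ox (inl j)].
- move=> u X _ _ H; apply/arr_openP => j; rewrite facet_form_pt_of0; case: j => // j; exact: H.
- move=> x s /arr_openP Ox s01; apply/arr_openP => -[j|[i k]].
    by rewrite facet_form_pt_of_inl; exact: (Ox (inl j)).
  rewrite facet_form_pt_of_inr entry_segment [(0 : 'rV[R]_l) _ _]mxE block_segment mulr0 addr0.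
  by apply: segment_mix_gt => //; exact: (Ox (inr (i, k))).
Qed.

Lemma arr_facetP j x : hyp_facet xi a b c sg j x <->
  (forall m, 0 <= facet_form m x) /\ facet_form (enum_val j) x = 0.
Proof.
split=> [[[fj _] /arr_closedP cx]|[/arr_closedP cx fj]]; first by rewrite -facet_formE.
by split => //; apply: arr_closed_surface => //; rewrite facet_formE.
Qed.

Lemma arr_facet_connected j : connected (hyp_facet xi a b c sg j).
Proof.
have height_gt0 x : (forall m, 0 <= facet_form m x) -> 0 < height x.
  move=> /arr_closedP cx; have [/andP [u0 _] _] := arr_range cx; exact: lt_le_trans T0_gt0 u0.
have := @arr_facetP j; case Ej : (enum_val j) => [m|[i k]] HA.
  apply: (@simplex_connected _ (fun m' v => 0 <= v /\ (m' = m -> v = 0)) (fun _ => True) (fun _ => 0)).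
  - move=> m' p q s s01 [p0 p1] [q0 q1]; split; first exact: segment_mix.
    by move=> mm; rewrite p1 // q1 // subrr mulr0 addr0.
  - by [].
  - by move=> u _ _; exact: cst_continuous.
  - move=> x /HA [cx fx]; split => //; first exact: height_gt0.
    by move=> m'; split=> [|->]; [exact: cx|].
  - move=> u X _ _ H; apply/HA; split=> [m'|]; rewrite facet_form_pt_of0; last by case: (H m) => _; apply.
    by case: m' => // m'; case: (H m').
  - move=> x s /HA [cx fx] s01; apply/HA; split=> [[m'|[i' k']]|].
    + by rewrite facet_form_pt_of_inl; exact: (cx (inl m')).
    + rewrite facet_form_pt_of_inr entry_segment [(0 : 'rV[R]_l) _ _]mxE block_segment mulr0 addr0.
      by apply: segment_mix => //; exact: (cx (inr (i', k'))).
    + by rewrite facet_form_pt_of_inl.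
pose kap u := eps k * (u - del i k); pose ok u := 0 < side k * (u - del i k).
have kap0 u : ok u -> kap u != 0.
  rewrite /ok /kap /eps /side => H; rewrite mulf_neq0 //; first by case: k {HA Ej kap ok H} => [[]|]; rewrite ?oppr_eq0 oner_eq0.
  by apply: contraTneq H => ->; rewrite mulr0 ltxx.
(* On a block wall the coordinate Z_i is forced to be the opposite of the inverse of [kap u]; the
   other entries of Z can be contracted to 0. *)
pose zeta u : 'rV[R]_l := - (kap u)^-1 *: delta_mx 0 i.
have zetaE u m : zeta u 0 m = if m == i then - (kap u)^-1 else 0.
  by rewrite /zeta mxE mxE eqxx /=; case: eqP; rewrite ?mulr1 ?mulr0.
apply: (@simplex_connected _ (fun _ v => 0 <= v) ok zeta).
- by move=> m p q s; exact: segment_mix.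
- move=> p q s s01 p0 q0; rewrite /ok.
  have -> : side k * (p + s * (q - p) - del i k) =
    side k * (p - del i k) + s * (side k * (q - del i k) - side k * (p - del i k)) by ring.
  exact: segment_mix_gt.
- move=> u _ /kap0 ku; apply: (@continuousZr_tmp _ _ _ (fun u => - (kap u)^-1)).
  apply: (@continuousN _ _ _ (fun u => (kap u)^-1)); apply: continuousV => //.
  apply: (@continuousM _ _ (cst (eps k)) (fun u : R => u - del i k)); first exact: cst_continuous.
  by apply: (@continuousB _ _ _ id (cst (del i k))); [exact: cvg_id|exact: cst_continuous].
- move=> x Ax; have /HA [cx fx] := Ax; split; [exact: height_gt0| |by move=> m; exact: (cx (inl m))].
  case: Ax => [[_ +] _]; rewrite /sg /b Ej -[X in 0 < X]/(facet_side (inr (i, k)) x) facet_sideE.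
  by [].
- move=> u X u0 oku H; have [/andP [uT _] _] := simplex_range H.
  apply/HA; split=> [[m|[i' k']]|]; rewrite ?facet_form_pt_of_inl ?facet_form_pt_of_inr ?zetaE ?eqxx //; last first.
    by rewrite -/(kap u) mulrN divff ?subrr // kap0.
  case: eqP => [->|_]; last by rewrite mulr0 addr0.
  have := kap0 _ oku; move: oku; rewrite /ok /kap mulrN => oku ku.
  (* With this Z_i another form of the block equals one minus the quotient of its factor by [kap u].
     Clearing the square of [kap u] leaves polynomial inequalities, one for each pair of walls. *)
  suff H1 : 0 <= (eps k * (u - del i k) - eps k' * (u - del i k')) * (eps k * (u - del i k)).
    suff -> : 1 - eps k' * (u - del i k') / (eps k * (u - del i k)) =
      ((eps k * (u - del i k) - eps k' * (u - del i k')) * (eps k * (u - del i k))) / (eps k * (u - del i k)) ^+ 2.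
      by rewrite divr_ge0 // sqr_ge0.
    by move: (eps k * _) (eps k' * _) ku => p q p0; field.
  have := al_gt0 i; have := al_be i; have := be_lt i; rewrite -/T0.
  by case: k {HA Ej kap ok kap0 zeta zetaE ku} oku => [[]|]; case: k' => [[]|];
    rewrite /= ?mul1r ?mulN1r ?subr0 => oku h1 h2 h3; nra.
- move=> x s /HA [cx fx] s01; have zi : cZ x 0 i = zeta (height x) 0 i.
    have ku : kap (height x) != 0.
      by apply/eqP => k0; move: fx; rewrite /= -/(kap _) k0 mul0r addr0 => /eqP; rewrite oner_eq0.
    rewrite zetaE eqxx; apply: (mulfI ku); rewrite mulrN divff //.
    by move: fx; rewrite /= -/(kap _) => /eqP; rewrite addrC addr_eq0 => /eqP.
  apply/HA; split=> [[m|[i' k']]|].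
  + by rewrite facet_form_pt_of_inl; exact: (cx (inl m)).
  + rewrite facet_form_pt_of_inr entry_segment; have [->|ii] := eqVneq i' i.
      by rewrite -zi subrr mulr0 addr0; exact: (cx (inr (i, k'))).
    rewrite zetaE (negbTE ii) block_segment mulr0 addr0; apply: segment_mix => //.
    exact: (cx (inr (i', k'))).
  + by rewrite facet_form_pt_of_inr entry_segment -zi subrr mulr0 addr0.
Qed.

(** * Bounded and unbounded levels *)

Let row_mx_norm p q (u : 'rV[R]_p) (v : 'rV[R]_q) : `|row_mx u v| <= `|u| + `|v|.
Proof.
apply: norm_le_coord => [|i m]; first by rewrite addr_ge0.
rewrite ord1 -(splitK m); case: (fintype.split m) => h /=.
  by rewrite row_mxEl; apply: le_trans (coord_le_norm _ _ _) _; rewrite lerDl.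
by rewrite row_mxEr; apply: le_trans (coord_le_norm _ _ _) _; rewrite lerDr.
Qed.

Lemma arr_bounded tau : (forall i, tau - a0 < al i \/ be i < tau - a0) ->
  exists M, forall x, hyp_closed xi a b c x -> x 0 ord0 = tau -> `|x| <= M.
Proof.
move=> Htau; set u := tau - a0.
(* Z_i is at least [- u^-1] and at most the inverse distance of [u] to one of the poles, depending
   on the side; the sum of these nonnegative quantities covers all cases. *)
pose B i := u^-1 + (`|al i - u|^-1 + `|u - be i|^-1).
exists (`|tau| + (u^-1 + \sum_i B i)) => x cx xt.
have hx : height x = u by rewrite /height xt.
have [/andP [u0 _] Xr] := arr_range cx; have F := (arr_closedP x).1 cx.
have u_gt0 : 0 < u by rewrite -hx; exact: lt_le_trans T0_gt0 u0.
have B_ge0 i : 0 <= B i by rewrite !addr_ge0 // invr_ge0 // ltW.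
have X_le : `|cX x| <= u^-1.
  apply: norm_le_coord => [|i m]; first by rewrite invr_ge0 ltW.
  rewrite ord1; have := Xr m; rewrite hx => /andP [x1 x2].
  have hX : u * `|cX x 0 m| <= 1.
    by rewrite -{1}(gtr0_norm u_gt0) -normrM ler_norml; apply/andP; split; lra.
  by rewrite -[_^-1]mul1r ler_pdivlMr // mulrC.
have Z_le : `|cZ x| <= \sum_i B i.
  apply: norm_le_coord => [|i' i]; first exact: sumr_ge0.
  rewrite ord1; apply: le_trans (_ : B i <= _); last first.
    by rewrite (bigD1 i) //= lerDl; apply: sumr_ge0.
  have := F (inr (i, None)); have := F (inr (i, Some true)); have := F (inr (i, Some false)).
  rewrite /facet_form /= hx !mul1r mulN1r subr0 => h3 h2 h1.
  have lo : - u^-1 <= cZ x 0 i.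
    by rewrite -(ler_pM2l u_gt0) mulrN divff ?gt_eqF //; lra.
  have ui : 0 <= u^-1 by rewrite invr_ge0 ltW.
  have n1 : 0 <= `|al i - u|^-1 by rewrite invr_ge0.
  have n2 : 0 <= `|u - be i|^-1 by rewrite invr_ge0.
  suff up : cZ x 0 i <= `|al i - u|^-1 + `|u - be i|^-1.
    by rewrite ler_norml /B; apply/andP; split; lra.
  case: (Htau i); rewrite -/u => hu.
    have d0 : 0 < al i - u by rewrite subr_gt0.
    suff : cZ x 0 i <= `|al i - u|^-1 by lra.
    by rewrite (gtr0_norm d0) -(ler_pM2l d0) divff ?gt_eqF //; lra.
  have d0 : 0 < u - be i by rewrite subr_gt0.
  suff : cZ x 0 i <= `|u - be i|^-1 by lra.
  by rewrite (gtr0_norm d0) -(ler_pM2l d0) divff ?gt_eqF //; lra.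
rewrite -[x]pt_of_coords hx /pt_of; apply: le_trans (@row_mx_norm 1 (l + l) _ _) _; apply: lerD.
  by apply: norm_le_coord => // i m; rewrite mxE subrK.
by apply: le_trans (@row_mx_norm l l _ _) _; apply: lerD.
Qed.

(** For al <= u <= be the coefficients u, u - al and be - u of Z_i are all nonnegative, so Z_i can
    be made arbitrarily large. *)
Lemma arr_unbounded (i : 'I_l) tau M : al i <= tau - a0 <= be i -> T0 + a0 <= tau <= Tl + a0 ->
  exists x, [/\ hyp_closed xi a b c x, x 0 ord0 = tau & M < `|x|].
Proof.
move=> /andP [hal hbe] /arr_level_neq0 [y [/arr_closedP cy yt _]].
have hy : height y = tau - a0 by rewrite /height yt.
pose z := `|M| + 1; have zE m : (z *: delta_mx 0 i : 'rV[R]_l) 0 m = if m == i then z else 0.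
  by rewrite mxE mxE eqxx; case: eqP; rewrite ?mulr1 ?mulr0.
exists (pt_of (height y) (cX y) (z *: delta_mx 0 i)); split.
- apply/arr_closedP => -[j|[i' k]]; first by rewrite facet_form_pt_of_inl; exact: (cy (inl j)).
  rewrite facet_form_pt_of_inr zE; case: (i' =P i) => [->|_]; last by rewrite mulr0 addr0.
  rewrite addr_ge0 // mulr_ge0 ?addr_ge0 // hy.
  by have := al_gt0 i; case: k => [[]|] /= ?; rewrite ?mul1r ?mulN1r ?subr0; lra.
- by rewrite pt_of0 hy subrK.
- set x := pt_of _ _ _; have : cZ x 0 i = x 0 (rshift 1 (rshift l i) : 'I_(1 + (l + l))) by rewrite !mxE.
  rewrite cZ_pt_of zE eqxx => xE.
  apply: lt_le_trans (coord_le_norm x 0 (rshift 1 (rshift l i) : 'I_(1 + (l + l)))).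
  by rewrite -xE /z ger0_norm ?addr_ge0 //; have := ler_norm M; lra.
Qed.
End Arrangement.

(* The coordinate x_0 is shifted so that the heights t_j - a0 are positive and
   close to each other, relatively to their size. *)
Lemma level_arrangement_exists (R : realType) (l : nat) (t : nat -> R) (lambda : nat -> bool) :
  (1 < l)%N -> (forall j : nat, (1 <= j)%N -> (j < l)%N -> t j < t j.+1) ->
  exists q r (xi : 'I_r -> 'cV[R]_q.+3) (a b c sg : 'I_r -> R), level_arrangement l t lambda xi a b c sg.
Proof.
case: l => [|[|l']] // _ ht; pose l := l'.+2.
have t_lt i j : (i < j)%N -> (j < l)%N -> t i.+1 < t j.+1.
  elim: j => // j IH; rewrite ltnS leq_eqVlt => /orP [/eqP ->|ij] jl; first exact: ht.
  by apply: lt_trans (IH ij (ltnW jl)) _; exact: ht.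
have t_le i j : (i <= j)%N -> (j < l)%N -> t i.+1 <= t j.+1.
  by rewrite leq_eqVlt => /orP [/eqP -> //|ij] jl; exact/ltW/t_lt.
have t1l : t 1%N < t l := t_lt 0 l'.+1 isT (ltnSn _).
pose w := t l - t 1%N; have w0 : 0 < w by rewrite subr_gt0.
(* The choice gives T 0 = l w + w + 2 and T l'.+1 = T 0 + w, so that l (T l'.+1 - T 0) < T l'.+1,
   and even T l'.+1 + 1 is below 2 T 0. *)
pose a0 := t 1%N - (l%:R * w + w + 2).
pose T (i : nat) := t i.+1 - a0.
have lw : 0 < l%:R * w by rewrite mulr_gt0 // ltr0n.
have TE i : T i = t i.+1 - t 1%N + (l%:R * w + w + 2) by rewrite /T /a0; ring.
have T0E : T 0 = l%:R * w + w + 2 by rewrite TE subrr add0r.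
have TlE : T l'.+1 = l%:R * w + 2 * w + 2 by rewrite TE -/l -/w; ring.
(* Indices are shifted: T i comes from t_(i+1), so Z_i takes care of lambda(i+1). The last index
   starts no interval and is treated as bounded. *)
pose lam (i : 'I_l) := (i < l'.+1)%N && lambda i.+1.
(* If Z_i is to stay bounded, both poles are put at a height above the whole domain. *)
pose al i := if lam i then T i else T l'.+1 + 1.
pose be (i : 'I_l) := if lam i then T i.+1 else T l'.+1 + 1.
have T_lt i j : (i < j)%N -> (j < l)%N -> T i < T j by move=> ij jl; rewrite ltrD2r; exact: t_lt.
have T_le i j : (i <= j)%N -> (j < l)%N -> T i <= T j by move=> ij jl; rewrite lerD2r; exact: t_le.
have T0_gt0 : 0 < T 0 by lra.
have T_gt0 (i : 'I_l) : 0 < T i by apply: lt_le_trans T0_gt0 (T_le 0 i _ _).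
have Tl_big : l%:R * (T l'.+1 - T 0) < T l'.+1.
  by rewrite (_ : T l'.+1 - T 0 = w); [lra|rewrite TlE T0E; ring].
have al_gt0 i : 0 < al i by rewrite /al; case: ifP => // _; lra.
have al_be i : al i <= be i.
  by rewrite /al /be; case: ifP => // /andP [il _]; apply: T_le.
have be_lt i : be i < 2 * T 0.
  rewrite /be; case: ifP => [/andP [il _]|_]; last by lra.
  by have := T_le i.+1 l'.+1 il (ltnSn _); lra.
have shift i : T i + a0 = t i.+1 by rewrite subrK.
pose r := #|facet l'|.
exists (l' + l'.+2)%N, r, (fun j => facet_xi T (enum_val j)), (fun j => facet_a (enum_val j)),
  (fun j => facet_b a0 al be (enum_val j)), (fun j => facet_c T (enum_val j)), (fun j => facet_sg (enum_val j)).
have t_of (i : nat) : (1 <= i <= l)%N -> exists2 k : 'I_l, t i = T k + a0 & i = k.+1.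
  by case: i => // i /= il; exists (Ordinal il) => //; rewrite shift.
split.
- exact: arr_xi00.
- exact: arr_xi_neq0.
- exact: arr_c_neq0.
- exact: arr_sg.
- exact: arr_closed_surface.
- exact: arr_transverse.
- exact: arr_open_connected.
- exact: arr_facet_connected.
- have [|x [cx _ x0]] := @arr_level_neq0 R l' T a0 al be T0_gt0 (t 1%N).
    by rewrite !shift lexx ltW.
  exists (enum_rank (inl (inl ord0) : facet l')), x.
  apply/arr_facetP => //; rewrite enum_rankK; split => //; exact/arr_closedP.
- by move=> x /(arr_level_range T_lt); rewrite !shift.
- move=> tau taul; have [|x [cx xt _]] := @arr_level_neq0 R l' T a0 al be T0_gt0 tau.
    by rewrite !shift.
  by exists x.
- move=> x mu s cx s0 amu /(arr_critical T_lt T0_gt0 al_gt0 al_be be_lt cx s0 amu) [i ->].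
  by exists i.+1; [exact: ltn_ord|exact: shift].
- by move=> i /t_of [k -> _]; exact: arr_vertex.
- move=> i tau /andP [i1 il] li /andP [ti tS]; apply: arr_bounded => // k.
  rewrite /al /be; case: ifP => [/andP [kl lk]|_]; last first.
    left; have := t_le i l'.+1 il (ltnSn _); have := T0_gt0; rewrite /T; lra.
  have [ki|ki] := ltnP k.+1 i; last first.
    left; rewrite ltrD2r; apply: lt_le_trans tS _; apply: t_le; last exact: ltnW.
    by move: ki; rewrite leq_eqVlt => /orP [/eqP E|//]; rewrite -E li in lk.
  right; rewrite ltrD2r; apply: le_lt_trans ti.
  by case: i {li tS i1} il ki => // i il ki; apply: t_le => //; exact: ltnW.
- move=> i tau M /andP [i1 il] li /andP [ti tS].
  case: i i1 il li ti tS => // i _ il li ti tS.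
  pose k : 'I_l := Ordinal (ltnW il : (i < l)%N).
  have lk : lam k by rewrite /lam /= li andbT; exact: il.
  apply: (@arr_unbounded R l' T a0 al be T0_gt0 al_gt0 k) => //.
    by rewrite /al /be lk /= !lerD2r !ltW.
  rewrite !shift; apply/andP; split; apply: ltW.
    by apply: le_lt_trans ti; apply: t_le => //; exact: ltnW.
  by apply: lt_le_trans tS _; apply: (t_le i.+1 l'.+1).
Qed.

(** * The construction *)

(* The numbers t_1 < ... < t_l are [t 1], ..., [t l], and [lambda j] is used only
   for 1 <= j <= l - 1; the ambient dimension n >= 3 is [n0.+3]. *)
Theorem theorem1 (R : realType) (l : nat) (t : nat -> R) (lambda : nat -> bool)
    (hl : (1 < l)%N)
    (ht : forall j : nat, (1 <= j)%N -> (j < l)%N -> t j < t j.+1) :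
  exists m0 : nat, forall m : nat, (m0 <= m)%N ->
  exists (k : nat) (M : set 'rV[R]_k) (f : 'rV[R]_k -> R) (n0 : nat),
  let n := n0.+3 in
  exists (r : nat) (p : 'I_r -> mpoly n R) (S : 'I_r -> set 'rV[R]_n)
         (D : set 'rV[R]_n) (fD : 'rV[R]_k -> 'rV[R]_n),
  let f1 : 'rV[R]_k -> 'rV[R]_1 := fun x => const_mx (f x) in
  [/\ nonsingular_ra_manifold m M, connected M, smooth_ra_map M f1,
      NC_set p S D & smooth_ra_map M fD] /\
  (* (1) *)
  (f @` M = [set x | t 1%N <= x <= t l] /\
   f @` singular_set m M f1 = [set t j | j in [set j : nat | (1 <= j <= l)%N]]) /\
  (* (2) *)
  (forall y : R, (f @` M) y ->
     connected (fiber M f y) /\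
     homeomorphic_to_CW_dim_le R (fiber M f y) (m%:Z - 1)) /\
  (* (3) *)
  (forall j : nat, (1 <= j)%N -> (j < l)%N -> forall y : R, t j < y < t j.+1 ->
     (exists d : nat, submanifold d (fiber M f y)) /\
     (lambda j = false -> compact (fiber M f y)) /\
     (lambda j = true -> ~ compact (fiber M f y))) /\
  (* (4) *)
  (forall x, M x -> f x = fD x 0 ord0) /\
  (* (5) *)
  ((exists g : 'I_r -> mpoly k R,
      nonsingular_by g m M /\ is_component (zeros g) M) /\
   fD @` M = closure D /\
   fD @` singular_set m M fD = closure D `\` D /\
   forall y : 'rV[R]_n,
     dim_le (fiber M fD y) (m%:Z - n%:Z) /\
     (D y ->
        (exists d : nat, submanifold d (fiber M fD y)) /\
        exists (q : nat) (ks : 'I_q -> nat),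
          (0 < q)%N /\ diffeomorphic (fiber M fD y) (sphere_product ks))) /\
  (* (6) *)
  ((exists (N : nat) (B : 'I_N -> set 'rV[R]_n),
      closure D `\` D = \bigcup_i B i /\
      forall i, [/\ B i !=set0, connected (B i),
                    submanifold_corners (n - 1) (B i) &
                    exists j, B i `<=` S j]) /\
   forall j, exists g : mpoly n R,
     (mmeasure mdeg g <= 3)%N /\
     is_component (zeros (fun _ : 'I_1 => g)) (S j)) /\
  (* (7) *)
  (forall j, hyperbola_cylinder n0.+1 (S j)).
Proof.
have t_mono i j : (1 <= i)%N -> (i <= j)%N -> (j <= l)%N -> t i <= t j.
  move=> i1; elim: j => [|j IH] ij jl; first by move: (leq_trans i1 ij).
  move: ij; rewrite leq_eqVlt => /orP [/eqP ->//|]; rewrite ltnS => ij.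
  by apply: (le_trans (IH ij (ltnW jl))); apply/ltW/ht => //; exact: leq_trans i1 ij.
have [q [r [xi [a [b [c [sg H]]]]]]] := level_arrangement_exists lambda hl ht.
have := la_xi00 H; have := la_xi_neq0 H; have := la_c_neq0 H; have := la_sg H.
move=> sg1 c_neq0 xi_neq0 xi00.
have closed_surface := la_closed_surface H; have transverse := la_transverse H.
have open_conn := la_connected H.
have [jf facet_neq0] := la_facet_neq0 H.
have r_gt0 : (0 < r)%N by apply: leq_ltn_trans (ltn_ord jf).
pose n := q.+3; set D := hyp_open xi a b c; set S := hyp_surface xi a b c sg.
pose E := hyp_closed xi a b c.
have clE : closure D = E := hyp_closure closed_surface transverse.
exists (n + r)%N => m nrm.
(* All blocks are circles except that of [jf], which absorbs the remaining dimension; the total is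
   [m - n]. The bound [n + r] on [m] is what leaves dimension at least 1 to each of the [r]
   spheres. *)
pose ks (j : 'I_r) := (1 + (if j == jf then m - (n + r) else 0))%N.
have ks0 j : (0 < ks j)%N by [].
set N := (\sum_(j < r) (ks j).+1)%N.
have NE : N = (r + (m - n))%N.
  rewrite /N (eq_bigr (fun j => 2 + (if j == jf then m - (n + r) else 0)))%N //.
  rewrite big_split /= sum_nat_const card_ord -big_mkcond /= big_pred1_eq.
  by move: nrm; lia.
have km : (n + N)%N = (r + m)%N by rewrite NE; move: nrm; lia.
have m0 : (0 < m)%N by move: nrm r_gt0; lia.
pose F j := hyp_form xi a b c j; pose sl j := hyp_slope xi a b j.
have Fq j : squadratic (F j) (sl j) := hyp_form_squadratic xi a b c j.
have indep (x : 'rV[R]_n) (mu : 'I_r -> R) : E x -> (forall j, F j x != 0 -> mu j = 0) ->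
    \sum_j mu j *: sl j (x + x) = 0 -> forall j, mu j = 0.
  move=> Ex amu s0 j; have [Fj|/amu //] := eqVneq (F j x) 0.
  apply: (transverse [set j | F j x == 0]%SET x mu); last by rewrite inE Fj.
    by move=> i; rewrite inE => /eqP Fi; exact: closed_surface.
  rewrite -[RHS]s0 big_mkcond /=; apply: eq_bigr => i _; rewrite inE /sl hyp_slope_grad.
  by case: eqP => // /eqP /amu ->; rewrite scale0r.
have fpoly j : exists P : mpoly (n + N) R, forall z, peval P z = F j (lsubmx z).
  exists (@hyp_poly R (q.+1 + N) r (fun j => col_mx (xi j) 0) a b c j) => z.
  rewrite peval_hyp_poly /hyp_form /F /hyp_form.
  rewrite -[in (z *m _)](hsubmxK z) mul_row_col mulmx0 addr0; congr ((_ - _) * _ - _).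
  by rewrite mxE; congr (z _ _); apply: val_inj.
pose M := @lifted R n r ks F; pose DD := base_proj (R := R) n ks.
have subM := lifted_manifold Fq indep km.
have [g [nsg zg]] := lifted_polynomials Fq indep km fpoly.
have Ms x : E x -> M (lift_section ks F x) /\ lsubmx (lift_section ks F x) = x := @lift_sectionP _ _ _ ks F x.
have ME z : M z -> E (lsubmx z) := @lifted_base _ _ _ _ F z.
have cM : connected M.
  apply: (lifted_connected Fq ks0); rewrite -[[set _ | _]]/E -clE.
  exact: connected_closure.
have [z0 Mz0] : exists z, M z.
  have [x [_ Ex]] := facet_neq0; exists (lift_section ks F x); exact: (Ms _ Ex).1.
pose f (z : 'rV[R]_(n + N)) := z 0 (lshift N ord0).
pose fD (z : 'rV[R]_(n + N)) : 'rV[R]_n := lsubmx z.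
have fE z : f z = fD z 0 ord0 by rewrite mxE.
pose q0 : 'cV[R]_n := delta_mx ord0 0.
have q0E x : (x *m q0) 0 0 = x 0 ord0 := mul_e0 x.
have f1E : (fun z => const_mx (f z) : 'rV[R]_1) = fun z => z *m (DD *m q0).
  apply/funext => z; apply/rowP => i; rewrite ord1 mulmxA base_projE q0E [LHS]mxE; exact: fE.
have fDE : fD = fun z => z *m (DD *m 1%:M).
  by apply/funext => z; rewrite mulmx1 base_projE.
pose slice tau := [set x | E x /\ x 0 ord0 = tau].
have slice_aff j tau x : (x *m q0) 0 0 = tau ->
    F j x = ((tau - b j) * - a j - c j) + (x *m ((tau - b j) *: xi j)) 0 0.
  rewrite q0E /F /hyp_form => ->; rewrite -scalemxAr mx11Z; ring.
have slice_connected tau : connected (slice tau).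
  have [[z [Ez ztau]]|S0] := pselect (slice tau !=set0); last first.
    by rewrite (_ : slice tau = set0); [exact: connected0|apply/seteqP; split=> // x Sx; apply: S0; exists x].
  apply: (star_shaped_connected (z := z)) => y s [Ey ytau] /andP [s0 s1].
  have wtau : (z + s *: (y - z)) 0 ord0 = tau by rewrite !mxE ztau ytau subrr mulr0 addr0.
  split=> // j; have := Ez j; have := Ey j.
  rewrite -/(F j y) -/(F j z) -/(F j (z + s *: (y - z))) !(slice_aff j tau) ?q0E //.
  by rewrite mulmxDl -scalemxAl mulmxBl mx11D mx11Z mx11B; nra.
have fiberE tau : fiber M f tau = lifted_over F (slice tau).
  apply/seteqP; split=> z [Mz zt]; split=> //.
    by split; [exact: ME|apply: etrans zt; rewrite fE].
  by case: zt => _ zt; apply: etrans zt; exact: fE.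
have sliceE tau : slice tau `<=` E by move=> x [].
have indep1 (x : 'rV[R]_n) : E x -> (forall i, (1 <= i <= l)%N -> x 0 ord0 <> t i) ->
    forall mu (nu : 'cV[R]_1), (forall j, F j x != 0 -> mu j = 0) ->
    q0 *m nu = \sum_j mu j *: sl j (x + x) -> nu = 0.
  move=> Ex nt mu nu amu; rewrite [nu]mx11_scalar mul_mx_scalar => HQ.
  have [->|nu0] := eqVneq (nu 0 0) 0; first by rewrite raddf0.
  have [|i i1 xi1] := la_critical H Ex nu0 amu; last by case: (nt i i1).
  by rewrite [LHS]HQ; apply: eq_bigr => j _; rewrite /sl hyp_slope_grad.
exists (n + N)%N, M, f, q, r, (hyp_poly xi a b c), S, D, fD; rewrite /= f1E.
have facet_corners j : submanifold_corners (n - 1) (hyp_facet xi a b c sg j) :=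
  @hyp_facet_corners _ _ _ _ _ _ _ _ closed_surface transverse j.
split.
  split => //; first by exists r, g.
  - exact: linear_smooth_ra_map.
  - exact: hyp_NC_set.
  - rewrite fDE; exact: linear_smooth_ra_map.
split.
  split.
    apply/seteqP; split=> [_ [z Mz <-]|tau /(la_level_neq0 H) [x Ex <-]].
      by rewrite /= fE; apply: (la_level H); exact: ME.
    by have [Mx sx] := Ms _ Ex; exists (lift_section ks F x) => //; rewrite fE /fD sx.
  apply/seteqP; split=> [_ [z [Mz [W [phi [w [lp rk]]]]] <-]|_ [i i1 <-]].
    have := rk; rewrite (minn_idPr m0) => /(lift_singular Fq indep km _ lp) [mu [nu [nu0 amu HQ]]].
    have [[i i1 zi]|nt] := pselect (exists2 i, (1 <= i <= l)%N & lsubmx z 0 ord0 = t i).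
      by exists i => //; rewrite fE.
    case/eqP: nu0; apply: (indep1 (lsubmx z) (ME _ Mz) _ mu) => // i i1 zi; apply: nt; by exists i.
  have [x [mu [Ex xt amu Hmu]]] := la_vertex H i1.
  have [Mx sx] := Ms _ Ex; exists (lift_section ks F x); last by rewrite fE /fD sx.
  split=> //; have [W [phi [w lp]]] := subM _ Mx; exists W, phi, w; split => //.
  rewrite (minn_idPr m0); apply/(lift_singular Fq indep km _ lp); rewrite sx.
  exists mu, 1%:M; split => //; first exact: matrix_nonzero1.
  by rewrite mulmx1 /q0 Hmu; apply: eq_bigr => j _; rewrite /sl hyp_slope_grad.
split.
  move=> y [z Mz zy]; rewrite fiberE; split.
    exact: (lifted_over_connected Fq ks0).
  have -> : @lifted_over R n r ks F (slice y) = M `&` [set z | (lsubmx z *m q0) 0 0 = y].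
    rewrite -fiberE; apply/seteqP; split=> z' [Mz' zy']; split => //; first by rewrite /mkset q0E -zy' fE.
    by move: zy'; rewrite /mkset q0E -fE.
  apply: (lifted_level_CW km _ (fun j x => @slice_aff j y x)) => //.
    by apply/eqP => /matrixP /(_ ord0 0); rewrite !mxE eqxx => /eqP; rewrite oner_eq0.
  by exists z; split => //=; rewrite q0E -zy fE.
split.
  move=> j j1 jl y /andP [jy yj].
  have y_neq i : (1 <= i <= l)%N -> y <> t i.
    move=> /andP [i1 il] yi; have [ij|ij] := leqP i j.
      by have := t_mono i j i1 ij (ltnW jl); rewrite -yi leNgt jy.
    by have := t_mono j.+1 i isT ij il; rewrite -yi leNgt yj.
  split; [|split].
  - exists m.-1; have -> : fiber M f y = M `&` [set z | lsubmx z *m q0 = const_mx y].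
      apply/seteqP; split=> z [Mz zy]; split => //.
        by apply/rowP => i; rewrite ord1 q0E [RHS]mxE -zy fE.
      by move/rowP/(_ 0): zy; rewrite q0E [in RHS]mxE -fE.
    apply: (lifted_submanifold Fq indep); first by move: km m0; lia.
    move=> x Ex xy; apply: indep1 => // i i1 xt; apply: (y_neq i i1).
    by rewrite -xt -q0E xy mxE.
  - move=> lj; rewrite fiberE; apply: (lifted_over_compact Fq).
    apply: bounded_closed_compact.
      have [||B HB] := la_bounded (tau := y) H _ lj; [by rewrite j1|by rewrite jy|].
      exists B; split; first exact: num_real.
      by move=> B' BB' x [Ex xy]; apply: le_trans (HB x Ex xy) (ltW BB').
    apply: closedI; first by rewrite -clE; exact: closed_closure.
    apply: (@preimage_closed _ _ (fun x : 'rV[R]_n => x 0 ord0) [set y]); last exact: closed_eq.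
    by move=> x _; exact: coord_continuous.
  - move=> lj; rewrite fiberE; apply: (lifted_over_unbounded (@sliceE y)) => B.
    have [||x [Ex xy Bx]] := @la_unbounded _ _ _ _ _ _ _ _ _ _ _ H j y B _ lj.
    + by rewrite j1.
    + by rewrite jy.
    + by exists x.
split; first by move=> x _; exact: fE.
split.
  split.
    exists g; split => //; case: (nsg) => uc _ _ _; exact: is_component_union uc cM Mz0.
  split.
    rewrite clE; apply/seteqP; split=> [_ [z Mz <-]|x Ex]; first exact: ME.
    by have [Mx sx] := Ms _ Ex; exists (lift_section ks F x).
  split.
    have nm : (n <= m)%N by move: nrm; lia.
    rewrite fDE; apply/seteqP; split=> [_ [z [Mz [W [phi [w [lp rk]]]]] <-]|x].
      have := rk; rewrite (minn_idPr nm) => /(lift_singular Fq indep km _ lp) [mu [nu [nu0 amu HQ]]].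
      rewrite mulmx1 base_projE clE; split; first exact: ME.
      move=> Dz; case/eqP: nu0; rewrite -[nu]mul1mx HQ big1 // => j _.
      by rewrite amu ?scale0r // gt_eqF // Dz.
    rewrite clE => -[Ex nDx]; have [j Fj] : exists j, F j x = 0.
      apply: contrapT => nF; apply: nDx => j; rewrite lt_def Ex andbT.
      by apply/eqP => Fj; apply: nF; exists j.
    have [Mx sx] := Ms _ Ex; exists (lift_section ks F x); last by rewrite mulmx1 base_projE sx.
    split=> //; have [W [phi [w lp]]] := subM _ Mx; exists W, phi, w; split => //.
    rewrite (minn_idPr nm); apply/(lift_singular Fq indep km _ lp); rewrite sx.
    (* Here [Q] is the identity, so the gradient of a form vanishing at [x] is itself a nonzero
       combination of active gradients. *)
    exists (fun i => (i == j)%:R), (hyp_grad xi a b j x); split.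
    - exact: (hyp_grad_neq0 xi00 xi_neq0 c_neq0 Fj).
    - by move=> i; case: (i =P j) => // ->; rewrite Fj eqxx.
    - rewrite mul1mx (bigD1 j) //= big1 ?addr0; first by rewrite eqxx scale1r /sl hyp_slope_grad.
      by move=> i ij; rewrite (negbTE ij) scale0r.
  move=> y; split; first exact: (lifted_fiber_dim_le (f := F) km).
  move=> Dy; split; last by exists r, ks; split => //; exact: lifted_fiber_spheres.
  exists (m - n)%N; have -> : fiber M fD y = M `&` [set z | lsubmx z *m 1%:M = y].
    by apply/seteqP; split=> z [Mz zy]; split => //; move: zy; rewrite /= mulmx1.
  apply: (lifted_submanifold Fq indep); first by move: km nrm; lia.
  move=> x Ex; rewrite mulmx1 => -> mu nu amu; rewrite mul1mx => ->.
  by rewrite big1 // => j _; rewrite amu ?scale0r // gt_eqF // Dy.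
split; last exact: hyp_surface_cylinder.
split.
  (* The pieces must be nonempty: an index whose facet is empty receives the facet of [jf] once
     more, which leaves the union unchanged. *)
  exists r, (fun j => if pselect (hyp_facet xi a b c sg j !=set0) then hyp_facet xi a b c sg j
    else hyp_facet xi a b c sg jf); split.
    rewrite (hyp_boundary closed_surface transverse); apply/seteqP; split=> x [j _ Bx].
      by exists j => //; case: (pselect _) => // -[]; exists x.
    by move: Bx; case: (pselect _) => Pj /= Bx; [exists j|exists jf].
  move=> j; case: (pselect _) => Bj /=; split => //; try exact: (la_facet_connected H).
    by exists j => x [].
  by exists jf => x [].
move=> j; exists (hyp_poly xi a b c j); split; first exact: hyp_poly_size.
exact: hyp_surface_component.
Qed.
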